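(* Let $\Theta$ be an atomless Borel probability measure on $[0,\infty)$ such that $0\in\operatorname{supp}\Theta$. For every $L>1$, there is a realisation $(S,d,\mu)$ of $\Theta$ such that $\operatorname{supp}\mu=S$ and $d$ is $L$-bi-Lipschitz equivalent to an ultrametric $u$ on $S$. In fact, $$u(x,y)\le d(x,y)\le L\,u(x,y),\qquad x,y\in S.$$ If $\Theta$ has bounded support, then (in addition to these properties) $S$ may be chosen compact and homeomorphic to the Cantor space. In this case, $$\{d(x,y):x,y\in S\}=\operatorname{supp}\Theta,\qquad \operatorname{diam}S=\max\operatorname{supp}\Theta.$$ If $\Theta$ has unbounded support, then (in addition to the properties in the first two sentences above) $S$ may be chosen proper and homeomorphic to a countable disjoint union of Cantor spaces.
   Context: A realisation of a Borel probability measure $\Theta$ on $[0,\infty)$ is a triple $(S,d,\mu)$ where $(S,d)$ is a complete separable metric space and $\mu$ is a probability measure on the Borel $\sigma$-field generated by its metric topology, such that if $X,Y$ are independent random elements with common law $\mu$ then $d(X,Y)$ has distribution $\Theta$. For a finite Borel measure on $[0,\infty)$, atomless means that every singleton has measure zero. The support of a Borel measure $\nu$ on a topological space is $\operatorname{supp}\nu=\{x:\nu(U)>0\text{ for every open neighbourhood }U\text{ of }x\}$. Two metrics $d,u$ on a set $S$ are $L$-bi-Lipschitz equivalent ($L\ge1$) if $L^{-1}u(x,y)\le d(x,y)\le Lu(x,y)$ for all $x,y\in S$. An ultrametric is a metric $u$ with $u(x,z)\le\max\{u(x,y),u(y,z)\}$ for all $x,y,z$. A metric space is proper if every closed bounded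 subset is compact. The diameter of $S$ is taken with respect to $d$, and topological statements refer to the metric topology of $(S,d)$. The Cantor space is the product space $\{0,1\}^{\mathbb N}$; disjoint unions of Cantor spaces carry the disjoint-union topology. *)

(* Defs.v *)
From HB Require Import structures.
From mathcomp Require Import all_boot all_order all_algebra.
From mathcomp Require Import all_classical all_reals all_analysis.

Set Implicit Arguments.
Unset Strict Implicit.
Unset Printing Implicit Defensive.

Import Order.TTheory GRing.Theory Num.Theory.
Import numFieldNormedType.Exports.

Local Open Scope classical_set_scope.
Local Open Scope ring_scope.

#[short(type="completeMetricType")]
HB.structure Definition CompleteMetric (R : numDomainType) :=
  {T of Complete T & Metric R T}.

Definition separable (T : topologicalType) : Prop :=
  exists2 D : set T, countable D & dense D.

Notation borel T := (g_sigma_algebraType (@open T)).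

Definition msupp (R : realType) (T : topologicalType)
    (nu : set T -> \bar R) : set T :=
  [set x | forall U : set T, open U -> U x -> (0 < nu U)%E].

Definition atomless (R : realType) (T : Type) (nu : set T -> \bar R) : Prop :=
  forall x, nu [set x] = 0%E.

Definition independent_rv d d1 d2 (Omega : measurableType d)
    (T1 : measurableType d1) (T2 : measurableType d2) (R : realType)
    (P : probability Omega R) (X : {RV P >-> T1}) (Y : {RV P >-> T2}) : Prop :=
  forall (A : set T1) (B : set T2), measurable A -> measurable B ->
    P (X @^-1` A `&` Y @^-1` B) = (P (X @^-1` A) * P (Y @^-1` B))%E.

(* Laws are compared on measurable sets only: values of a probability outside
   its sigma-algebra carry no information. *)
Definition has_law d d' (T : measurableType d) (T' : measurableType d')
    (R : realType) (P : probability T R) (X : T -> T')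
    (nu : set T' -> \bar R) : Prop :=
  measurable_fun [set: T] X /\
  forall A : set T', measurable A -> P (X @^-1` A) = nu A.

(* Completeness of the space is part of the type of S. *)
Definition realisation (R : realType) (Theta : probability (measurableTypeR R) R)
    (S : completeMetricType R) (mu : probability (borel S) R) : Prop :=
  separable S /\
  forall (d : measure_display) (Omega : measurableType d)
    (P : probability Omega R) (X Y : {RV P >-> borel S}),
    has_law P X mu -> has_law P Y mu -> independent_rv X Y ->
    has_law P (fun w => mdist (X w : S) (Y w : S) : measurableTypeR R) Theta.

Definition is_metric (R : realType) (S : Type) (u : S -> S -> R) : Prop :=
  [/\ forall x y, 0 <= u x y,
      forall x y, u x y = 0 <-> x = y,
      forall x y, u x y = u y x &
      forall x y z, u x z <= u x y + u y z].

Definition is_ultrametric (R : realType) (S : Type) (u : S -> S -> R) : Prop :=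
  is_metric u /\ forall x y z, u x z <= Num.max (u x y) (u y z).

Definition bilipschitz_equiv (R : realType) (S : Type) (L : R)
    (d u : S -> S -> R) : Prop :=
  forall x y, L^-1 * u x y <= d x y <= L * u x y.

Definition full_ultrametric_realisation (R : realType) (L : R)
    (Theta : probability (measurableTypeR R) R)
    (S : completeMetricType R) (mu : probability (borel S) R) : Prop :=
  [/\ realisation Theta mu,
      msupp (mu : set S -> \bar R) = [set: S] &
      exists u : S -> S -> R,
        [/\ is_ultrametric u,
            bilipschitz_equiv L (@mdist R S) u &
            forall x y, u x y <= mdist x y <= L * u x y]].

Definition metric_bounded (R : realType) (S : metricType R) (A : set S) : Prop :=
  exists M : R, forall x y, A x -> A y -> mdist x y <= M.

Definition proper_space (R : realType) (S : metricType R) : Prop :=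
  forall A : set S, closed A -> metric_bounded A -> compact A.

Definition dist_set (R : realType) (S : metricType R) : set R :=
  [set mdist x y | x in [set: S] & y in [set: S]].

Definition diam (R : realType) (S : metricType R) : \bar R :=
  ereal_sup (EFin @` dist_set S).

Definition is_maximum (R : realType) (A : set R) (m : R) : Prop :=
  A m /\ ubound A m.

Definition homeomorphic (T U : topologicalType) : Prop :=
  exists (f : T -> U) (g : U -> T),
    [/\ cancel f g, cancel g f, continuous f & continuous g].

(* Main.v *)
Require Import Defs.
From HB Require Import structures.
From mathcomp Require Import all_boot all_order all_algebra.
From mathcomp Require Import all_classical all_reals all_analysis.
From mathcomp Require Import ring lra zify.
Import Order.TTheory GRing.Theory Num.Theory.
Import numFieldNormedType.Exports.
Local Open Scope classical_set_scope.
Local Open Scope ring_scope.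

Set Implicit Arguments.
Unset Strict Implicit.
Unset Printing Implicit Defensive.

(** Cut ]0, +oo[ into pieces J_i = ]a_i, b_i] with b_i <= L a_i, accumulating
    only at 0 and at infinity.  The space is a comb: a base point and, for each
    i, a Cantor set (the tooth i) with a height function valued in J_i.  Points
    of different teeth are at distance the larger of their heights, which is
    ultrametric once heights are rounded down to a_i.  If the tooth i has mass
    s_i and its heights follow Theta conditioned to J_i, a pair of points whose
    higher point is in the tooth i and whose lower point is in a lower tooth
    has a distance distributed as Theta conditioned to J_i.

    A tooth is a binary tree, identified with an interval cut at every node.
    Two points separated at a node are at a distance depending only on the one
    in the right-hand half, and distributed as Theta conditioned to a short
    window ]wa n, wb n] close to 0.  All the functions involved being monotone
    on the interval, cuts that halve the oscillation (every other generation)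
    and the length keep the variation of these functions between two points below
    the distance of the points, whence the triangle inequality.

    The law of the distance is thus a mixture of conditionings of Theta, and it
    remains to choose the masses so that the mixture is Theta.  If M_i is the
    mass of the union of the teeth of index at least i among the pieces below
    some r0, this amounts to 2 (M_i - M_{i+1}) M_{i+1} = (1 - x_i) Theta(J_i),
    where x_i, the density of what the insides of the other teeth use up, only
    depends on larger teeth since the windows of a tooth lie below it; the
    equations are solved downwards.  Above r0 the windows are never met, and the
    equations are solved upwards from a starting mass adjusted to get the total
    mass 1. *)

(** * Combs of Cantor sets *)

(** A separable ultrametric space has only countably many distances, so an atomless [Theta] is never
    the distance law of an ultrametric. Distances have to vary within a factor [L] of the
    ultrametric, and the difficulty is to keep the triangle inequality while their law is exactly
    right. As [Theta] need not have a density and its support may have gaps at every scale, the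
    varying distances are monotone transports of a uniform parameter, made to depend on one point of
    the pair only. The insides of the teeth borrow mass of [Theta] from the windows. A tooth of mass
    s borrows s^2, which is of second order, so that cutting short enough pieces keeps the borrowed
    density below 1/2. The conserved quantity is then M_i^2 plus the mass of [Theta] below the top
    of J_i borrowed by larger teeth: it equals the mass of [Theta] below that top, and it keeps the
    quadratic equation for M_{i+1} solvable. Without a bound on the support there is no largest
    tooth from which to descend, whence the separate treatment above r0. *)

Fixpoint stem (x : cantor_space) (n : nat) : seq bool :=
  if n is m.+1 then x m :: stem x m else [::].

(** The bounds [tooth_d_small] and [tooth_g_lip] are what the triangle inequality between different
    teeth needs. The last two fields say that [u] induces the product topology. *)
Record is_tooth (R : realType) (L a b : R) (g : cantor_space -> R)
    (d u : cantor_space -> cantor_space -> R) : Prop := IsTooth {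
  tooth_u_ge0 : forall x y, 0 <= u x y ;
  tooth_u_eq0 : forall x y, u x y = 0 <-> x = y ;
  tooth_u_sym : forall x y, u x y = u y x ;
  tooth_u_ultra : forall x y z, u x z <= Num.max (u x y) (u y z) ;
  tooth_d_sym : forall x y, d x y = d y x ;
  tooth_d_tri : forall x y z, d x z <= d x y + d y z ;
  tooth_u_le : forall x y, u x y <= d x y ;
  tooth_d_le : forall x y, d x y <= L * u x y ;
  tooth_d_small : forall x y, d x y <= a ;
  tooth_g_ge : forall x, a <= g x ;
  tooth_g_le : forall x, g x <= b ;
  tooth_g_lip : forall x y, `|g x - g y| <= u x y ;
  tooth_cyl : forall n, exists2 e, 0 < e & forall x y, u x y < e ->
    stem x n = stem y n ;
  tooth_cont : forall e, 0 < e -> exists n, forall x y,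
    stem x n = stem y n -> u x y < e }.

(** By [comb_finite] only finitely many teeth meet a given compact part of ]0, +oo[, which gives
    properness; by [comb_accum] the base point is a limit of teeth, hence needs no mass of its
    own. *)
Record comb (R : realType) := Comb {
  comb_L : R ;
  comb_a : nat -> R ;
  comb_b : nat -> R ;
  comb_g : nat -> cantor_space -> R ;
  comb_d : nat -> cantor_space -> cantor_space -> R ;
  comb_u : nat -> cantor_space -> cantor_space -> R ;
  comb_L_ge1 : 1 <= comb_L ;
  comb_a_gt0 : forall i, 0 < comb_a i ;
  comb_b_le : forall i, comb_b i <= comb_L * comb_a i ;
  comb_tooth : forall i, is_tooth comb_L (comb_a i) (comb_b i)
    (comb_g i) (comb_d i) (comb_u i) ;
  comb_finite : forall r M, 0 < r -> exists N, forall i, (N <= i)%N ->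
    comb_b i < r \/ M < comb_a i ;
  comb_accum : forall r, 0 < r -> exists i, comb_b i < r }.

Definition comb_space (R : realType) (c : comb R) : Type :=
  option (nat * cantor_space).

Section comb_metric.
Context (R : realType) (c : comb R).
Local Notation S := (comb_space c).

HB.instance Definition _ := Choice.copy S (option (nat * cantor_space)).

Definition height (p : S) : R :=
  if p is Some (i, x) then comb_g c i x else 0.

Definition base_height (p : S) : R :=
  if p is Some (i, _) then comb_a c i else 0.

Definition comb_dist (p q : S) : R :=
  match p, q with
  | None, None => 0
  | Some (i, x), Some (j, y) =>
    if i == j then comb_d c i x y else Num.max (height p) (height q)
  | _, _ => Num.max (height p) (height q)
  end.

Definition comb_ultra (p q : S) : R :=
  match p, q with
  | None, None => 0
  | Some (i, x), Some (j, y) =>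
    if i == j then comb_u c i x y else Num.max (base_height p) (base_height q)
  | _, _ => Num.max (base_height p) (base_height q)
  end.

Lemma base_height_ge0 p : 0 <= base_height p.
Proof. by case: p => [[i x]|] //=; exact/ltW/comb_a_gt0. Qed.

Lemma height_ge p : base_height p <= height p.
Proof. by case: p => [[i x]|] //=; exact: (tooth_g_ge (comb_tooth c i)). Qed.

Lemma height_le p : height p <= comb_L c * base_height p.
Proof.
case: p => [[i x]|] /=; last by rewrite mulr0.
exact: (le_trans (tooth_g_le (comb_tooth c i) x) (comb_b_le c i)).
Qed.

Lemma height_ge0 p : 0 <= height p.
Proof. exact: le_trans (base_height_ge0 p) (height_ge p). Qed.

Lemma tooth_d0 i x : comb_d c i x x = 0.
Proof.
have H := comb_tooth c i.
have u0 : comb_u c i x x = 0 by apply/(tooth_u_eq0 H).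
apply/eqP; rewrite eq_le; apply/andP; split.
  by rewrite (le_trans (tooth_d_le H x x))// u0 mulr0.
by rewrite -u0; exact: (tooth_u_le H).
Qed.

Lemma comb_dist_sym p q : comb_dist p q = comb_dist q p.
Proof.
case: p q => [[i x]|] [[j y]|]; rewrite /comb_dist //= ?(maxC 0)//.
rewrite [in RHS]eq_sym; case: eqP => [->|_]; last by rewrite maxC.
exact: (tooth_d_sym (comb_tooth c j)).
Qed.

Lemma comb_ultra_sym p q : comb_ultra p q = comb_ultra q p.
Proof.
case: p q => [[i x]|] [[j y]|]; rewrite /comb_ultra //= ?(maxC 0)//.
rewrite [in RHS]eq_sym; case: eqP => [->|_]; last by rewrite maxC.
exact: (tooth_u_sym (comb_tooth c j)).
Qed.

Lemma comb_ultra_le p q : comb_ultra p q <= comb_dist p q.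
Proof.
have H (p' q' : S) : Num.max (base_height p') (base_height q') <= Num.max (height p') (height q').
  by rewrite ge_max !le_max !height_ge orbT.
case: p q => [[i x]|] [[j y]|]; rewrite /comb_ultra /comb_dist //.
case: eqVneq => _ //; exact: (tooth_u_le (comb_tooth c i)).
Qed.

Lemma comb_dist_le p q : comb_dist p q <= comb_L c * comb_ultra p q.
Proof.
have L0 : 0 <= comb_L c by exact: le_trans (comb_L_ge1 c).
have H (p' q' : S) : Num.max (height p') (height q') <=
    comb_L c * Num.max (base_height p') (base_height q').
  rewrite ge_max !(le_trans (height_le _))// ler_wpM2l// le_max lexx ?orbT//.
case: p q => [[i x]|] [[j y]|]; rewrite /comb_ultra /comb_dist //; last first.
  by rewrite mulr0.
by case: eqVneq => _ //; exact: (tooth_d_le (comb_tooth c i)).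
Qed.

Lemma comb_ultra_ge0 p q : 0 <= comb_ultra p q.
Proof.
have H (p' q' : S) : 0 <= Num.max (base_height p') (base_height q').
  by rewrite le_max !base_height_ge0.
case: p q => [[i x]|] [[j y]|] //; rewrite /comb_ultra //.
by case: eqVneq => _ //; exact: (tooth_u_ge0 (comb_tooth c i)).
Qed.

Lemma comb_ultra_eq0 p q : comb_ultra p q = 0 <-> p = q.
Proof.
case: p q => [[i x]|] [[j y]|] //; rewrite /comb_ultra //=.
- case: eqP => [<-|ij].
    by rewrite (tooth_u_eq0 (comb_tooth c i)); split=> [->|[]].
  split => [|[]]// /eqP; rewrite eq_le ge_max => /andP[/andP[]].
  by rewrite leNgt comb_a_gt0.
- split=> // /eqP; rewrite eq_le ge_max => /andP[/andP[]].
  by rewrite leNgt comb_a_gt0.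
- split=> // /eqP; rewrite eq_le ge_max => /andP[/andP[_]].
  by rewrite leNgt comb_a_gt0.
Qed.

(** Between teeth this is the ultrametric maximum of the base heights. Inside the tooth [i] one has
    [u <= d <= a i], so a detour through another tooth is never shorter. *)
Lemma comb_ultra_tri p q r :
  comb_ultra p r <= Num.max (comb_ultra p q) (comb_ultra q r).
Proof.
have ai i := comb_a_gt0 c i; have ui := fun i x y => le_trans
  (tooth_u_le (comb_tooth c i) x y) (tooth_d_small (comb_tooth c i) x y).
have a0 i : Num.max (comb_a c i) 0 = comb_a c i by rewrite max_l// ltW.
have a0' i : Num.max 0 (comb_a c i) = comb_a c i by rewrite max_r// ltW.
have leM (v w : R) : v <= Num.max v w by rewrite le_max lexx.
have leM' (v w : R) : v <= Num.max w v by rewrite le_max lexx orbT.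
case: p q r => [[i x]|] [[j y]|] [[k z]|]; rewrite /comb_ultra /= ?a0 ?a0' ?maxxx//.
- case: (eqVneq i j) => [ij|ij]; rewrite -?ij; case: (eqVneq i k) => [ik|ik]; rewrite -?ik.
  + exact: (tooth_u_ultra (comb_tooth c i)).
  + exact: leM'.
  + by rewrite (le_trans (ui _ _ _))// !le_max lexx.
  + case: (eqVneq j k) => [jk|jk]; rewrite -?jk; first exact: leM.
    by rewrite ge_max !le_max !lexx !orbT.
- by case: (eqVneq i j) => [ij|ij]; rewrite -?ij !le_max lexx ?orbT.
- case: (eqVneq i k) => [ik|ik]; rewrite -?ik //.
  exact: le_trans (ui _ _ _) (leM _ _).
- by case: (eqVneq j k) => [jk|jk]; rewrite -?jk !le_max lexx ?orbT.
- exact: ltW.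
Qed.

(** A move inside a tooth changes the height by at most its length, since heights are 1-Lipschitz
    for [u <= d]; a detour out of a tooth costs at least a height of that tooth, which exceeds every
    distance inside it. *)
Lemma comb_dist_tri q p r : comb_dist p r <= comb_dist p q + comb_dist q r.
Proof.
have g0 i x : 0 <= comb_g c i x.
  by apply: le_trans (tooth_g_ge (comb_tooth c i) x); exact/ltW/comb_a_gt0.
have dg i x y z : comb_d c i x y <= comb_g c i z.
  exact: le_trans (tooth_d_small (comb_tooth c i) x y)
    (tooth_g_ge (comb_tooth c i) z).
have gg i x y : comb_g c i x <= comb_g c i y + comb_d c i x y.
  have := tooth_g_lip (comb_tooth c i) x y.
  have := tooth_u_le (comb_tooth c i) x y.
  rewrite ler_norml; lra.
have ds i x y : comb_d c i x y = comb_d c i y x.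
  exact: (tooth_d_sym (comb_tooth c i)).
have leM (u v : R) : u <= Num.max u v by rewrite le_max lexx.
have leM' (u v : R) : u <= Num.max v u by rewrite le_max lexx orbT.
case: p q r => [[i x]|] [[j y]|] [[k z]|]; rewrite /comb_dist /=.
- case: (eqVneq i j) => [ij|ij]; rewrite -?ij; case: (eqVneq i k) => [ik|ik]; rewrite -?ik.
  + exact: (tooth_d_tri (comb_tooth c i)).
  + rewrite ge_max; apply/andP; split.
      have := gg i x y; have := leM (comb_g c i y) (comb_g c k z); lra.
    have := leM' (comb_g c k z) (comb_g c i y); have := ds i x y.
    have := dg i x y y; have := g0 i x; have := tooth_u_le (comb_tooth c i) x y.
    have := tooth_u_ge0 (comb_tooth c i) x y; lra.
  + rewrite eq_sym (negbTE ij); have := dg i x z x.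
    have := leM (comb_g c i x) (comb_g c j y).
    have := leM' (comb_g c i z) (comb_g c j y); have := g0 i z; lra.
  + case: (eqVneq j k) => [jk|jk]; rewrite -?jk; rewrite ge_max; apply/andP; split.
    * have := leM (comb_g c i x) (comb_g c j y).
      have := tooth_u_le (comb_tooth c j) y z.
      have := tooth_u_ge0 (comb_tooth c j) y z; lra.
    * have := leM' (comb_g c j y) (comb_g c i x); have := gg j z y.
      have := ds j y z; lra.
    * have := leM (comb_g c i x) (comb_g c j y).
      have := leM (comb_g c j y) (comb_g c k z); have := g0 j y; lra.
    * have := leM' (comb_g c j y) (comb_g c i x).
      have := leM' (comb_g c k z) (comb_g c j y); have := g0 j y; lra.
- case: (eqVneq i j) => [ij|ij]; rewrite -?ij; rewrite !(max_idPl (g0 _ _)).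
  + by have := gg i x y; lra.
  + have := leM (comb_g c i x) (comb_g c j y); have := g0 j y; lra.
- rewrite !(max_idPl (g0 _ _)) !(max_idPr (g0 _ _)).
  case: (eqVneq i k) => [ik|ik]; rewrite -?ik.
  + by have := dg i x z x; have := g0 i z; lra.
  + rewrite ge_max; have := g0 i x; have := g0 k z; lra.
- by rewrite !(max_idPl (g0 _ _)); lra.
- case: (eqVneq j k) => [jk|jk]; rewrite -?jk; rewrite !(max_idPr (g0 _ _)).
  + by have := gg j z y; have := ds j y z; lra.
  + have := leM' (comb_g c k z) (comb_g c j y); have := g0 j y; lra.
- by have := g0 j y; rewrite (max_idPr (g0 _ _)) (max_idPl (g0 _ _)); lra.
- by rewrite !(max_idPr (g0 _ _)); lra.
- lra.
Qed.

Lemma comb_dist_refl p : comb_dist p p = 0.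
Proof. by case: p => [[i x]|] //=; rewrite eqxx tooth_d0. Qed.

Lemma comb_dist_eq0 p q : comb_dist p q = 0 -> p = q.
Proof.
move=> pq; apply/comb_ultra_eq0/eqP; rewrite eq_le comb_ultra_ge0 andbT.
by rewrite -pq comb_ultra_le.
Qed.

HB.instance Definition _ := @isMetric.Build R S comb_dist comb_dist_refl
  comb_dist_eq0 comb_dist_sym comb_dist_tri.
HB.instance Definition _ := isPointed.Build S None.

End comb_metric.

(** * Cylinders and maps out of the Cantor space *)

Lemma stemP (x y : cantor_space) n :
  stem x n = stem y n <-> forall k, (k < n)%N -> x k = y k.
Proof.
elim: n => [|n IH] //=; split.
  move=> [xy] /IH H k; rewrite ltnS leq_eqVlt => /predU1P[->//|]; exact: H.
by move=> H; rewrite H//; congr cons; apply/IH => k kn; apply: H; exact: ltnW.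
Qed.

Lemma size_stem x n : size (stem x n) = n.
Proof. by elim: n => //= n ->. Qed.

Lemma nbhs_stem (x : cantor_space) n :
  nbhs x [set y : cantor_space | stem x n = stem y n].
Proof.
elim: n => [|n IH]; first by apply: filterE.
have nb : nbhs x ((fun y : cantor_space => y n) @^-1` [set x n]).
  apply: (@proj_continuous nat (fun=> bool) n x).
  by apply: open_nbhs_nbhs; split => //; exact: discrete_open.
by apply: filterS (filterI IH nb) => y /= [-> ->].
Qed.

Lemma cantor_continuous_at (R : realType) (T : metricType R)
    (f : cantor_space -> T) (x : cantor_space) :
  (forall e, 0 < e -> exists n, forall y,
    stem x n = stem y n -> mdist (f x) (f y) < e) ->
  {for x, continuous f}.
Proof.
move=> H; apply/cvg_ballP => e e0; have [n Hn] := H e e0.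
have := nbhs_stem x n; apply: filterS => y /Hn.
by rewrite ballEmdist.
Qed.

(** The complement of [U] is compact, so its image is closed; by injectivity the image of [U] is the
    open range minus this closed set. *)
Lemma continuous_inj_open_map (T : topologicalType) (f : cantor_space -> T) :
  hausdorff_space T -> continuous f -> injective f -> open (range f) ->
  forall U, open U -> open (f @` U).
Proof.
move=> hT cf injf orf U oU.
have -> : f @` U = range f `&` ~` (f @` ~` U).
  apply/seteqP; split => [_ [x Ux <-]|_ [[x _ <-] H]].
    by split; [exists x|move=> [y nUy /injf yx]; apply: nUy; rewrite yx].
  by exists x => //; apply: contrapT => nUx; apply: H; exists x.
apply: openI => //; apply: closed_openC; apply: (compact_closed hT).
apply: continuous_compact; first exact: continuous_subspaceT.
apply: (@subclosed_compact _ _ [set: cantor_space]) => //.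
  exact: open_closedC.
exact: cantor_space_compact.
Qed.

Lemma homeomorphic_cantor (T : topologicalType) (f : cantor_space -> T) :
  hausdorff_space T -> continuous f -> injective f -> range f = setT ->
  homeomorphic T cantor_space.
Proof.
move=> hT cf injf rf.
have surj t : exists x, f x = t.
  by have : range f t by [rewrite rf]; move=> [x _ <-]; exists x.
pose g t := sval (cid (surj t)).
have gK : cancel g f by move=> t; rewrite /g; case: cid.
have fK : cancel f g by move=> x; apply: injf; rewrite gK.
exists g, f; split=> //; apply/continuousP => U oU.
have -> : g @^-1` U = f @` U.
  apply/seteqP; split => [t Ut|_ [x Ux <-]]; last by rewrite /= fK.
  by exists (g t) => //; rewrite gK.
by apply: (continuous_inj_open_map hT cf injf) => //; rewrite rf; exact: openT.
Qed.

Lemma homeomorphic_sum_cantor (T : topologicalType)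
    (f : nat -> cantor_space -> T) :
  hausdorff_space T -> (forall n, continuous (f n)) ->
  (forall n m x y, f n x = f m y -> n = m /\ x = y) ->
  (forall n, open (range (f n))) -> (forall t, exists n x, f n x = t) ->
  homeomorphic T {n : nat & cantor_space}.
Proof.
move=> hT cf injf orf surj.
pose F (p : {n : nat & cantor_space}) := f (projT1 p) (projT2 p).
have surjF t : exists p, F p = t.
  by have [n [x <-]] := surj t; exists (existT _ n x).
have injF : injective F.
  by move=> [n x] [m y] /injf /= [-> ->].
pose g t := sval (cid (surjF t)).
have gK : cancel g F by move=> t; rewrite /g; case: cid.
have fK : cancel F g by move=> x; apply: injF; rewrite gK.
exists g, F; split=> //; last by apply: sigT_continuous => n; exact: cf.
apply/continuousP => U oU.
have -> : g @^-1` U = \bigcup_n (f n @` (existT _ n @^-1` U)).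
  apply/seteqP; split => [t Ut|_ [n _ [x Ux <-]]].
    exists (projT1 (g t)) => //; exists (projT2 (g t)); last exact: (gK t).
    by move: Ut; rewrite /=; case: (g t).
  by have /= := fK (existT _ n x); rewrite /F /= => ->.
apply: bigcup_open => n _.
apply: (continuous_inj_open_map hT (cf n)) => //.
  by move=> x y /injf[].
by move/sigT_openP : oU; exact.
Qed.

(** * Topology of the comb: compactness, properness, completeness *)

Section comb_topology.
Context (R : realType) (c : comb R).
Local Notation S := (comb_space c).

Let L_gt0 : 0 < comb_L c. Proof. exact: lt_le_trans (comb_L_ge1 c). Qed.

Lemma comb_mdistE (p q : S) : mdist p q = comb_dist p q.
Proof. by []. Qed.

Lemma height_lip (p q : S) : height q <= height p + comb_dist p q.
Proof.
have h0 (r : S) : comb_dist (None : S) r = height r.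
  by case: r => [[i x]|] //=; rewrite max_r//; exact: (height_ge0 (Some (i, x) : S)).
by rewrite -(h0 p) -(h0 q) comb_dist_tri.
Qed.

Definition tooth_in (i : nat) (x : cantor_space) : S := Some (i, x).

Lemma tooth_in_continuous i : continuous (tooth_in i).
Proof.
move=> x; apply: cantor_continuous_at => e e0.
have [n Hn] := tooth_cont (comb_tooth c i) (divr_gt0 e0 L_gt0).
exists n => y /Hn; rewrite comb_mdistE /= eqxx ltr_pdivlMr// mulrC.
exact: le_lt_trans (tooth_d_le (comb_tooth c i) _ _).
Qed.

Lemma tooth_close i x (q : S) : comb_dist (tooth_in i x) q < comb_a c i ->
  exists y, q = tooth_in i y.
Proof.
have H (v : R) : comb_g c i x <= v -> v < comb_a c i -> False.
  move=> gv va; have := le_trans (tooth_g_ge (comb_tooth c i) x) gv.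
  by rewrite leNgt va.
case: q => [[j y]|] /=; last by move/H => -[]; rewrite le_max lexx.
case: (eqVneq i j) => [<-|_]; first by exists y.
by move/H => -[]; rewrite le_max lexx.
Qed.

Lemma tooth_cyl_open i n w :
  open [set p : S | exists2 x, p = tooth_in i x & stem x n = w].
Proof.
rewrite openE => _ [x -> xw].
have [e e0 He] := tooth_cyl (comb_tooth c i) n.
have m0 : 0 < Num.min e (comb_a c i) by rewrite lt_min e0 comb_a_gt0.
apply/nbhs_ballP; exists (Num.min e (comb_a c i)) => // q.
rewrite ballEmdist /= comb_mdistE lt_min => /andP[qe qa].
have [y qy] := tooth_close qa; exists y => //.
rewrite -xw; apply/esym/He; apply: le_lt_trans qe; rewrite qy /= eqxx.
exact: (tooth_u_le (comb_tooth c i)).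
Qed.

Lemma tooth_open i : open (range (tooth_in i)).
Proof.
have := @tooth_cyl_open i 0 [::]; congr open.
by apply/seteqP; split => [_ [x -> _]|_ [x _ <-]]; [exists x|exists x].
Qed.

Lemma tooth_compact i : compact (range (tooth_in i)).
Proof.
apply: continuous_compact; last exact: cantor_space_compact.
by apply: continuous_subspaceT; exact: tooth_in_continuous.
Qed.

(** A filter that does not cluster at the base point contains a set avoiding a ball around it. Below
    height [r], what lies outside this ball is contained in finitely many teeth, each of them
    compact. *)
Lemma base_height_compact r : compact [set p : S | base_height p <= r].
Proof.
move=> F FF FK.
have [noc|] := pselect (cluster F (None : S)).
  exists None; split=> //=; have [p /= pr] := filter_ex FK.
  exact: le_trans (base_height_ge0 p) pr.
move=> /existsNP[A /existsNP[B /not_implyP[FA /not_implyP[NB AB]]]].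
move/nbhs_ballP : NB => [e /= e0 eB].
have [N HN] := comb_finite c r e0.
pose T i := if comb_a c i <= r then range (tooth_in i) else set0.
pose K := \big[setU/set0]_(i < N) T i.
have cK : compact K.
  apply: bigsetU_compact => i _; rewrite /T; case: ifP => _; last exact: compact0.
  exact: tooth_compact.
have KE p : K p -> base_height p <= r.
  by rewrite /K -bigcup_mkord => -[i _]; rewrite /T; case: ifP => // ar [x _ <-].
have FK' : F K.
  apply: filterS (filterI FK FA) => p [/= pr Ap].
  case: p pr Ap => [[i x]|] /= pr Ap; last first.
    by exfalso; apply: AB; exists None; split => //; exact/eB/ballxx.
  rewrite /K -bigcup_mkord; exists i; last by rewrite /T pr; exists x.
  rewrite /= ltnNge; apply/negP => /HN[be|]; last by rewrite ltNge pr.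
  apply: AB; exists (Some (i, x)); split => //; apply: eB.
  rewrite ballEmdist /= comb_mdistE /= max_r.
    exact: le_lt_trans (tooth_g_le (comb_tooth c i) x) be.
  exact: (height_ge0 (Some (i, x) : S)).
by have [p [Kp cp]] := cK F FF FK'; exists p; split => //; exact: KE.
Qed.

Lemma comb_proper : proper_space (S : metricType R).
Proof.
move=> A cA [M HM]; have [[p Ap]|nA] := pselect (exists p, A p); last first.
  have -> : A = set0 by rewrite -subset0 => p Ap; apply: nA; exists p.
  exact: compact0.
apply: (subclosed_compact cA (@base_height_compact (height p + M))) => q Aq /=.
rewrite (le_trans (height_ge q))// (le_trans (height_lip p q))// lerD2l.
exact: HM.
Qed.

Lemma comb_complete (F : set_system S) : ProperFilter F -> cauchy F -> cvg F.
Proof.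
move=> FF cF; have /cauchyP/(_ 1 ltr01)[p Fp] := cF.
apply: (@compact_cauchy_cvg _ [set q : S | base_height q <= height p + 1] F) => //.
  apply: filterS Fp => q; rewrite ballEmdist /= => pq.
  by rewrite (le_trans (height_ge q))// (le_trans (height_lip p q))// lerD2l ltW.
exact: base_height_compact.
Qed.

End comb_topology.

HB.instance Definition _ (R : realType) (c : comb R) :=
  Uniform_isComplete.Build (comb_space c) (@comb_complete R c).

(** * Separability and homeomorphism types of combs *)

Section comb_homeomorphism.
Context (R : realType) (c : comb R).
Local Notation S := (comb_space c).

Lemma comb_separable : separable S.
Proof.
(* The dense points are the finite words continued by zeros; [rev] is there because [stem] lists the
   last coordinate first. *)
pose D : nat * seq bool -> S := fun iw => tooth_in c iw.1
  (fun k => nth false (rev iw.2) k).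
exists (range D); first by apply: (sub_countable (card_image_le _ _)); exact: countableP.
move=> U [p Up] oU; rewrite openE in oU.
have : exists i x, U (tooth_in c i x).
  case: p Up => [[i x]|] Up; first by exists i, x.
  have /nbhs_ballP[e /= e0 eU] := oU _ Up; have [i be] := comb_accum c e0.
  exists i, (fun=> false); apply: eU; rewrite ballEmdist /= comb_mdistE /=.
  rewrite max_r; last exact: (height_ge0 (tooth_in c i (fun=> false))).
  exact: le_lt_trans (tooth_g_le (comb_tooth c i) _) be.
move=> [i [x Ux]]; have /nbhs_ballP[e /= e0 eU] := oU _ Ux.
have L0 : 0 < comb_L c by exact: lt_le_trans (comb_L_ge1 c).
have [n Hn] := tooth_cont (comb_tooth c i) (divr_gt0 e0 L0).
exists (D (i, stem x n)); split; last by exists (i, stem x n).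
apply: eU; rewrite ballEmdist /= comb_mdistE /= eqxx.
rewrite (le_lt_trans (tooth_d_le (comb_tooth c i) _ _))// mulrC -ltr_pdivlMr//.
apply: Hn; apply/stemP => k kn /=.
have nth_stem m : (k < m)%N -> nth false (rev (stem x m)) k = x k.
  elim: m => // m IH; rewrite ltnS /= rev_cons nth_rcons size_rev size_stem.
  by rewrite leq_eqVlt => /predU1P[->|km]; [rewrite ltnn eqxx|rewrite km IH].
by rewrite nth_stem.
Qed.

Lemma comb_hausdorff : hausdorff_space S.
Proof. exact: (@metric_hausdorff R (S : metricType R)). Qed.

Lemma comb_compact M : (forall i, comb_a c i <= M) -> compact [set: S].
Proof.
move=> aM; rewrite (_ : setT = [set p : S | base_height p <= Num.max M 0]).
  exact: base_height_compact.
apply/seteqP; split => // -[[i x]|] _ /=; last by rewrite le_max lexx orbT.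
by rewrite le_max aM.
Qed.

(* The sequence 0^k 1 y is sent to the point y of the tooth e k, and 0^oo to
   the base point. *)
Definition fan (e : nat -> nat) (x : cantor_space) : S :=
  if pselect (exists k, x k) is left h then
    tooth_in c (e (ex_minn h)) (fun m => x ((ex_minn h).+1 + m)%N)
  else None.

Lemma fan0 e (x : cantor_space) : (forall k, x k = false) -> fan e x = None.
Proof.
move=> x0; rewrite /fan; case: pselect => // h; exfalso.
by case: h => k; rewrite x0.
Qed.

Lemma fanS e (x : cantor_space) k : (forall j, (j < k)%N -> x j = false) ->
  x k -> fan e x = tooth_in c (e k) (fun m => x (k.+1 + m)%N).
Proof.
move=> xj xk; rewrite /fan; case: pselect => [h|[]]; last by exists k.
have -> : ex_minn h = k; last by [].
case: ex_minnP => m xm mmin; apply/eqP; rewrite eqn_leq mmin//= leqNgt.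
by apply/negP => /xj; rewrite xm.
Qed.

Lemma fan_cases (x : cantor_space) : (forall k, x k = false) \/
  exists k, (forall j, (j < k)%N -> x j = false) /\ x k.
Proof.
have [h|nh] := pselect (exists k, x k).
  right; exists (ex_minn h); case: ex_minnP => m xm mmin; split=> // j jm.
  by apply/negP => /mmin; rewrite leqNgt jm.
by left => k; apply/negP => xk; apply: nh; exists k.
Qed.

Lemma fan_continuous e :
  (forall r, 0 < r -> exists N, forall k, (N <= k)%N -> comb_b c (e k) < r) ->
  continuous (fan e).
Proof.
move=> be x; apply: cantor_continuous_at => r r0.
have [x0|[k [xj xk]]] := fan_cases x.
  have [N HN] := be _ r0; exists N => y xy; rewrite fan0//.
  have [y0|[l [yj yl]]] := fan_cases y; first by rewrite fan0//= comb_mdistE.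
  rewrite (fanS _ yj yl) comb_mdistE /= max_r; last first.
    exact: (height_ge0 (tooth_in c (e l) _)).
  apply: le_lt_trans (tooth_g_le (comb_tooth c _) _) (HN l _).
  rewrite leqNgt; apply/negP => lN; move/stemP : xy => /(_ l lN).
  by rewrite x0 yl.
have := @tooth_in_continuous R c (e k) (fun m => x (k.+1 + m)%N).
have L0 : 0 < comb_L c by exact: lt_le_trans (comb_L_ge1 c).
have [n Hn] := tooth_cont (comb_tooth c (e k)) (divr_gt0 r0 L0).
move=> _; exists (k.+1 + n)%N => y /stemP xy.
rewrite (fanS _ xj xk) (@fanS _ y k).
- rewrite comb_mdistE /= eqxx (le_lt_trans (tooth_d_le (comb_tooth c _) _ _))//.
  rewrite mulrC -ltr_pdivlMr//; apply: Hn; apply/stemP => m mn.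
  by apply: xy; rewrite ltn_add2l.
- by move=> j jk; rewrite -xy ?xj//; lia.
- by rewrite -xy//; lia.
Qed.

Lemma fan_inj e : injective e -> injective (fan e).
Proof.
move=> inje x y.
have [x0|[k [xj xk]]] := fan_cases x; have [y0|[l [yj yl]]] := fan_cases y.
- by move=> _; apply/funext => i; rewrite x0 y0.
- by rewrite (fan0 _ x0) (fanS _ yj yl).
- by rewrite (fan0 _ y0) (fanS _ xj xk).
rewrite (fanS _ xj xk) (fanS _ yj yl) => -[/inje kl] /funeqP xy; subst l.
apply/funext => i; case: (ltngtP i k) => [ik|ki|->]; last by rewrite xk yl.
  by rewrite xj// yj.
by have := xy (i - k.+1)%N; rewrite subnKC.
Qed.

Lemma fan_range e : range (fan e) =
  [set p | p = None \/ exists k y, p = tooth_in c (e k) y].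
Proof.
apply/seteqP; split => [_ [x _ <-]|p [->|[k [y ->]]]] /=.
- have [x0|[k [xj xk]]] := fan_cases x; first by left; rewrite fan0.
  by right; exists k, (fun m => x (k.+1 + m)%N); rewrite (fanS _ xj xk).
- by exists (fun=> false) => //; rewrite fan0.
- exists (fun m => if (m < k)%N then false else
    if m == k then true else y (m - k.+1)%N) => //.
  rewrite (@fanS _ _ k).
  + congr (tooth_in _ _); apply/funext => m.
    have -> : (k.+1 + m < k)%N = false by lia.
    have -> : (k.+1 + m == k)%N = false by lia.
    by rewrite addKn.
  + by move=> j ->.
  + by rewrite ltnn eqxx.
Qed.

Lemma comb_homeo_cantor :
  (forall r, 0 < r -> exists N, forall k, (N <= k)%N -> comb_b c k < r) ->
  homeomorphic S cantor_space.
Proof.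
move=> be; apply: (@homeomorphic_cantor _ (fan id)) => //.
- exact: comb_hausdorff.
- exact: fan_continuous.
- exact: fan_inj.
- rewrite fan_range; apply/seteqP; split => // -[[k y]|] _; last by left.
  by right; exists k, y.
Qed.

(** The even teeth shrink to the base point and form with it a single Cantor set, the fan, which is
    open because the odd teeth stay away from the base point. Each odd tooth is one more summand. *)
Lemma comb_homeo_sum :
  (forall r, 0 < r -> exists N, forall k, (N <= k)%N -> comb_b c k.*2 < r) ->
  (exists2 r, 0 < r & forall k, r <= comb_a c k.*2.+1) ->
  homeomorphic S {n : nat & cantor_space}.
Proof.
move=> be [r r0 ra].
pose f n := if n is m.+1 then tooth_in c m.*2.+1 else fan double.
apply: (@homeomorphic_sum_cantor _ f).
- exact: comb_hausdorff.
- move=> [|n]; first exact: fan_continuous.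
  exact: tooth_in_continuous.
- have fN k m x y : tooth_in c m.*2.+1 x <> tooth_in c k.*2 y.
    by move=> [mk]; lia.
  move=> [|n] [|m] x y /=.
  + by move/(fan_inj double_inj).
  + move=> xy; have : range (fan double) (fan double x) by exists x.
    by rewrite fan_range xy => -[//|[k [z /fN]]].
  + move=> xy; have : range (fan double) (fan double y) by exists y.
    by rewrite fan_range -xy => -[//|[k [z /fN]]].
  + by move=> [nm ->]; split => //; lia.
- move=> [|n] /=; last exact: tooth_open.
  rewrite fan_range openE => _ [->|[k [y ->]]].
    apply/nbhs_ballP; exists r => //= q; rewrite ballEmdist /= comb_mdistE.
    case: q => [[i x]|]; last by left.
    rewrite /= max_r; last exact: (height_ge0 (tooth_in c i x)).
    move=> gr; right; exists i./2, x; congr (tooth_in _ _).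
    rewrite -[LHS]odd_double_half; case: (boolP (odd i)) => // oi.
    have := ra i./2; rewrite leNgt => /negP[].
    rewrite (le_lt_trans _ gr)//.
    have -> : (i./2.*2.+1 = i)%N by have := odd_double_half i; rewrite oi.
    exact: (tooth_g_ge (comb_tooth c i)).
  have : nbhs (tooth_in c k.*2 y) (range (tooth_in c k.*2)).
    by apply: open_nbhs_nbhs; split; [exact: tooth_open|exists y].
  by apply: filterS => _ [z _ <-]; right; exists k, z.
- move=> [[i x]|]; last by exists 0%N, (fun=> false) => /=; rewrite fan0.
  case: (boolP (odd i)) => oi.
    exists i./2.+1, x; rewrite /= /tooth_in.
    have -> : (i./2.*2.+1 = i)%N by have := odd_double_half i; rewrite oi.
    by [].
  have : range (fan double) (tooth_in c i x).
    rewrite fan_range; right; exists i./2, x; congr tooth_in.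
    by rewrite -[LHS]odd_double_half (negbTE oi).
  by move=> [y _ yx]; exists 0%N, y.
Qed.

End comb_homeomorphism.

(** * Quantiles *)

Lemma measure_eq_rays (R : realType)
    (m1 m2 : {measure set (measurableTypeR R) -> \bar R}) :
  (forall x : R, (m1 `]x, +oo[%classic < +oo)%E) ->
  (forall x : R, m1 `]x, +oo[%classic = m2 `]x, +oo[%classic) ->
  forall A, measurable A -> m1 A = m2 A.
Proof.
move=> fin eqm A mA.
pose G := [set A : set R | exists x, A = `]x, +oo[%classic].
pose g (n : nat) : set R := `](- n%:R), +oo[%classic.
apply: (@measure_unique _ R (measurableTypeR R) G g _ _ _ _ m1 m2) => //.
- exact: measurable_realfun.RGenOInfty.measurableE.
- move=> _ _ [x ->] [y ->]; exists (Num.max x y).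
  apply/seteqP; split => z /=; rewrite !in_itv /= !andbT gt_max.
    by move=> [-> ->].
  by move=> /andP[].
- by move=> n; eexists.
- rewrite -subTset => x _; exists (Num.truncn `|x|).+1 => //=.
  rewrite /g /= in_itv /= andbT ltrNl (le_lt_trans (ler_norm _))// normrN.
  exact: truncnS_gt.
- by move=> _ [x ->].
- by move=> n; exact: fin.
Qed.

Section quantile.
Context (R : realType) (Theta : probability (measurableTypeR R) R).
Hypothesis Theta_nonneg : Theta [set x : R | 0 <= x] = 1%E.

Definition cumul (x : R) : R := fine (Theta `]-oo, x]%classic).

Lemma cumulE x : (cumul x)%:E = Theta `]-oo, x]%classic.
Proof. by rewrite fineK// fin_num_measure. Qed.

Lemma cumul_homo x y : x <= y -> cumul x <= cumul y.
Proof.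
move=> xy; rewrite -lee_fin !cumulE le_measure ?inE//.
by move=> z /=; rewrite !in_itv /= => /le_trans; exact.
Qed.

Lemma cumul_le1 x : cumul x <= 1.
Proof. by rewrite -lee_fin cumulE probability_le1. Qed.

Lemma cumul_lt0 (x : R) : x < 0 -> cumul x = 0.
Proof.
move=> x0; apply/eqP; rewrite -eqe cumulE; apply/eqP.
have E : [set x : R | 0 <= x] = `[0, +oo[%classic by rewrite set_itvcy.
have : Theta (~` [set x : R | 0 <= x]) = 0%E.
  rewrite probability_setC ?Theta_nonneg ?subee//.
  by rewrite E; exact: measurable_itv.
apply: subset_measure0 => //.
  by rewrite E; apply: measurableC; exact: measurable_itv.
by move=> y /=; rewrite in_itv /= => yx; apply/negP; rewrite -ltNge (le_lt_trans yx).
Qed.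

Lemma cumul_ge0 x : 0 <= cumul x.
Proof. exact/fine_ge0/measure_ge0. Qed.

Lemma measure_itvoc (a b : R) : a <= b ->
  Theta `]a, b]%classic = (cumul b - cumul a)%:E.
Proof.
move=> ab; rewrite EFinB !cumulE.
have -> : `]a, b]%classic = `]-oo, b] `\` `]-oo, a] :> set R.
  by rewrite -[RHS]setCK setCD setCitvl setUC -[LHS]setCK setCitv.
rewrite measureD//= ?setIidr//; first exact: subset_itvl.
by rewrite -ge0_fin_numE// fin_num_measure.
Qed.

(** Right continuity of the distribution function, in the form in which an infimum uses it. *)
Lemma cumul_right x u : (forall y, x < y -> u <= cumul y) -> u <= cumul x.
Proof.
move=> H; pose F n : set R := `]-oo, (x + n.+1%:R^-1)]%classic.
have mF n : measurable (F n) by exact: measurable_itv.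
have : Theta (F n) @[n --> \oo] --> Theta (\bigcap_n F n).
  apply: nonincreasing_cvg_mu => //.
  - by rewrite ltey_eq fin_num_measure//; exact: mF.
  - exact: bigcapT_measurable.
  - apply/nonincreasing_seqP => n; apply/subsetPset => z /=.
    rewrite /F /= !in_itv /= => /le_trans; apply.
    by rewrite lerD2l lef_pV2 ?posrE// ler_nat.
have -> : \bigcap_n F n = `]-oo, x]%classic.
  apply/seteqP; split => z /=; last first.
    rewrite in_itv /= => zx n _; rewrite /F /= in_itv /= (le_trans zx)//.
    by rewrite lerDl invr_ge0.
  move=> Hz; rewrite in_itv /=; apply/ler_addgt0Pr => e e0.
  have := Hz (Num.truncn e^-1) I; rewrite /F /= in_itv /= => /le_trans; apply.
  rewrite lerD2l -[leRHS]invrK lef_pV2 ?posrE ?invr_gt0//.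
  by rewrite ltW// truncnS_gt.
move=> cvF; rewrite -lee_fin cumulE; apply: (cvge_ge _ cvF).
by apply: nearW => n; rewrite -cumulE lee_fin H// ltrDl invr_gt0.
Qed.

Definition quantile (t : R) : R := inf [set x | t <= cumul x].

(** The Galois connection between quantile and distribution function: the infimum is attained by
    right continuity, and the set is bounded below by 0 because [t] is positive. *)
Lemma quantile_le t x : 0 < t -> (exists y, t <= cumul y) ->
  (quantile t <= x) = (t <= cumul x).
Proof.
move=> t0 [y ty]; pose E := [set x | t <= cumul x].
have hE : has_inf E.
  split; first by exists y.
  exists 0 => z /= tz; rewrite leNgt; apply/negP => /cumul_lt0 z0.
  by move: tz; rewrite /E /= z0 leNgt t0.
apply/idP/idP => [qx|tx]; last by apply: ge_inf => //; case: hE.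
apply: (@le_trans _ _ (cumul (quantile t))); last exact: cumul_homo.
apply: cumul_right => z qz; have [w /= tw wz] := inf_lt hE.1 qz.
by apply: le_trans tw _; exact/cumul_homo/ltW.
Qed.

Lemma quantile_gt t x : 0 < t -> (exists y, t <= cumul y) ->
  (x < quantile t) = (cumul x < t).
Proof. by move=> t0 ty; rewrite !ltNge quantile_le. Qed.

(** The monotone map from Lebesgue measure on ]c, q] to [Theta] conditioned to ]a, b], up to the
    total mass [q - c]. *)
Definition transport (a b c q t : R) : R :=
  quantile (cumul a + (t - c) / (q - c) * (cumul b - cumul a)).

Section transport.
Variables a b c q : R.
Hypotheses (ab : cumul a < cumul b) (cq : c < q).

Lemma transport_gt t x : c < t <= q -> (x < transport a b c q t) =
  (c + (cumul x - cumul a) / (cumul b - cumul a) * (q - c) < t).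
Proof.
move=> /andP[ct tq].
have d0 : 0 < cumul b - cumul a by rewrite subr_gt0.
have e0 : 0 < q - c by rewrite subr_gt0.
have f0 : 0 < t - c by rewrite subr_gt0.
rewrite /transport quantile_gt.
- by rewrite -ltrBlDl -(ltr_pdivrMr _ _ d0) ltr_pdivlMr// ltrBrDl.
- by rewrite ltr_wpDl ?cumul_ge0// mulr_gt0 ?divr_gt0.
- exists b; rewrite -lerBrDl ler_piMl ?(ltW d0)// ler_pdivrMr// mul1r lerD2r//.
Qed.

Lemma transport_le t x : c < t <= q -> (transport a b c q t <= x) =
  (t <= c + (cumul x - cumul a) / (cumul b - cumul a) * (q - c)).
Proof. by move=> tcq; rewrite !leNgt transport_gt. Qed.

Lemma transport_ge_left t : c < t <= q -> a < transport a b c q t.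
Proof.
move=> tcq; rewrite transport_gt// subrr !mul0r addr0.
by case/andP: tcq.
Qed.

Lemma transport_le_right t : c < t <= q -> transport a b c q t <= b.
Proof.
move=> tcq; rewrite transport_le// divff ?subr_eq0 ?gt_eqF// mul1r addrC subrK.
by case/andP: tcq.
Qed.

Lemma transport_homo s t : c < s -> s <= t -> t <= q ->
  transport a b c q s <= transport a b c q t.
Proof.
move=> cs st tq; rewrite leNgt; apply/negP; rewrite transport_gt; last first.
  by rewrite cs (le_trans st).
set v := (c + _); move=> vs.
have : transport a b c q t <= transport a b c q t by [].
rewrite transport_le ?(lt_le_trans cs)// -/v.
by rewrite leNgt (lt_le_trans vs).
Qed.

(** Since the transport is nondecreasing, this is its left continuity. *)
Lemma transport_left t m : c < t <= q -> m < transport a b c q t ->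
  exists2 r, r < t & forall s, r < s <= t -> c < s -> m < transport a b c q s.
Proof.
move=> /[dup] tcq /andP[ct tq]; rewrite transport_gt// => mt.
eexists; first exact: mt.
by move=> s /andP[rs st] cs; rewrite transport_gt// cs (le_trans st).
Qed.

Lemma transport_measurable :
  measurable_fun (`]c, q]%classic : set (measurableTypeR R))
    (transport a b c q : measurableTypeR R -> measurableTypeR R).
Proof.
apply: (measurability _ (measurable_realfun.RGenOInfty.measurableE R)) => _ [_ [x ->] <-].
set v := c + (cumul x - cumul a) / (cumul b - cumul a) * (q - c).
rewrite (_ : _ `&` _ = `]c, q] `&` `]v, +oo[)%classic.
  by apply: measurableI; exact: measurable_itv.
apply/seteqP; split => t [tc] /=; move: (tc); rewrite /= !in_itv /= !andbT => tc';
  by rewrite transport_gt.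
Qed.

(** Both sides are finite on rays and it is enough to compare them there, where [transport_gt] turns
    the preimage into an interval with right end [q]. *)
Lemma transport_law (A : set (measurableTypeR R)) : measurable A ->
  lebesgue_measure (`]c, q] `&` transport a b c q @^-1` A)%classic =
  (((q - c) / (cumul b - cumul a))%:E * Theta (A `&` `]a, b]%classic))%E.
Proof.
have d0 : 0 < cumul b - cumul a by rewrite subr_gt0.
have e0 : 0 < q - c by rewrite subr_gt0.
have ab' : a <= b.
  by rewrite leNgt; apply/negP => /ltW/cumul_homo; rewrite leNgt ab.
have mD : measurable (`]c, q]%classic : set (measurableTypeR R)) by exact: measurable_itv.
have mJ : measurable (`]a, b]%classic : set (measurableTypeR R)) by exact: measurable_itv.
have mT : @measurable_fun _ _ (measurableTypeR R) (measurableTypeR R) setT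
    ((transport a b c q : measurableTypeR R -> measurableTypeR R) \_ `]c, q]).
  by apply/(measurable_restrictT _ mD); exact: transport_measurable.
pose mu : {measure set (measurableTypeR R) -> \bar R} := mrestr lebesgue_measure mD.
pose m1 : {measure set (measurableTypeR R) -> \bar R} :=
  measure_function_pushforward__canonical__measure_function_Measure mu mT.
have k0 : 0 <= (q - c) / (cumul b - cumul a) by rewrite divr_ge0// ltW.
pose m2 : {measure set (measurableTypeR R) -> \bar R} :=
  mscale (NngNum k0) (mrestr Theta mJ).
move=> mA; transitivity (m1 A); last transitivity (m2 A) => //.
  rewrite /m1 /= /pushforward /mu /= /mrestr; congr (lebesgue_measure _).
  apply/seteqP; split => t /=; rewrite patchE.
    by move=> [tc tA]; rewrite mem_set.
  by move=> [+ tc]; rewrite mem_set.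
have m1E (x : R) : m1 `]x, +oo[%classic = m2 `]x, +oo[%classic.
  rewrite /m1 /m2 /= /pushforward /mu /mscale /= /mrestr /=.
  set v := c + (cumul x - cumul a) / (cumul b - cumul a) * (q - c).
  rewrite (_ : _ `&` _ = `]Num.max c v, q]%classic); last first.
    apply/seteqP; split => t /=; rewrite patchE !in_itv /= gt_max ?andbT.
      move=> [+ /[dup] tc /andP[ct tq]]; rewrite mem_set /= ?in_itv// tq ct /= andbT.
      by rewrite transport_gt// => ->.
    move=> /andP[/andP[ct vt] tq]; rewrite ct tq mem_set /= ?in_itv /= ?ct//.
    by rewrite transport_gt ?ct.
  rewrite (_ : `]x, +oo[ `&` `]a, b] = `]Num.max a x, b])%classic; last first.
    by apply/seteqP; split => t /=; rewrite !in_itv /= gt_max andbT;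
      [move=> [-> /andP[-> ->]]|move=> /andP[/andP[-> ->] ->]].
  have [bx|xb] := leP b x.
    rewrite (@set_itv_ge _ _ _ (BRight b)) ?bnd_simp -?leNgt ?le_max ?bx ?orbT//.
    rewrite measure0 mule0 set_itv_ge ?measure0// bnd_simp -leNgt le_max /v.
    apply/orP; right; rewrite -lerBlDl -[leLHS]mul1r ler_pM2r// ler_pdivlMr//.
    by rewrite mul1r lerD2r cumul_homo.
  have vq : v <= q.
    rewrite /v -lerBrDl -[leRHS]mul1r ler_pM2r// ler_pdivrMr// mul1r lerD2r.
    exact/cumul_homo/ltW.
  rewrite lebesgue_measure_itv /= lte_fin -EFinB.
  rewrite measure_itvoc ?ge_max ?ab' ?ltW// -EFinM.
  have -> : Num.max c v = c + (cumul (Num.max a x) - cumul a) / (cumul b - cumul a) * (q - c).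
    have [ax|xa] := leP a x.
      rewrite max_r// /v lerDl mulr_ge0 ?(ltW e0)// divr_ge0 ?(ltW d0)//.
      by rewrite subr_ge0 cumul_homo.
    rewrite subrr !mul0r addr0 max_l// /v gerDl mulr_le0_ge0 ?(ltW e0)//.
    by rewrite mulr_le0_ge0 ?invr_ge0 ?(ltW d0)// subr_le0 cumul_homo// ltW.
  set w := cumul _; have wb : w <= cumul b by rewrite cumul_homo// ge_max ab' ltW.
  have E : q - (c + (w - cumul a) / (cumul b - cumul a) * (q - c)) =
    (q - c) / (cumul b - cumul a) * (cumul b - w) by field; rewrite gt_eqF.
  case: ifPn => [_|]; first by congr (_%:E).
  rewrite -leNgt -subr_le0 E => H; congr (_%:E); apply/eqP; rewrite eq_le H andbT.
  by rewrite mulr_ge0// subr_ge0.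
apply: measure_eq_rays => // x.
rewrite /m1 /= /pushforward /mu /mrestr /=.
apply: (@le_lt_trans _ _ (lebesgue_measure (`]c, q]%classic : set R))).
  apply: le_measure; rewrite ?inE//.
  apply: measurableI => //; rewrite -[X in measurable X]setTI.
  by apply: (mT measurableT); exact: measurable_itv.
by rewrite lebesgue_measure_itv /=; case: ifP => _; rewrite ?ltry// -EFinB ltry.
Qed.

End transport.
End quantile.

(** * The tree of a tooth *)

Section cut.
Context (R : realType).
Implicit Types (p q : R) (h : R -> R).

Definition homo_on p q h :=
  forall s t, p < s -> s <= t -> t <= q -> h s <= h t.

(** Lower semicontinuity from the left, that is left continuity for a nondecreasing function; unlike
    continuity it survives the jumps caused by gaps in the support of [Theta]. *)
Definition left_lsc p q h := forall t m, p < t <= q -> m < h t ->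
  exists2 r, r < t & forall s, r < s <= t -> p < s -> m < h s.

Definition osc_le p q h w :=
  forall s t, p < s -> s <= t -> t <= q -> h t - h s <= w.

(* [osc_le] bounds the oscillation from above, so that the second case covers
   all the bounds [w] at once with the same cut. *)
Definition good_cut (n : nat) p q h c := p < c < q /\
  if odd n then c = (p + q) / 2 else
  forall w, osc_le p q h w -> osc_le p c h (w / 2) /\ osc_le c q h (w / 2).

(** At even generations, cut at the supremum of the points where [h] is at most the middle of its
    range. Pieces are closed on the right, so left semicontinuity puts the cut itself in the lower
    half, and also keeps it away from [q]. If [h] does not exceed the middle of its range at [q], it
    is constant and any cut will do. *)
Lemma good_cut_exists n p q h : p < q -> homo_on p q h -> left_lsc p q h ->
  exists c, good_cut n p q h c.
Proof.
move=> pq hh hl; rewrite /good_cut; case: (odd n).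
  by exists ((p + q) / 2); split => //; apply/andP; split; lra.
pose E0 := [set h s | s in [set s | p < s <= q]].
have E0q : E0 (h q) by exists q => //=; rewrite pq lexx.
have [[H hlb]|nb] := pselect (exists H, lbound E0 H); last first.
  (* No [w] bounds the oscillation when [h] is unbounded below, so the condition on the halves is
     vacuous. *)
  exists ((p + q) / 2); split; first by apply/andP; split; lra.
  move=> w ow; exfalso; apply: nb; exists (h q - w) => _ [s /andP[ps sq] <-].
  by have := ow s q ps sq (lexx _); lra.
have hiE : has_inf E0 by split; [exists (h q)|exists H].
have infE s : p < s <= q -> inf E0 <= h s.
  by move=> ps; apply: ge_inf => //; [case: hiE|exists s].
pose mid := (inf E0 + h q) / 2.
have oscE w : osc_le p q h w -> h q - inf E0 <= w.
  move=> ow; rewrite lerBlDr -lerBlDl; apply: lb_le_inf; first by case: hiE.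
  move=> _ [s /andP[ps sq] <-]; have := ow s q ps sq (lexx _); lra.
have hq0 := infE q; have {}hq0 : inf E0 <= h q by rewrite hq0// pq lexx.
have [mq|qm] := ltP mid (h q); last first.
  have cst s : p < s <= q -> h s = h q.
    move=> /[dup] ps /infE; case/andP: ps => ps sq.
    have := hh s q ps sq (lexx _); rewrite /mid in qm; lra.
  exists ((p + q) / 2); split; first by apply/andP; split; lra.
  move=> w /oscE ow; split => s t ps st tq.
    by rewrite !cst ?(lt_le_trans ps)//=; rewrite /mid in qm; lra.
  by rewrite !cst //=; rewrite /mid in qm; lra.
pose E := [set s | p < s <= q /\ h s <= mid].
have [e Ee] : exists e, E e.
  have im : inf E0 < mid by rewrite /mid; rewrite /mid in mq; lra.
  have [_ [s ps <-] sm] := inf_lt hiE.1 im.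
  by exists s; split => //; exact: ltW.
have hsE : has_sup E.
  by split; [exists e|exists q => s [/andP[]]].
have supE s : E s -> s <= sup E by move=> Es; apply: ub_le_sup => //; case: hsE.
have pc : p < sup E.
  by apply: lt_le_trans (supE _ Ee); case: Ee => /andP[].
have [||r rq Hr] := hl q mid; rewrite ?pq ?lexx//.
have cq : sup E < q.
  apply: le_lt_trans rq; apply: ge_sup; first by exists e.
  move=> s [/andP[ps sq] sm]; rewrite leNgt; apply/negP => rs.
  by have := Hr s; rewrite rs sq => /(_ isT ps); rewrite ltNge sm.
have left s : p < s <= sup E -> h s <= mid.
  move=> /andP[ps sc]; move: (sc); rewrite le_eqVlt => /predU1P[sE|slt].
    rewrite leNgt; apply/negP => ms.
    have [||r' r's Hr'] := hl s mid; rewrite ?ps ?(le_trans sc (ltW cq))//.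
    rewrite sE in r's; have [z Ez r'z] := sup_gt hsE.1 r's.
    have zs : z <= s by rewrite sE; exact: supE.
    case: Ez => /andP[pz _]; rewrite leNgt => /negP; apply.
    by apply: Hr' => //; rewrite r'z.
  have [z Ez sz] := sup_gt hsE.1 slt; case: Ez => /andP[pz zq] zm.
  by apply: le_trans zm; apply: hh => //; exact: ltW.
have right s : sup E < s -> s <= q -> mid < h s.
  move=> cs sq; rewrite ltNge; apply/negP => sm.
  have /supE : E s by split => //; rewrite sq (lt_trans pc).
  by rewrite leNgt cs.
exists (sup E); split; first by rewrite pc.
move=> w /oscE ow; split => s t ps st tq.
  have := left t; rewrite (lt_le_trans ps st) tq => /(_ isT).
  have := infE s; rewrite ps (le_trans st (le_trans tq (ltW cq))) => /(_ isT).
  rewrite /mid; lra.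
have := right s ps (le_trans st tq).
have := hh t q (lt_trans pc (lt_le_trans ps st)) tq (lexx _).
rewrite /mid; lra.
Qed.

Definition split_pt n p q h : R := xget ((p + q) / 2) [set c | good_cut n p q h c].

Lemma split_ptP n p q h : p < q -> homo_on p q h -> left_lsc p q h ->
  good_cut n p q h (split_pt n p q h).
Proof.
move=> pq hh hl; have [c gc] := good_cut_exists n pq hh hl.
exact: (@xgetPex _ ((p + q) / 2) [set c | good_cut n p q h c] (ex_intro _ c gc)).
Qed.

Lemma homo_on_sub p q p' q' h : p <= p' -> q' <= q -> homo_on p q h ->
  homo_on p' q' h.
Proof.
move=> pp qq hh s t ps st tq; apply: hh => //; first exact: le_lt_trans ps.
exact: le_trans tq _.
Qed.

Lemma homo_onD p q h g : homo_on p q h -> homo_on p q g ->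
  homo_on p q (fun t => h t + g t).
Proof. by move=> hh hg s t ps st tq; rewrite lerD ?hh ?hg. Qed.

Lemma left_lsc_sub p q p' q' h : p <= p' -> q' <= q -> left_lsc p q h ->
  left_lsc p' q' h.
Proof.
move=> pp qq hl t m /andP[pt tq] mt.
have [|r rt Hr] := hl t m _ mt; first by rewrite (le_lt_trans pp)// (le_trans tq).
by exists r => // s rs ps; apply: Hr => //; exact: le_lt_trans ps.
Qed.

Lemma left_lscD p q h g : left_lsc p q h -> left_lsc p q g ->
  left_lsc p q (fun t => h t + g t).
Proof.
move=> hl gl t m pt mt; pose e := (h t + g t - m) / 2.
have [|r rt Hr] := hl t (h t - e) pt; first by rewrite /e; lra.
have [|r' r't Hr'] := gl t (g t - e) pt; first by rewrite /e; lra.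
exists (Num.max r r'); first by rewrite gt_max rt.
move=> s /andP[]; rewrite gt_max => /andP[rs r's] st ps.
have := Hr s; have := Hr' s; rewrite rs r's st => /(_ isT ps) + /(_ isT ps).
rewrite /e; lra.
Qed.

End cut.

Section tree.
Context (R : realType) (Theta : probability (measurableTypeR R) R).
Hypothesis Theta_nonneg : Theta [set x : R | 0 <= x] = 1%E.
Variables (a0 b0 : R) (wa wb : nat -> R).

Let F := cumul Theta.
Let tr := transport Theta.

(* [pot] is the sum of the root function and of the gates of the ancestors that
   depend on the node: its oscillation controls all of theirs. *)
Record node := Node { lo : R ; hi : R ; pot : R -> R }.

(* Words list the choices from the last one to the first one. *)
Fixpoint node_at (w : seq bool) : node :=
  if w is b :: v then
    let nd := node_at v in
    let c := split_pt (size v) (lo nd) (hi nd) (pot nd) in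
    if b then Node c (hi nd)
      (fun t => pot nd t + tr (wa (size v)) (wb (size v)) c (hi nd) t)
    else Node (lo nd) c (pot nd)
  else Node 0 1 (tr a0 b0 0 1).

Definition wlo w := lo (node_at w).
Definition whi w := hi (node_at w).
Definition wpot w := pot (node_at w).
Definition wcut w := split_pt (size w) (wlo w) (whi w) (wpot w).
(* The distance between a point of the left half of the node [w] and a point of
   the right half, as a function of the latter. *)
Definition gate w := tr (wa (size w)) (wb (size w)) (wcut w) (whi w).
Definition in_piece t w := wlo w < t <= whi w.

Hypothesis F_ab0 : F a0 < F b0.
Hypothesis F_win : forall n, F (wa n) < F (wb n).

Lemma node_inv w : [/\ wlo w < whi w, homo_on (wlo w) (whi w) (wpot w),
  left_lsc (wlo w) (whi w) (wpot w), 0 <= wlo w & whi w <= 1].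
Proof.
elim: w => [|b v [pq hh hl p0 q1]].
  split; rewrite /wlo /whi /wpot //=.
  - by move=> s t; apply: transport_homo.
  - by move=> t m; apply: transport_left.
have [/andP[pc cq] _] := split_ptP (size v) pq hh hl.
rewrite /wlo /whi /wpot; case: b => /=; rewrite -/(wlo v) -/(whi v) -/(wpot v) -/(wcut v).
- split => //; rewrite ?(le_trans p0 (ltW pc))//.
  + apply: homo_onD; first by apply: homo_on_sub hh => //; exact: ltW.
    by move=> s t; apply: transport_homo.
  + apply: left_lscD; first by apply: left_lsc_sub hl => //; exact: ltW.
    by move=> t m; apply: transport_left.
- split => //; rewrite ?(le_trans (ltW cq) q1)//.
  + by apply: homo_on_sub hh => //; exact: ltW.
  + by apply: left_lsc_sub hl => //; exact: ltW.
Qed.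

Lemma wlo_lt w : wlo w < whi w. Proof. by case: (node_inv w). Qed.

Lemma wcutP w : good_cut (size w) (wlo w) (whi w) (wpot w) (wcut w).
Proof. by apply: split_ptP; case: (node_inv w). Qed.

Lemma wlo_lt_cut w : wlo w < wcut w. Proof. by case: (wcutP w) => /andP[]. Qed.
Lemma wcut_lt_hi w : wcut w < whi w. Proof. by case: (wcutP w) => /andP[]. Qed.

Lemma in_piece_cons b w t :
  in_piece t (b :: w) <-> in_piece t w /\ b = (wcut w < t).
Proof.
have := wlo_lt_cut w; have := wcut_lt_hi w.
rewrite /in_piece /wlo /whi; case: b => /=;
  rewrite -/(wlo w) -/(whi w) -/(wpot w) -/(wcut w) => cq pc.
- split => [/andP[ct ->]|[/andP[pt ->] <-//]].
  by rewrite ct (lt_trans pc).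
- split => [/andP[-> tc]|[/andP[-> tq] /esym]].
    by rewrite (le_trans tc (ltW cq)) ltNge tc.
  by rewrite ltNge => /negbFE.
Qed.

Lemma in_piece_hi w : in_piece (whi w) w.
Proof. by rewrite /in_piece wlo_lt lexx. Qed.

Lemma gate_homo w s t : wcut w < s -> s <= t -> t <= whi w ->
  gate w s <= gate w t.
Proof. by apply: transport_homo => //; exact: wcut_lt_hi. Qed.

Section widths.
Variable omega : nat -> R.
Hypothesis omega0 : b0 - a0 <= omega 0.
Hypothesis omegaS : forall n,
  (if odd n then omega n else omega n / 2) + (wb n - wa n) <= omega n.+1.

Lemma win_lt n : wa n < wb n.
Proof.
by rewrite ltNge; apply/negP => /(cumul_homo Theta); rewrite leNgt F_win.
Qed.

(** An even generation halves the oscillation of the inherited potential and an odd one does not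
    increase it; the right child adds the oscillation of its gate, at most the width of a window.
    This is the recursion of [omegaS]. *)
Lemma osc_wpot w : osc_le (wlo w) (whi w) (wpot w) (omega (size w)).
Proof.
elim: w => [|b v IH].
  move=> s t ps st tq; rewrite /wpot /=.
  have := @transport_le_right _ _ Theta_nonneg a0 b0 0 1 F_ab0 ltr01 t.
  have := @transport_ge_left _ _ Theta_nonneg a0 b0 0 1 F_ab0 ltr01 s.
  rewrite (lt_le_trans ps st) ps tq (le_trans st tq) => /(_ isT) + /(_ isT).
  rewrite -/tr; move: omega0; lra.
have [/andP[pc cq] Hcut] := wcutP v; have := omegaS (size v).
have tb s : wcut v < s <= whi v -> wa (size v) <= gate v s <= wb (size v).
  move=> sc; apply/andP; split.
    by apply/ltW/transport_ge_left => //.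
  exact: transport_le_right.
have := win_lt (size v).
move: Hcut; case: (odd (size v)) => [_|/(_ _ IH)[H1 H2]] wl oS;
  move=> s t; rewrite /wlo /whi /wpot;
  case: b => /=; rewrite -/(wlo v) -/(whi v) -/(wpot v) -/(wcut v);
  rewrite -/(gate v _) => ps st tq.
- have := IH s t (lt_trans pc ps) st tq.
  have := tb s; have := tb t.
  rewrite ps tq (lt_le_trans ps st) (le_trans st tq) => /(_ isT)/andP[_ h1] /(_ isT)/andP[h2 _].
  rewrite /gate in h1 h2; move: h1 h2 oS wl; lra.
- have := IH s t ps st (le_trans tq (ltW cq)); move: oS wl; lra.
- have := H2 s t ps st tq.
  have := tb s; have := tb t.
  rewrite ps tq (lt_le_trans ps st) (le_trans st tq) => /(_ isT)/andP[_ h1] /(_ isT)/andP[h2 _].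
  rewrite /gate in h1 h2; move: h1 h2 oS wl; lra.
- have := H1 s t ps st tq; move: oS wl; lra.
Qed.

End widths.

(** Only the odd generations bisect, whence the half in the exponent; the others do not lengthen
    pieces. *)
Lemma width_le w : whi w - wlo w <= (2^-1) ^+ (size w)./2.
Proof.
elim: w => [|b v IH]; first by rewrite /whi /wlo /= expr0 subr0.
have [/andP[pc cq] Hcut] := wcutP v.
rewrite /whi /wlo; move: Hcut => /=; rewrite uphalf_half.
case: (odd (size v)) => [cE|_]; rewrite ?add0n ?add1n ?exprS;
  case: b => /=; rewrite -/(wlo v) -/(whi v) -/(wpot v) -/(wcut v).
- by rewrite cE; move: IH; lra.
- by rewrite cE; move: IH; lra.
- by apply: le_trans IH; rewrite lerD2l lerN2 ltW.
- by apply: le_trans IH; rewrite lerD2r ltW.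
Qed.

(** When the increments of [f] are at most those of the potential, the bound on the oscillation of
    the potential passes to [f]. *)
Definition dominated f w := forall s t, wlo w < s -> s <= t -> t <= whi w ->
  f t - f s <= wpot w t - wpot w s.

Lemma dominated_cons f b w : dominated f w -> dominated f (b :: w).
Proof.
have pc := wlo_lt_cut w; have cq := wcut_lt_hi w.
move=> fw s t; rewrite /wlo /whi /wpot; case: b => /=;
  rewrite -/(wlo w) -/(whi w) -/(wpot w) -/(wcut w) => ps st tq.
- have := fw s t (lt_trans pc ps) st tq.
  have := gate_homo ps st tq; rewrite /gate; lra.
- exact: fw s t ps st (le_trans tq (ltW cq)).
Qed.

Lemma dominated_root u : dominated (tr a0 b0 0 1) u.
Proof. by elim: u => [s t _ _ _|b u IH] //; exact: dominated_cons. Qed.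

Lemma dominated_gate u w : dominated (gate w) (u ++ true :: w).
Proof.
elim: u => [|b u IH] /=; last exact: dominated_cons.
have [_ hh _ _ _] := node_inv w; have pc := wlo_lt_cut w.
move=> s t; rewrite /wlo /whi /wpot /=.
rewrite -/(wlo w) -/(whi w) -/(wpot w) -/(wcut w) => ps st tq.
have := hh s t (lt_trans pc ps) st tq; rewrite /gate; lra.
Qed.

Lemma stem_cat (x : cantor_space) m k :
  exists2 u, size u = k & stem x (k + m) = u ++ stem x m.
Proof.
elim: k => [|k [u uk E]]; first by exists [::].
by exists (x (k + m)%N :: u); rewrite /= ?uk ?E.
Qed.

Lemma dominated_gate_stem (x : cantor_space) n m : (n < m)%N -> x n ->
  dominated (gate (stem x n)) (stem x m).
Proof.
move=> nm xn; have [u _] := stem_cat x n.+1 (m - n.+1).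
rewrite subnK// => -> /=; rewrite xn; exact: dominated_gate.
Qed.

Lemma in_piece_le (x : cantor_space) m n t : (m <= n)%N ->
  in_piece t (stem x n) -> in_piece t (stem x m).
Proof.
move=> mn; have [u _] := stem_cat x m (n - m); rewrite subnK// => ->.
by elim: u => //= b u IH /in_piece_cons[/IH].
Qed.

(* The value at a point of the Cantor set of a left-continuous function on
   (0,1]: its left limit when the point is the left side of a cut. *)
Definition ext (f : R -> R) (x : cantor_space) : R :=
  sup [set m | exists n, forall t, in_piece t (stem x n) -> m <= f t].

Lemma ext_bounds f x n l r :
  (forall t, in_piece t (stem x n) -> l <= f t <= r) -> l <= ext f x <= r.
Proof.
move=> H; rewrite /ext; set E := [set m | exists n, _].
have El : E l by exists n => t /H /andP[].
have ubE : ubound E r.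
  move=> m [k Hk]; pose t := whi (stem x (maxn n k)).
  have tp : in_piece t (stem x (maxn n k)) by exact: in_piece_hi.
  have := Hk t (in_piece_le (leq_maxr n k) tp).
  have /andP[_ tr_] := H t (in_piece_le (leq_maxl n k) tp).
  by move/le_trans; apply.
apply/andP; split; last by apply: ge_sup => //; exists l.
by apply: ub_le_sup => //; exists r.
Qed.

Lemma ext_close f x y n w : stem x n = stem y n ->
  homo_on (wlo (stem x n)) (whi (stem x n)) f ->
  osc_le (wlo (stem x n)) (whi (stem x n)) f w -> `|ext f x - ext f y| <= w.
Proof.
move=> xy hf of_; pose q := whi (stem x n).
have fq t : in_piece t (stem x n) -> f q - w <= f t <= f q.
  move=> /andP[pt tq]; have := of_ t q pt tq (lexx _).
  by have := hf t q pt tq (lexx _); lra.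
have := ext_bounds fq; have fq' t : in_piece t (stem y n) -> f q - w <= f t <= f q.
  by rewrite -xy; exact: fq.
by have := ext_bounds fq'; rewrite ler_norml; lra.
Qed.

Fixpoint address_word (t : R) (n : nat) : seq bool :=
  if n is m.+1 then (wcut (address_word t m) < t) :: address_word t m else [::].

(** The expansion of [t] along the cuts of the tree: it sends Lebesgue measure on ]0, 1] to the
    measure giving each cylinder the length of its piece. *)
Definition address (t : R) : cantor_space := fun n => wcut (address_word t n) < t.

Lemma stem_address t n : stem (address t) n = address_word t n.
Proof. by elim: n => //= n ->. Qed.

Lemma in_piece_address t n : 0 < t <= 1 -> in_piece t (address_word t n).
Proof. by move=> t01; elim: n => //= n IH; apply/in_piece_cons. Qed.

Lemma address_word_in_piece t w : in_piece t w -> address_word t (size w) = w.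
Proof.
by elim: w => //= b w IH /in_piece_cons[/IH -> <-].
Qed.

Lemma address_stem t w : 0 < t <= 1 ->
  (stem (address t) (size w) = w) <-> in_piece t w.
Proof.
move=> t01; rewrite stem_address; split=> [<-|]; first exact: in_piece_address.
exact: address_word_in_piece.
Qed.

(** Pieces containing [t] shrink to [t]. On such a piece, [f] is at least [f t] to the right of [t]
    by monotonicity, and almost so to the left by left continuity. *)
Lemma ext_address f t n : 0 < t <= 1 ->
  homo_on (wlo (address_word t n)) (whi (address_word t n)) f ->
  left_lsc (wlo (address_word t n)) (whi (address_word t n)) f ->
  ext f (address t) = f t.
Proof.
move=> t01 hf lf; rewrite /ext; set E := [set m | _].
have ubE : ubound E (f t).
  by move=> m [k]; rewrite stem_address; apply; exact: in_piece_address.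
have EP m : m < f t -> E m.
  move=> mt; have /andP[pt tq] := in_piece_address n t01.
  have [|r rt Hr] := lf t m _ mt; first by rewrite pt.
  have [k Hk] : exists k, (2^-1 : R) ^+ k < t - r.
    have tr0 : 0 < t - r by rewrite subr_gt0.
    have : (2^-1 : R) ^+ k @[k --> \oo] --> 0 by apply: cvg_expr; rewrite ger0_norm; lra.
    move/cvgrPdist_lt/(_ _ tr0) => [N _ /(_ N (leqnn _))] /=.
    by rewrite sub0r normrN ger0_norm ?exprn_ge0// => H; exists N.
  (* The pieces of generation [2 k] have length at most 2^-k, hence less than [t - r]. *)
  exists (maxn n k.*2) => s sp.
  have sn : in_piece s (address_word t n).
    by rewrite -stem_address; apply: in_piece_le sp; exact: leq_maxl.
  have sk : in_piece s (address_word t k.*2).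
    by rewrite -stem_address; apply: in_piece_le sp; exact: leq_maxr.
  case/andP: sn => ps sq.
  have [ts|st] := leP t s; first by apply: le_trans (ltW mt) _; exact: hf.
  apply/ltW/Hr => //; rewrite (ltW st) andbT.
  have /andP[tp' tq'] := in_piece_address k.*2 t01.
  case/andP: sk => ps' sq'; have := width_le (address_word t k.*2).
  have -> : size (address_word t k.*2) = k.*2.
    by rewrite -stem_address size_stem.
  rewrite doubleK; lra.
have Em : E (f t - 1) by apply: EP; lra.
apply/eqP; rewrite eq_le; apply/andP; split.
  by apply: ge_sup => //; exists (f t - 1).
rewrite leNgt; apply/negP => st.
have := EP (((sup E) + f t) / 2) => /(_ ltac:(lra)) Emid.
have : (sup E + f t) / 2 <= sup E by apply: ub_le_sup => //; exists (f t).
lra.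
Qed.

End tree.

(** * The metric of a tooth *)

Definition meet_at (x y : cantor_space) (n : nat) : Prop :=
  stem x n = stem y n /\ x n != y n.

Lemma meet_sym x y n : meet_at x y n -> meet_at y x n.
Proof. by move=> [xy xyn]; split; [exact: esym|rewrite eq_sym]. Qed.

Lemma meet_uniq x y m n : meet_at x y m -> meet_at x y n -> m = n.
Proof.
move=> [/stemP xm /eqP xym] [/stemP xn /eqP xyn].
by case: (ltngtP m n) => // [/xn|/xm].
Qed.

Lemma stem_neq x y n : stem x n <> stem y n -> exists2 k, (k < n)%N & meet_at x y k.
Proof.
elim: n => //= n IH H; have [xy|/IH[k kn mk]] := pselect (stem x n = stem y n).
  by exists n => //; split=> //; apply/eqP => xyn; apply: H; rewrite xyn xy.
by exists k => //; exact: ltnW.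
Qed.

Lemma meet_or_eq x y : x = y \/ exists n, meet_at x y n.
Proof.
have [->|xy] := pselect (x = y); first by left.
right; apply: contrapT => H; apply: xy; apply/funext => k.
have [/stemP /(_ k)->//|/stem_neq[m _ mm]] := pselect (stem x k.+1 = stem y k.+1).
by exfalso; apply: H; exists m.
Qed.

Section tree_metric.
Context (R : realType) (Theta : probability (measurableTypeR R) R).
Hypothesis Theta_nonneg : Theta [set x : R | 0 <= x] = 1%E.
Variables (a0 b0 : R) (wa wb omega : nat -> R) (L : R).
Hypothesis F_ab0 : cumul Theta a0 < cumul Theta b0.
Hypothesis F_win : forall n, cumul Theta (wa n) < cumul Theta (wb n).
Hypothesis omega0 : b0 - a0 <= omega 0.
Hypothesis omegaS : forall n,
  (if odd n then omega n else omega n / 2) + (wb n - wa n) <= omega n.+1.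
Hypothesis omega_le : forall n, omega n <= wa n.
Hypothesis wa_gt0 : forall n, 0 < wa n.
Hypothesis wa_homo : forall m n, (m <= n)%N -> wa n <= wa m.
Hypothesis wa_lim : forall e, 0 < e -> exists n, wa n < e.
Hypothesis wb_le : forall n, wb n <= L * wa n.
Hypothesis wb_a0 : forall n, wb n <= a0.
Hypothesis L_ge1 : 1 <= L.
Hypothesis L_le2 : L <= 2.

Let node_at := node_at Theta a0 b0 wa wb.
Let gate := gate Theta a0 b0 wa wb.
Let ext := ext Theta a0 b0 wa wb.

Definition tree_u (x y : cantor_space) : R :=
  if pselect (exists n, meet_at x y n) is left h then wa (projT1 (cid h)) else 0.

Definition tree_d (x y : cantor_space) : R :=
  if pselect (exists n, meet_at x y n) is left h then
    let n := projT1 (cid h) in ext (gate (stem x n)) (if x n then x else y)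
  else 0.

Definition tree_g (x : cantor_space) : R :=
  ext (transport Theta a0 b0 0 1) x.

Lemma tree_uE x y n : meet_at x y n -> tree_u x y = wa n.
Proof.
move=> m; rewrite /tree_u; case: pselect => [h|[]]; last by exists n.
by case: cid => k /= /meet_uniq/(_ m) ->.
Qed.

Lemma tree_dE x y n : meet_at x y n ->
  tree_d x y = ext (gate (stem x n)) (if x n then x else y).
Proof.
move=> m; rewrite /tree_d; case: pselect => [h|[]]; last by exists n.
by case: cid => k /= /meet_uniq/(_ m) ->.
Qed.

Lemma not_meet x n : ~ meet_at x x n.
Proof. by move=> [_]; rewrite eqxx. Qed.

Lemma tree_uxx x : tree_u x x = 0.
Proof. by rewrite /tree_u; case: pselect => // h; exfalso; case: h => n /not_meet. Qed.

Lemma tree_dxx x : tree_d x x = 0.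
Proof. by rewrite /tree_d; case: pselect => // h; exfalso; case: h => n /not_meet. Qed.

Lemma gate_bounds w t : in_piece Theta a0 b0 wa wb t (true :: w) ->
  wa (size w) <= gate w t <= wb (size w).
Proof.
have cq := wcut_lt_hi Theta_nonneg F_ab0 F_win w.
move=> tp; apply/andP; split.
  exact/ltW/(transport_ge_left Theta_nonneg (F_win _) cq).
exact: (transport_le_right Theta_nonneg (F_win _) cq).
Qed.

Lemma tree_d_bounds x y n : meet_at x y n -> wa n <= tree_d x y <= wb n.
Proof.
move=> m; rewrite (tree_dE m); move: m => [xy xyn].
have H z : stem z n = stem x n -> z n ->
    wa n <= ext (gate (stem x n)) z <= wb n.
  move=> zx zn; apply: (@ext_bounds _ _ Theta_nonneg _ _ _ _ F_ab0 F_win _ _ n.+1) => t.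
  rewrite /= zn zx => /gate_bounds; by rewrite size_stem.
case: ifPn => xn; first exact: H.
apply: H; first by rewrite xy.
by move: xyn xn; case: (x n); case: (y n).
Qed.

Lemma tree_u_le x y : tree_u x y <= tree_d x y.
Proof.
have [->|[n m]] := meet_or_eq x y; first by rewrite tree_uxx tree_dxx.
by rewrite (tree_uE m); case/andP: (tree_d_bounds m).
Qed.

Lemma tree_u_ge0 x y : 0 <= tree_u x y.
Proof.
have [->|[n m]] := meet_or_eq x y; first by rewrite tree_uxx.
by rewrite (tree_uE m) ltW.
Qed.

Lemma tree_d_sym x y : tree_d x y = tree_d y x.
Proof.
have [->//|[n m]] := meet_or_eq x y.
case: (m) => xy xyn; rewrite (tree_dE m) (tree_dE (meet_sym m)) xy.
move: xyn.
by case: (x n); case: (y n).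
Qed.

Lemma tree_u_sym x y : tree_u x y = tree_u y x.
Proof.
have [->//|[n m]] := meet_or_eq x y.
by rewrite (tree_uE m) (tree_uE (meet_sym m)).
Qed.

Lemma tree_u_ultra x y z : tree_u x z <= Num.max (tree_u x y) (tree_u y z).
Proof.
have [->|[n m]] := meet_or_eq x z; first by rewrite tree_uxx le_max tree_u_ge0.
rewrite (tree_uE m) le_max.
have [xy|/stem_neq[k kn mk]] := pselect (stem x n = stem y n); last first.
  by rewrite (tree_uE mk) (wa_homo (ltnW kn)) ?orbT.
have [xyn|xyn] := eqVneq (x n) (y n); last by rewrite (@tree_uE x y n) ?lexx//; split.
rewrite (@tree_uE y z n) ?lexx ?orbT//.
by case: m => xz xzn; split; rewrite -?xy -?xyn.
Qed.

(** Both points lie in the same node of generation [n], where the potential oscillates by at most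
    [omega n <= wa n], and [wa n] is precisely [tree_u x y]. *)
Lemma ext_lip f x y n : meet_at x y n ->
  homo_on (wlo Theta a0 b0 wa wb (stem x n)) (whi Theta a0 b0 wa wb (stem x n)) f ->
  dominated Theta a0 b0 wa wb f (stem x n) ->
  `|ext f x - ext f y| <= tree_u x y.
Proof.
move=> m hf df; rewrite (tree_uE m); case: m => xy _.
apply: (ext_close Theta_nonneg F_ab0 F_win xy hf) => s t ps st tq.
apply: le_trans (df s t ps st tq) _; apply: le_trans (omega_le n).
have := osc_wpot Theta_nonneg F_ab0 F_win omega0 omegaS ps st tq.
by rewrite size_stem.
Qed.

Lemma tree_g_lip x y : `|tree_g x - tree_g y| <= tree_u x y.
Proof.
have [->|[n m]] := meet_or_eq x y; first by rewrite subrr normr0 tree_uxx.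
apply: (ext_lip m); last exact: dominated_root.
have [_ _ _ p0 q1] := node_inv Theta_nonneg F_ab0 F_win (stem x n).
apply: (@homo_on_sub _ 0 1) => // s t; exact: transport_homo.
Qed.

Lemma ext_gate_lip x y n : stem x n.+1 = stem y n.+1 -> x n ->
  `|ext (gate (stem x n)) x - ext (gate (stem x n)) y| <= tree_u x y.
Proof.
move=> xy xn; have [<-|[k mk]] := meet_or_eq x y.
  by rewrite subrr normr0 tree_uxx.
have nk : (n < k)%N.
  rewrite ltnNge; apply/negP => kn; case: mk => _ /eqP; apply.
  by move/stemP : xy; apply.
apply: (ext_lip mk); last exact: dominated_gate_stem.
have sub t : in_piece Theta a0 b0 wa wb t (stem x k) ->
    wcut Theta a0 b0 wa wb (stem x n) < t <= whi Theta a0 b0 wa wb (stem x n).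
  by move/(in_piece_le Theta_nonneg F_ab0 F_win nk) => /=; rewrite xn.
move=> s t ps st tq; apply: gate_homo => //.
  by have /sub/andP[] : in_piece Theta a0 b0 wa wb s (stem x k) by rewrite /in_piece ps (le_trans st).
by have /sub/andP[] : in_piece Theta a0 b0 wa wb t (stem x k) by rewrite /in_piece tq (lt_le_trans ps).
Qed.

(** If [y] separates from [x] before [z] does, both distances on the right are at least [wa n], and
    [L <= 2] suffices. Otherwise [y] is on the side of [x] or of [z]; its distance to the point
    across is given by the same gate, whose variation along that side is at most the remaining
    distance. *)
Lemma tree_d_tri x y z : tree_d x z <= tree_d x y + tree_d y z.
Proof.
have d0 u v : 0 <= tree_d u v by apply: le_trans (tree_u_ge0 u v) (tree_u_le u v).
have [->|[n m]] := meet_or_eq x z; first by rewrite tree_dxx addr_ge0.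
have [xy|/[dup] nxy /stem_neq[k kn mk]] := pselect (stem x n = stem y n); last first.
  have mk' : meet_at y z k.
    case: mk => /stemP xyk nk; case: m => /stemP xz _; split.
      by apply/stemP => j jk; rewrite -xyk// xz// (ltn_trans jk).
    by rewrite -(xz _ kn) eq_sym.
  have /andP[h1 _] := tree_d_bounds mk; have /andP[h2 _] := tree_d_bounds mk'.
  have /andP[_ h3] := tree_d_bounds m; have h4 := wb_le n.
  have h5 := wa_homo (ltnW kn); have h6 := wa_gt0 n.
  have : L * wa n <= 2 * wa n by rewrite ler_pM2r.
  lra.
(* [u] and [v] lie on the same side and [w] on the other one. *)
have key u v w : stem u n = stem v n -> u n = v n -> meet_at u w n ->
    tree_d u w <= tree_d v w + tree_d u v.
  move=> uv uvn muw.
  have mvw : meet_at v w n by case: muw => uw uwn; split; rewrite -?uv -?uvn.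
  rewrite (tree_dE muw) (tree_dE mvw) -uvn -uv.
  (* When [u] is on the left side, both distances to [w] depend on [w] alone and are equal. *)
  case: ifPn => [un|_]; last by rewrite lerDl.
  have uv1 : stem u n.+1 = stem v n.+1 by rewrite /= uv uvn.
  have := ext_gate_lip uv1 un; have := tree_u_le u v.
  by rewrite ler_norml; lra.
have [xyn|xyn] := eqVneq (x n) (y n).
  by have := key x y z xy xyn m; lra.
have xz : stem x n = stem z n by case: m.
have yzn : y n = z n.
  by case: m => _; move: xyn; case: (x n); case: (y n); case: (z n).
have := key z y x (etrans (esym xz) xy) (esym yzn) (meet_sym m).
by rewrite !(tree_d_sym z) (tree_d_sym y x) addrC; lra.
Qed.

Lemma tree_tooth : is_tooth L a0 b0 tree_g tree_d tree_u.
Proof.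
have gb x : a0 <= tree_g x <= b0.
  apply: (@ext_bounds _ _ Theta_nonneg _ _ _ _ F_ab0 F_win _ _ 0) => t t01.
  by rewrite ltW ?(transport_ge_left Theta_nonneg F_ab0)// (transport_le_right Theta_nonneg F_ab0).
split.
- exact: tree_u_ge0.
- move=> x y; split => [|->]; last exact: tree_uxx.
  have [//|[n m]] := meet_or_eq x y; rewrite (tree_uE m) => w0.
  by have := wa_gt0 n; rewrite w0 ltxx.
- exact: tree_u_sym.
- exact: tree_u_ultra.
- exact: tree_d_sym.
- exact: tree_d_tri.
- exact: tree_u_le.
- move=> x y; have [->|[n m]] := meet_or_eq x y; first by rewrite tree_uxx tree_dxx mulr0.
  by rewrite (tree_uE m); case/andP: (tree_d_bounds m) => _ /le_trans; apply.
- move=> x y; have [->|[n m]] := meet_or_eq x y.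
    by rewrite tree_dxx; have := wb_a0 0; have := win_lt F_win 0; have := wa_gt0 0; lra.
  by case/andP: (tree_d_bounds m) => _ /le_trans; apply.
- by move=> x; case/andP: (gb x).
- by move=> x; case/andP: (gb x).
- exact: tree_g_lip.
- move=> n; exists (wa n) => // x y uw.
  have [//|/stem_neq[k kn mk]] := pselect (stem x n = stem y n).
  move: uw; rewrite (tree_uE mk) ltNge => /negP; case; exact/wa_homo/ltnW.
- move=> e /wa_lim[n we]; exists n => x y xy.
  have [->|[k mk]] := meet_or_eq x y; first by rewrite tree_uxx (lt_trans (wa_gt0 n)).
  rewrite (tree_uE mk); apply: le_lt_trans we; apply: wa_homo.
  rewrite leqNgt; apply/negP => kn; case: mk => _ /eqP; apply.
  by move/stemP : xy; apply.
Qed.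

End tree_metric.

(** * The law of the distance inside a tooth *)

Fixpoint words (n : nat) : seq (seq bool) :=
  if n is m.+1 then map (cons false) (words m) ++ map (cons true) (words m)
  else [:: [::]].

Lemma mem_words n w : (w \in words n) = (size w == n).
Proof.
elim: n w => [|n IH] [|b w] //=; first by rewrite mem_cat; apply/orP => -[] /mapP[].
rewrite mem_cat; have inj c : injective (cons c : seq bool -> _) by move=> u v [].
have F c v : (c :: v \in map (cons (~~ c)) (words n)) = false.
  by apply/negP => /mapP[u _ []]; case: c.
by case: b; rewrite mem_map// IH eqSS; [rewrite (F true)|rewrite (F false) orbF].
Qed.

Lemma words_uniq n : uniq (words n).
Proof.
elim: n => //= n IH; rewrite cat_uniq !map_inj_uniq ?IH /=; try by move=> u v [].
by rewrite andbT; apply/hasPn => _ /mapP[v _ ->]; apply/mapP => -[u _].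
Qed.

Section tree_law.
Context (R : realType) (Theta : probability (measurableTypeR R) R).
Hypothesis Theta_nonneg : Theta [set x : R | 0 <= x] = 1%E.
Variables (a0 b0 : R) (wa wb : nat -> R).
Hypothesis F_ab0 : cumul Theta a0 < cumul Theta b0.
Hypothesis F_win : forall n, cumul Theta (wa n) < cumul Theta (wb n).

Let lo := wlo Theta a0 b0 wa wb.
Let hi := whi Theta a0 b0 wa wb.
Let mid := wcut Theta a0 b0 wa wb.

(** The probability that two independent uniform points of ]0, 1] separate at the generation [n]. *)
Definition split_mass n : R :=
  \sum_(w <- words n) (2 * (mid w - lo w) * (hi w - mid w)).

(** The probability that two independent uniform points of ]0, 1] are still together at the
    generation [n]. *)
Definition square_mass n : R := \sum_(w <- words n) (hi w - lo w) ^+ 2.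

Lemma split_mass_ge0 n : 0 <= split_mass n.
Proof.
apply: sumr_ge0 => w _; have := wlo_lt_cut Theta_nonneg F_ab0 F_win w.
have := wcut_lt_hi Theta_nonneg F_ab0 F_win w; rewrite -/(lo w) -/(hi w) -/(mid w).
by move=> h1 h2; rewrite !mulr_ge0// subr_ge0 ltW.
Qed.

Lemma sum_width n : \sum_(w <- words n) (hi w - lo w) = 1.
Proof.
elim: n => [|n IH]; first by rewrite big_seq1 /hi /lo /whi /wlo /= subr0.
rewrite big_cat !big_map /= -big_split -[RHS]IH; apply: eq_bigr => w _ /=.
by rewrite /hi /lo /whi /wlo /=; lra.
Qed.

Lemma square_massS n : square_mass n.+1 = square_mass n - split_mass n.
Proof.
rewrite /square_mass /split_mass big_cat !big_map /= -big_split /= -sumrB.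
apply: eq_bigr => w _ /=; rewrite {1 2}/hi {1 2}/lo /whi /wlo /=.
rewrite -/(whi _ _ _ _ _ w) -/(wlo _ _ _ _ _ w) -/(lo w) -/(hi w).
rewrite -/(wpot _ _ _ _ _ w) -/(wcut _ _ _ _ _ w) -/(mid w); ring.
Qed.

Lemma square_mass_le n : square_mass n <= (2^-1) ^+ n./2.
Proof.
apply: (@le_trans _ _ ((2^-1) ^+ n./2 * \sum_(w <- words n) (hi w - lo w))).
  2: by rewrite sum_width mulr1.
rewrite mulr_sumr /square_mass big_seq [leRHS]big_seq.
apply: ler_sum => w; rewrite mem_words => /eqP wn.
have lh : 0 <= hi w - lo w by rewrite subr_ge0 ltW// (wlo_lt Theta_nonneg F_ab0 F_win).
rewrite expr2 ler_wpM2r//.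
by have := width_le Theta_nonneg F_ab0 F_win w; rewrite wn.
Qed.

Lemma square_mass_ge0 n : 0 <= square_mass n.
Proof. by apply: sumr_ge0 => w _; exact: sqr_ge0. Qed.

Lemma split_mass_le n : split_mass n <= (2^-1) ^+ n./2.
Proof.
by have := square_massS n; have := square_mass_le n; have := square_mass_ge0 n.+1; lra.
Qed.

(** The sum telescopes to [1 - square_mass n]: two points separate almost surely. *)
Lemma sum_split_mass : (\sum_(n <oo) (split_mass n)%:E = 1)%E.
Proof.
apply/cvg_lim => //.
have -> : (fun n => \sum_(0 <= i < n) (split_mass i)%:E)%E =
    (fun n => (1 - square_mass n)%:E).
  apply/funext => n; rewrite sumEFin; congr (_%:E).
  elim: n => [|n IH]; last by rewrite big_nat_recr//= IH square_massS; lra.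
  by rewrite big_geq// /square_mass big_seq1 /hi /lo /whi /wlo /= subr0 expr1n subrr.
apply: cvg_EFin; first exact: nearW.
rewrite -[X in _ --> X]subr0; apply: cvgB; first exact: cvg_cst.
have h0 : (2^-1 : R) ^+ k @[k --> \oo] --> 0 by apply: cvg_expr; rewrite ger0_norm; lra.
apply/cvgrPdist_le => e e0; move/cvgrPdist_le/(_ _ e0) : h0 => [N _ HN].
exists N.*2 => // n /= Nn; rewrite sub0r normrN ger0_norm ?square_mass_ge0//.
apply: le_trans (square_mass_le n) _.
have := HN n./2; rewrite /= sub0r normrN ger0_norm ?exprn_ge0//; apply.
by rewrite -(doubleK N) half_leq.
Qed.

(* A tooth of mass [s] placed on the interval ]P, P + s] of the unit interval. *)
Variables (P s : R).
Hypothesis s_gt0 : 0 < s.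

Definition placed_address (t : R) : cantor_space :=
  address Theta a0 b0 wa wb ((t - P) / s).

Lemma placed_in01 t : P < t <= P + s -> 0 < (t - P) / s <= 1.
Proof.
move=> /andP[Pt tQ]; apply/andP; split; first by rewrite divr_gt0// subr_gt0.
by rewrite ler_pdivrMr// mul1r lerBlDl.
Qed.

Lemma placed_stem t w : P < t <= P + s ->
  stem (placed_address t) (size w) = w <->
  P + s * lo w < t <= P + s * hi w.
Proof.
move=> tP; rewrite /placed_address.
rewrite (address_stem Theta_nonneg F_ab0 F_win w (placed_in01 tP)).
rewrite /in_piece -/(lo w) -/(hi w) ltr_pdivlMr// ler_pdivrMr//.
by rewrite ltrBrDl lerBlDl [lo w * s]mulrC [hi w * s]mulrC.
Qed.

Lemma placed_piece_sub w : 0 <= lo w /\ hi w <= 1.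
Proof. by have [] := node_inv Theta_nonneg F_ab0 F_win w. Qed.

Lemma placed_piece t w : P + s * lo w < t <= P + s * hi w -> P < t <= P + s.
Proof.
move=> /andP[h1 h2]; have [l0 h01] := placed_piece_sub w.
have : 0 <= s * lo w by rewrite mulr_ge0// ltW.
have : s * hi w <= s by rewrite ger_pMr.
by move=> *; apply/andP; split; lra.
Qed.

Lemma transport_placed a b c q t : c < q ->
  transport Theta a b c q ((t - P) / s) =
  transport Theta a b (P + s * c) (P + s * q) t.
Proof.
move=> cq; rewrite /transport; congr (quantile _ (_ + _ * _)).
have -> : P + s * q - (P + s * c) = s * (q - c) by ring.
by field; rewrite !gt_eqF// subr_gt0.
Qed.

Lemma ext_root_address t : P < t <= P + s ->
  tree_g Theta a0 b0 wa wb (placed_address t) =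
  transport Theta a0 b0 P (P + s) t.
Proof.
move=> tP; rewrite /tree_g /placed_address.
rewrite (@ext_address _ _ Theta_nonneg _ _ _ _ F_ab0 F_win _ _ 0 (placed_in01 tP)).
- by rewrite transport_placed// mulr0 mulr1 addr0.
- by move=> u v; exact: transport_homo.
- by move=> u v; exact: transport_left.
Qed.

Lemma ext_gate_address t w :
  P + s * mid w < t <= P + s * hi w ->
  ext Theta a0 b0 wa wb (gate Theta a0 b0 wa wb w) (placed_address t) =
  transport Theta (wa (size w)) (wb (size w)) (P + s * mid w) (P + s * hi w) t.
Proof.
move=> tp; have tP : P < t <= P + s by exact: (@placed_piece t (true :: w)).
have cq := wcut_lt_hi Theta_nonneg F_ab0 F_win w.
rewrite /placed_address.
have E : address_word Theta a0 b0 wa wb ((t - P) / s) (size w).+1 = true :: w.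
  rewrite -(stem_address Theta a0 b0 wa wb); exact/(placed_stem (true :: w) tP).
rewrite (@ext_address _ _ Theta_nonneg _ _ _ _ F_ab0 F_win _ _ (size w).+1 (placed_in01 tP)) ?E.
- by rewrite -transport_placed.
- by move=> u v; apply: transport_homo.
- by move=> u v; apply: transport_left.
Qed.

Lemma root_law (A : set (measurableTypeR R)) : measurable A ->
  lebesgue_measure [set t | P < t <= P + s /\
    A (tree_g Theta a0 b0 wa wb (placed_address t))] =
  ((s / (cumul Theta b0 - cumul Theta a0))%:E * Theta (A `&` `]a0, b0]%classic))%E.
Proof.
move=> mA; have PQ : P < P + s by rewrite ltrDl.
have := transport_law Theta_nonneg F_ab0 PQ mA.
have -> : P + s - P = s by ring.
move=> <-; congr (lebesgue_measure _); apply/seteqP; split => t /=; rewrite in_itv /=.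
  by move=> [tP]; rewrite ext_root_address.
by move=> [tP]; rewrite -ext_root_address.
Qed.

Lemma gate_law w (A : set (measurableTypeR R)) : measurable A ->
  lebesgue_measure [set t | P < t <= P + s /\
    (stem (placed_address t) (size w).+1 = true :: w /\
    A (ext Theta a0 b0 wa wb (gate Theta a0 b0 wa wb w) (placed_address t)))] =
  ((s * (hi w - mid w) / (cumul Theta (wb (size w)) - cumul Theta (wa (size w))))%:E *
    Theta (A `&` `](wa (size w)), (wb (size w))]%classic))%E.
Proof.
move=> mA; have cq := wcut_lt_hi Theta_nonneg F_ab0 F_win w.
have PQ : P + s * mid w < P + s * hi w by rewrite ltrD2l ltr_pM2l.
have := transport_law Theta_nonneg (F_win (size w)) PQ mA.
have -> : P + s * hi w - (P + s * mid w) = s * (hi w - mid w) by ring.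
move=> <-; congr (lebesgue_measure _); apply/seteqP; split => t /=; rewrite in_itv /=.
  by move=> [tP [/(placed_stem (true :: w) tP) tw]]; rewrite ext_gate_address.
move=> [tw At]; have tP : P < t <= P + s by exact: (@placed_piece t (true :: w)).
split => //; rewrite ext_gate_address//; split => //.
exact/(placed_stem (true :: w) tP).
Qed.

Lemma stem_set w : [set t | P < t <= P + s /\
    stem (placed_address t) (size w) = w] = `](P + s * lo w), (P + s * hi w)]%classic.
Proof.
apply/seteqP; split => t /=; rewrite in_itv /=.
  by move=> [tP /(placed_stem w tP)].
move=> tw; have tP := placed_piece tw.
by split => //; apply/(placed_stem w tP).
Qed.

End tree_law.

Lemma measure_bigsetU_seq d (T : measurableType d) (R : realType)
    (mu : {measure set T -> \bar R}) (I : choiceType) (s : seq I) (B : I -> set T) :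
  uniq s -> (forall i, measurable (B i)) ->
  (forall i j, i != j -> B i `&` B j = set0) ->
  mu (\big[setU/set0]_(i <- s) B i) = (\sum_(i <- s) mu (B i))%E.
Proof.
move=> + mB dB; elim: s => [|i s IH] /=; first by rewrite !big_nil measure0.
move=> /andP[nis us]; rewrite !big_cons measureU//; first by congr (_ + _)%E; exact: IH.
  exact: bigsetU_measurable.
rewrite -subset0 => x [Bi]; rewrite -bigcup_seq => -[j /= js Bj].
have ij : i != j by apply: contraNneq nis => ->.
by have : (B i `&` B j) x by []; rewrite dB.
Qed.

(* The conditions under which the window sequence [wa, wb] yields a tree with
   values in [a0, b0]; [omega n] bounds the oscillation of the potentials of
   the nodes of generation [n]. *)
Record admissible (R : realType) (Theta : probability (measurableTypeR R) R)
    (L a0 b0 : R) (wa wb : nat -> R) : Prop := Admissible {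
  adm_root : cumul Theta a0 < cumul Theta b0 ;
  adm_win : forall n, cumul Theta (wa n) < cumul Theta (wb n) ;
  adm_gt0 : forall n, 0 < wa n ;
  adm_homo : forall m n, (m <= n)%N -> wa n <= wa m ;
  adm_lim : forall e, 0 < e -> exists n, wa n < e ;
  adm_win_le : forall n, wb n <= L * wa n ;
  adm_win_root : forall n, wb n <= a0 ;
  adm_root_le : b0 <= L * a0 ;
  adm_omega : exists omega, [/\ b0 - a0 <= omega 0, forall n,
    (if odd n then omega n else omega n / 2) + (wb n - wa n) <= omega n.+1 &
    forall n, omega n <= wa n] }.

(* The tooth [i] has mass [sk_s i] and occupies ]P i, P i + s i] in the unit
   interval, in the order of the heights, so that [sk_P i] is the mass below it.
   In [sk_law] the first term comes from the pairs with a point in the tooth [i]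
   and a point below it, the second one from the pairs inside the tooth [i]
   separated at the generation [n]. *)
Record skeleton (R : realType) (Theta : probability (measurableTypeR R) R)
    (L : R) := Skeleton {
  sk_a : nat -> R ;
  sk_b : nat -> R ;
  sk_wa : nat -> nat -> R ;
  sk_wb : nat -> nat -> R ;
  sk_P : nat -> R ;
  sk_s : nat -> R ;
  sk_Theta : Theta [set x : R | 0 <= x] = 1%E ;
  sk_L1 : 1 <= L ;
  sk_L2 : L <= 2 ;
  sk_adm : forall i, admissible Theta L (sk_a i) (sk_b i) (sk_wa i) (sk_wb i) ;
  sk_finite : forall r M, 0 < r -> exists N, forall i, (N <= i)%N ->
    sk_b i < r \/ M < sk_a i ;
  sk_accum : forall r, 0 < r -> exists i, sk_b i < r ;
  sk_order : forall i j, i != j ->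
    (sk_b i <= sk_a j /\ sk_P i + sk_s i <= sk_P j) \/
    (sk_b j <= sk_a i /\ sk_P j + sk_s j <= sk_P i) ;
  sk_P_ge0 : forall i, 0 <= sk_P i ;
  sk_s_gt0 : forall i, 0 < sk_s i ;
  sk_le1 : forall i, sk_P i + sk_s i <= 1 ;
  sk_cover : forall t, 0 < t < 1 -> exists i, sk_P i < t <= sk_P i + sk_s i ;
  sk_law : forall A : set (measurableTypeR R), measurable A ->
    (Theta A = \sum_(i <oo)
     ((2 * sk_P i * sk_s i / (cumul Theta (sk_b i) - cumul Theta (sk_a i)))%:E *
        Theta (A `&` `](sk_a i), (sk_b i)]%classic) +
      \sum_(n <oo) (sk_s i ^+ 2 *
          split_mass Theta (sk_a i) (sk_b i) (sk_wa i) (sk_wb i) n /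
          (cumul Theta (sk_wb i n) - cumul Theta (sk_wa i n)))%:E *
        Theta (A `&` `](sk_wa i n), (sk_wb i n)]%classic)))%E }.

(** * The comb of a skeleton and its parametrisation *)

Section skeleton_comb.
Context (R : realType) (Theta : probability (measurableTypeR R) R) (L : R).
Variable k : skeleton Theta L.

Let nonneg := sk_Theta k.
Let adm := sk_adm k.

Lemma sk_a_gt0 i : 0 < sk_a k i.
Proof.
apply: lt_le_trans (adm_win_root (adm i) 0).
exact: lt_trans (adm_gt0 (adm i) 0) (win_lt (adm_win (adm i)) 0).
Qed.

Lemma sk_tooth i : is_tooth L (sk_a k i) (sk_b k i)
  (tree_g Theta (sk_a k i) (sk_b k i) (sk_wa k i) (sk_wb k i))
  (tree_d Theta (sk_a k i) (sk_b k i) (sk_wa k i) (sk_wb k i))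
  (tree_u (sk_wa k i)).
Proof.
have [w [h1 h2 h3]] := adm_omega (adm i).
apply: (@tree_tooth _ _ nonneg _ _ _ _ w) => //.
- exact: adm_root (adm i).
- exact: adm_win (adm i).
- exact: adm_gt0 (adm i).
- exact: adm_homo (adm i).
- exact: adm_lim (adm i).
- exact: adm_win_le (adm i).
- exact: adm_win_root (adm i).
- exact: sk_L2 k.
Qed.

Definition sk_comb : comb R := @Comb R L (sk_a k) (sk_b k)
  (fun i => tree_g Theta (sk_a k i) (sk_b k i) (sk_wa k i) (sk_wb k i))
  (fun i => tree_d Theta (sk_a k i) (sk_b k i) (sk_wa k i) (sk_wb k i))
  (fun i => tree_u (sk_wa k i))
  (sk_L1 k) sk_a_gt0 (fun i => adm_root_le (adm i)) sk_tooth
  (sk_finite k) (sk_accum k).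

Local Notation S := (comb_space sk_comb).

Definition in_place i t := sk_P k i < t <= sk_P k i + sk_s k i.

Definition sk_address i t : cantor_space :=
  placed_address Theta (sk_a k i) (sk_b k i) (sk_wa k i) (sk_wb k i)
    (sk_P k i) (sk_s k i) t.

(** The parametrisation of the comb by the unit interval. The base point serves as default value; by
    [sk_cover] it is not taken on ]0, 1[. *)
Definition sk_map (t : R) : S :=
  if pselect (exists i, in_place i t) is left h then
    tooth_in sk_comb (projT1 (cid h)) (sk_address (projT1 (cid h)) t)
  else None.

Lemma in_place_uniq i j t : in_place i t -> in_place j t -> i = j.
Proof.
move=> /andP[it ti] /andP[jt tj]; apply/eqP; apply: contrapT => /negP.
by move=> /(sk_order k)[[_ h]|[_ h]]; lra.
Qed.

Lemma sk_mapE i t : in_place i t -> sk_map t = tooth_in sk_comb i (sk_address i t).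
Proof.
move=> it; rewrite /sk_map; case: pselect => [h|[]]; last by exists i.
by case: cid => j /= /in_place_uniq/(_ it) ->.
Qed.

Lemma sk_map_tooth i t x : sk_map t = tooth_in sk_comb i x ->
  in_place i t /\ x = sk_address i t.
Proof.
rewrite /sk_map; case: pselect => // h; case: cid => j jt /= [ji <-].
by rewrite ji in jt *.
Qed.

Definition cyl i (w : seq bool) : set S :=
  [set p | exists2 x, p = tooth_in sk_comb i x & stem x (size w) = w].

Lemma cyl_open i w : open (cyl i w).
Proof. exact: tooth_cyl_open. Qed.

Lemma cyl_measurable i w : measurable (cyl i w : set (borel S)).
Proof. by apply: sub_sigma_algebra; exact: cyl_open. Qed.

Lemma sk_map_cyl i w : sk_map @^-1` cyl i w =
  `](sk_P k i + sk_s k i * wlo Theta (sk_a k i) (sk_b k i) (sk_wa k i) (sk_wb k i) w),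
    (sk_P k i + sk_s k i * whi Theta (sk_a k i) (sk_b k i) (sk_wa k i) (sk_wb k i) w)]%classic.
Proof.
rewrite -(stem_set nonneg (adm_root (adm i)) (adm_win (adm i)) (sk_P k i) (sk_s_gt0 k i)).
apply/seteqP; split => t /=.
  by move=> [x /sk_map_tooth[it ->] xw].
by move=> [it xw]; exists (sk_address i t) => //; exact: sk_mapE.
Qed.

(** An open set meets a tooth in the union of the cylinders it contains. There are countably many of
    them, and their preimages are intervals. *)
Lemma sk_map_measurable : measurable_fun setT
  (sk_map : measurableTypeR R -> borel S).
Proof.
apply: (measurability _ (erefl : @measurable _ (borel S) = <<s @open S >>)).
move=> _ [U oU <-]; rewrite setTI.
pose I i : set (measurableTypeR R) := [set t | in_place i t].
have mI i : measurable (I i).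
  have -> : I i = `](sk_P k i), (sk_P k i + sk_s k i)]%classic.
    by apply/seteqP; split => t /=; rewrite in_itv.
  exact: measurable_itv.
pose K i n : set (measurableTypeR R) := \big[setU/set0]_(w <- words n | `[< cyl i w `<=` U >])
  (sk_map @^-1` cyl i w).
have mK i n : measurable (K i n).
  by apply: bigsetU_measurable => w _; rewrite sk_map_cyl; exact: measurable_itv.
have -> : sk_map @^-1` U = (\bigcup_i \bigcup_n K i n) `|`
    (if `[< U None >] then ~` (\bigcup_i I i) else set0).
  apply/seteqP; split => t /=.
    have [[i it]|nit] := pselect (exists i, in_place i t).
      rewrite (sk_mapE it) => Ut; left; exists i => //.
      have := tooth_in_continuous (c := sk_comb) (i := i) (x := sk_address i t).
      have L0 : 0 < L by exact: lt_le_trans (sk_L1 k).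
      move: (oU); rewrite openE => /(_ _ Ut) /nbhs_ballP[e /= e0 eU] _.
      have [n Hn] := tooth_cont (comb_tooth sk_comb i) (divr_gt0 e0 L0).
      exists n => //; rewrite /K -bigcup_seq_cond; exists (stem (sk_address i t) n).
        rewrite /= mem_words size_stem eqxx /=; apply/asboolP => _ [x -> xw].
        apply: eU; rewrite ballEmdist /= comb_mdistE /= eqxx.
        apply: le_lt_trans (tooth_d_le (comb_tooth sk_comb i) _ _) _.
        rewrite mulrC -ltr_pdivlMr//; apply: Hn.
        by rewrite -[in LHS]xw size_stem.
      by exists (sk_address i t); [exact: sk_mapE|rewrite size_stem].
    have -> : sk_map t = None by rewrite /sk_map; case: pselect.
    move=> UN; right; rewrite asboolT//=; first by move=> [i _]; apply: contra_not nit => ?; exists i.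
  move=> [[i _ [n _]]|].
    rewrite /K -bigcup_seq_cond => -[w /= /andP[_ /asboolP cU]]; exact: cU.
  case: asboolP => //= UN nI; rewrite /sk_map; case: pselect => // -[i it].
  by exfalso; apply: nI; exists i.
apply: measurableU; first by do 2!apply: bigcupT_measurable => ?; exact: mK.
case: ifP => _ //; apply: measurableC; exact: bigcupT_measurable.
Qed.

End skeleton_comb.

(** * The law of the distance *)

Section unit_interval.
Context (R : realType).

Let mI : measurable (`]0, 1[%classic : set (measurableTypeR R)).
Proof. exact: measurable_itv. Qed.

(** The end point 1 is left out because the places of the teeth are only required to cover ]0, 1[:
    in the unbounded case their right ends tend to 1 without reaching it. *)
Definition unit_measure : {measure set (measurableTypeR R) -> \bar R} :=
  mrestr lebesgue_measure mI.

Lemma unit_measureE (E : set (measurableTypeR R)) : measurable E ->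
  (forall t, E t -> 0 < t <= 1) -> unit_measure E = lebesgue_measure E.
Proof.
move=> mE E01; rewrite /unit_measure /= /mrestr.
have -> : lebesgue_measure E =
    lebesgue_measure ((E `&` `]0, 1[%classic) `|` (E `&` [set 1])).
  congr lebesgue_measure; apply/seteqP; split => t /=; rewrite in_itv /=.
    move=> Et; have /andP[t0] := E01 t Et; rewrite le_eqVlt => /predU1P[t1|t1].
      by right; split.
    by left; rewrite t0.
  by case=> -[].
rewrite measureU0//; [exact: measurableI|exact: measurableI|].
apply: (@subset_measure0 _ _ _ lebesgue_measure _ [set 1]) => //.
- exact: measurableI.
- exact: lebesgue_measure_set1.
Qed.

Lemma unit_measure_itv (u v : R) : 0 <= u -> u <= v -> v <= 1 ->
  unit_measure `]u, v]%classic = (v - u)%:E.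
Proof.
move=> u0 uv v1; rewrite unit_measureE ?lebesgue_measure_itv /= ?lte_fin; last 2 first.
- exact: measurable_itv.
- move=> t /=; rewrite in_itv /= => /andP[ut tv].
  by rewrite (le_lt_trans u0)// (le_trans tv).
by case: ltP => [_|vu]; rewrite -?EFinB//; congr (_%:E); lra.
Qed.

Lemma unit_measureT : unit_measure setT = 1%E.
Proof.
rewrite /unit_measure /= /mrestr setTI lebesgue_measure_itv /= lte_fin ltr01.
by rewrite -EFinB subr0.
Qed.

End unit_interval.

(** * The probability measure on the comb *)

Section skeleton_measure.
Context (R : realType) (Theta : probability (measurableTypeR R) R) (L : R).
Variable k : skeleton Theta L.
Local Notation S := (comb_space (sk_comb k)).

Let nonneg := sk_Theta k.
Let adm := sk_adm k.
Local Notation cylk := (@cyl R Theta L k).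
Local Notation toot := (tooth_in (sk_comb k)).
Local Notation rootf i :=
  (tree_g Theta (sk_a k i) (sk_b k i) (sk_wa k i) (sk_wb k i)).
Local Notation gatef i w :=
  (ext Theta (sk_a k i) (sk_b k i) (sk_wa k i) (sk_wb k i)
    (gate Theta (sk_a k i) (sk_b k i) (sk_wa k i) (sk_wb k i) w)).
Local Notation lo i := (wlo Theta (sk_a k i) (sk_b k i) (sk_wa k i) (sk_wb k i)).
Local Notation hi i := (whi Theta (sk_a k i) (sk_b k i) (sk_wa k i) (sk_wb k i)).
Local Notation mid i := (wcut Theta (sk_a k i) (sk_b k i) (sk_wa k i) (sk_wb k i)).

Definition sk_measure : set (borel S) -> \bar R :=
  pushforward (unit_measure R)
    (@sk_map R Theta L k : measurableTypeR R -> borel S).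

HB.instance Definition _ := Measure.copy sk_measure
  (measure_function_pushforward__canonical__measure_function_Measure
    (unit_measure R) (@sk_map_measurable R Theta L k)).

Lemma sk_measureE B : sk_measure B = unit_measure R (@sk_map _ _ _ k @^-1` B).
Proof. by []. Qed.

Lemma sk_measureT : sk_measure setT = 1%E.
Proof. by rewrite sk_measureE preimage_setT unit_measureT. Qed.

HB.instance Definition _ := Measure_isProbability.Build _ _ _ sk_measure sk_measureT.

Definition sk_prob : probability (borel S) R := sk_measure.

(** The Lipschitz bound makes [f] continuous on the open cylinder, so that preimages of open
    intervals are open; these intervals generate the Borel sets. *)
Lemma piece_measurable i w (f : cantor_space -> R) :
  (forall x y, stem x (size w) = w -> stem y (size w) = w ->
    `|f x - f y| <= tree_u (sk_wa k i) x y) ->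
  forall A : set (measurableTypeR R), measurable A ->
  measurable ([set p | exists2 x, p = toot i x &
    stem x (size w) = w /\ A (f x)] : set (borel S)).
Proof.
move=> lip A mA.
pose G (p : S) : R := if p is Some (_, x) then f x else 0.
have mG : @measurable_fun _ _ (borel S) (measurableTypeR R) (cylk i w) G.
  apply: (measurability _ (measurable_realfun.RGenOpens.measurableE R)).
  move=> _ [_ [l [r ->]] <-]; apply: sub_sigma_algebra.
  rewrite openE => _ [[x -> xw]] /=; rewrite in_itv /= => /andP[lx xr].
  pose e := Num.min (Num.min (f x - l) (r - f x)) (sk_a k i).
  have e0 : 0 < e by rewrite !lt_min !subr_gt0 lx xr sk_a_gt0.
  have nx : nbhs (toot i x) (cylk i w).
    by apply: open_nbhs_nbhs; split; [exact: cyl_open|exists x].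
  have nb : nbhs (toot i x) (ball (toot i x) e) by exact: nbhsx_ballx.
  apply: filterS (filterI nx nb) => _ [[y -> yw]].
  rewrite ballEmdist /= comb_mdistE /= eqxx !lt_min => /andP[/andP[dl dr] _].
  split; first by exists y.
  have := lip x y xw yw; have := tooth_u_le (sk_tooth k i) x y.
  by rewrite in_itv /= ler_norml; lra.
have := mG (cyl_measurable (k := k) i w) A mA.
congr measurable; apply/seteqP; split => p /=.
  by move=> [[x -> xw] /= Ax]; exists x.
by move=> [x -> [xw Ax]]; split => //; exists x.
Qed.

Definition root_set i (A : set R) : set S :=
  [set p | exists2 x, p = toot i x & A (rootf i x)].

Definition gate_set i w (A : set R) : set S :=
  [set p | exists2 x, p = toot i x &
    stem x (size w).+1 = true :: w /\ A (gatef i w x)].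

(** Teeth are compared by heights and not by indices, which alternate between small and large teeth
    in the unbounded case. *)
Definition lower_set i : set S :=
  [set p | p = None \/ exists2 j, sk_b k j <= sk_a k i & exists x, p = toot j x].

Lemma root_lip i x y : `|rootf i x - rootf i y| <= tree_u (sk_wa k i) x y.
Proof. exact: (tooth_g_lip (sk_tooth k i)). Qed.

Lemma gate_lip i w x y : stem x (size w).+1 = true :: w ->
  stem y (size w).+1 = true :: w ->
  `|gatef i w x - gatef i w y| <= tree_u (sk_wa k i) x y.
Proof.
move=> xw yw; have [v [h1 h2 h3]] := adm_omega (adm i).
have [xn xw'] : x (size w) = true /\ stem x (size w) = w by move: xw => /= [-> ->].
have := ext_gate_lip nonneg (adm_root (adm i)) (adm_win (adm i)) h1 h2 h3.
move=> /(_ x y (size w)); rewrite xw'; apply; last by rewrite xn.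
by rewrite xw yw.
Qed.

Lemma root_set_measurable i (A : set (measurableTypeR R)) : measurable A ->
  measurable (root_set i A : set (borel S)).
Proof.
move=> mA; have := @piece_measurable i [::] (rootf i) _ A mA.
move=> /(_ (fun x y _ _ => root_lip i x y)); congr measurable.
apply/seteqP; split => p [x -> H]; exists x => //; first by case: H.
Qed.

Lemma gate_set_measurable i w (A : set (measurableTypeR R)) : measurable A ->
  measurable (gate_set i w A : set (borel S)).
Proof.
move=> mA; exact: (@piece_measurable i (true :: w) (gatef i w) (@gate_lip i w) A mA).
Qed.

Lemma lower_set_measurable i : measurable (lower_set i : set (borel S)).
Proof.
have -> : lower_set i = ~` (\bigcup_(j in [set j | ~~ (sk_b k j <= sk_a k i)]) cylk j [::]).
  apply/seteqP; split => p.
    move=> [->|[j ji [x ->]]]; first by move=> [l _ [x]].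
    by move=> [l /= nl [y [jl _] _]]; move: nl; rewrite -jl ji.
  case: p => [[j x]|] H; last by left.
  right; exists j; last by exists x.
  by apply: contrapT => nj; apply: H; exists j; [exact/negP|exists x].
by apply: measurableC; apply: bigcup_measurable => j _; exact: cyl_measurable.
Qed.

Let inP i t : in_place k i t -> 0 < t <= 1.
Proof.
move=> /andP[h1 h2]; have := sk_P_ge0 k i; have := sk_le1 k i.
by move=> h3 h4; apply/andP; split; lra.
Qed.

Lemma sk_measure_root i (A : set (measurableTypeR R)) : measurable A ->
  sk_measure (root_set i A) =
  ((sk_s k i / (cumul Theta (sk_b k i) - cumul Theta (sk_a k i)))%:E *
   Theta (A `&` `](sk_a k i), (sk_b k i)]%classic))%E.
Proof.
move=> mA; rewrite -(root_law nonneg (adm_root (adm i)) (adm_win (adm i)) (sk_P k i) (sk_s_gt0 k i))//.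
have E : @sk_map _ _ _ k @^-1` root_set i A =
    [set t | sk_P k i < t <= sk_P k i + sk_s k i /\ A (rootf i (sk_address k i t))].
  apply/seteqP; split => t /=.
    by move=> [x /sk_map_tooth[it ->] Ax].
  by move=> [it Ax]; exists (sk_address k i t) => //; exact: sk_mapE.
rewrite sk_measureE unit_measureE.
- by rewrite E.
- rewrite -[X in measurable X]setTI; apply: sk_map_measurable => //.
  exact: root_set_measurable.
- by move=> t; rewrite E => -[/inP].
Qed.

Lemma sk_measure_gate i w (A : set (measurableTypeR R)) : measurable A ->
  sk_measure (gate_set i w A) =
  ((sk_s k i * (hi i w - mid i w) /
     (cumul Theta (sk_wb k i (size w)) - cumul Theta (sk_wa k i (size w))))%:E *
   Theta (A `&` `](sk_wa k i (size w)), (sk_wb k i (size w))]%classic))%E.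
Proof.
move=> mA; rewrite -(gate_law nonneg (adm_root (adm i)) (adm_win (adm i)) (sk_P k i) (sk_s_gt0 k i))//.
have E : @sk_map _ _ _ k @^-1` gate_set i w A =
    [set t | sk_P k i < t <= sk_P k i + sk_s k i /\
      (stem (sk_address k i t) (size w).+1 = true :: w /\ A (gatef i w (sk_address k i t)))].
  apply/seteqP; split => t /=.
    by move=> [x /sk_map_tooth[it ->] Ax].
  by move=> [it Ax]; exists (sk_address k i t) => //; exact: sk_mapE.
rewrite sk_measureE unit_measureE.
- by rewrite E.
- rewrite -[X in measurable X]setTI; apply: sk_map_measurable => //.
  exact: gate_set_measurable.
- by move=> t; rewrite E => -[/inP].
Qed.

Lemma sk_measure_cyl i w : sk_measure (cylk i w) =
  (sk_s k i * (hi i w - lo i w))%:E.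
Proof.
have [l0 h1] := placed_piece_sub nonneg (adm_root (adm i)) (adm_win (adm i)) w.
have lh := wlo_lt nonneg (adm_root (adm i)) (adm_win (adm i)) w.
have s0 := sk_s_gt0 k i; have P0 := sk_P_ge0 k i; have P1 := sk_le1 k i.
rewrite sk_measureE sk_map_cyl unit_measure_itv.
- by congr (_%:E); ring.
- by rewrite addr_ge0// mulr_ge0// ltW.
- by rewrite lerD2l ler_pM2l// ltW.
- by apply: le_trans P1; rewrite lerD2l ger_pMr.
Qed.

(** Places are in the order of heights, so that in the parameter this set is ]0, [sk_P i]]. *)
Lemma sk_measure_lower i : sk_measure (lower_set i) = (sk_P k i)%:E.
Proof.
have P0 := sk_P_ge0 k i; have P1 := sk_le1 k i; have s0 := sk_s_gt0 k i.
rewrite -[RHS](_ : unit_measure R `]0, (sk_P k i)]%classic = _); last first.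
  by rewrite unit_measure_itv ?subr0//; lra.
rewrite sk_measureE /unit_measure /= /mrestr; congr lebesgue_measure.
apply/seteqP; split => t /=; rewrite !in_itv /= => -[H /andP[t0 t1]];
  rewrite t0 t1; split => //; have [j jt] := sk_cover k (introT andP (conj t0 t1)).
  move: H; rewrite (sk_mapE jt) => -[//|[l li [x [jl _]]]]; subst l.
  rewrite /=; have ij : i != j.
    apply/eqP => ij; subst j; have := adm_root (adm i); rewrite ltNge.
    by rewrite (cumul_homo Theta li).
  have := sk_order k ij; case/andP: jt => jt tj => -[[bi _]|[_ Pi]]; last by lra.
  have := adm_root (adm i); rewrite ltNge => /negP[]; apply: cumul_homo.
  apply: le_trans bi _; apply: le_trans li.
  by rewrite leNgt; apply/negP => /ltW/(cumul_homo Theta); rewrite leNgt (adm_root (adm j)).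
rewrite (sk_mapE jt); right; exists j; last by exists (sk_address k j t).
have ij : i != j.
  apply/eqP => ij; subst j; case/andP: jt; rewrite /= in H; move: H => /andP[_ H]; lra.
case: (sk_order k ij) => -[h1 h2] //; case/andP: jt; case/andP: H; lra.
Qed.

End skeleton_measure.

(** * Decomposition of pairs of points *)

Section skeleton_law.
Context (R : realType) (Theta : probability (measurableTypeR R) R) (L : R).
Variable k : skeleton Theta L.
Local Notation S := (comb_space (sk_comb k)).

Let nonneg := sk_Theta k.
Let adm := sk_adm k.
Local Notation cylk := (@cyl R Theta L k).
Local Notation toot := (tooth_in (sk_comb k)).
Local Notation rootf i :=
  (tree_g Theta (sk_a k i) (sk_b k i) (sk_wa k i) (sk_wb k i)).
Local Notation hi i := (whi Theta (sk_a k i) (sk_b k i) (sk_wa k i) (sk_wb k i)).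

Lemma sk_a_lt_b i : sk_a k i < sk_b k i.
Proof.
rewrite ltNge; apply/negP => /(cumul_homo Theta).
by rewrite leNgt (adm_root (adm i)).
Qed.

Let g_ge i x : sk_a k i <= rootf i x.
Proof. exact: (tooth_g_ge (sk_tooth k i)). Qed.

Let g_le i x : rootf i x <= sk_b k i.
Proof. exact: (tooth_g_le (sk_tooth k i)). Qed.

Let g_ge0 i x : 0 <= rootf i x.
Proof. exact: le_trans (ltW (sk_a_gt0 k i)) (g_ge i x). Qed.

Lemma dist_root i (A : set R) (p q : S) : root_set i A p -> lower_set i q ->
  A (comb_dist p q).
Proof.
move=> [x -> Ax] [->|[j ji [y ->]]] /=; first by rewrite max_l.
case: eqVneq => [ij|_].
  by move: ji; rewrite -ij leNgt sk_a_lt_b.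
by rewrite max_l// (le_trans (g_le _ _))// (le_trans ji).
Qed.

Lemma dist_gate i w (A : set R) (p q : S) : cylk i (false :: w) p ->
  gate_set i w A q -> A (comb_dist p q).
Proof.
move=> [x -> /= [xn xw]] [y -> [/= [yn yw] Ay]]; rewrite eqxx.
have m : meet_at x y (size w) by split; [rewrite xw yw|rewrite xn yn].
by rewrite (tree_dE _ _ _ _ _ m) xn xw.
Qed.

Lemma dist_cases (A : set R) (p q : S) : p <> q -> A (comb_dist p q) ->
  exists i, (root_set i A p /\ lower_set i q) \/
    (root_set i A q /\ lower_set i p) \/
    exists w, (cylk i (false :: w) p /\ gate_set i w A q) \/
      (cylk i (false :: w) q /\ gate_set i w A p).
Proof.
case: p q => [[i x]|] [[j y]|] //=.
- have [<-|ij] := eqVneq i j.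
    move=> xy Ad; have [xyE|[n m]] := meet_or_eq x y; first by rewrite xyE in xy.
    exists i; right; right; exists (stem x n).
    have xyn : stem x n = stem y n by case: m.
    move: Ad; rewrite (tree_dE _ _ _ _ _ m) => Ad.
    case: (boolP (x n)) Ad => xn Ad.
      have yn : y n = false by case: m => _; rewrite xn; case: (y n).
      right; split; [exists y|exists x] => //=; rewrite size_stem ?yn ?xn//.
      by rewrite xyn.
    have yn : y n by case: m => _; move: xn; case: (x n); case: (y n).
    left; split; [exists x|exists y] => //=; rewrite size_stem ?yn ?(negbTE xn)//.
    by rewrite -xyn.
  move=> _ Ad; case: (sk_order k ij) => -[ba _].
    exists j; right; left; split; first exists y => //.
      by move: Ad; rewrite max_r// (le_trans (g_le _ _))// (le_trans ba).
    by right; exists i => //; exists x.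
  exists i; left; split; first exists x => //.
    by move: Ad; rewrite max_l// (le_trans (g_le _ _))// (le_trans ba).
  by right; exists j => //; exists y.
- rewrite max_l// => _ Ad; exists i; left; split; last by left.
  by exists x.
- rewrite max_r// => _ Ad; exists j; right; left; split; last by left.
  by exists y.
Qed.

Lemma root_lower_disj i (A : set R) : root_set i A `&` lower_set i = set0 :> set S.
Proof.
rewrite -subset0 => p [[x -> _] [//|[j ji [y [ij _]]]]].
by move: ji; rewrite -ij leNgt sk_a_lt_b.
Qed.

(** The tooth of the higher point of a pair; its uniqueness makes the events of different teeth
    disjoint. *)
Definition top_tooth i (p q : S) : Prop :=
  (exists x, p = toot i x /\ (lower_set i q \/ exists y, q = toot i y)).

Lemma top_tooth_uniq i j p q : top_tooth i p q \/ top_tooth i q p ->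
  top_tooth j p q \/ top_tooth j q p -> i = j.
Proof.
have H i' j' p' q' : top_tooth i' p' q' -> top_tooth j' p' q' \/ top_tooth j' q' p' -> i' = j'.
  move=> [x [-> qi]] [|]; first by move=> [y [[->]]].
  move=> [y [qj pj]]; case: qi => [[|[l li [z]]]|[z]]; rewrite qj => -[] //.
  move=> jl _; subst l; case: pj => [[//|[l lj [z' [il _]]]]|[z' [//]]]; subst l.
  by exfalso; have := sk_a_lt_b i'; have := sk_a_lt_b j'; lra.
by move=> [/H|/H] h => [/h//|[|] h']; apply: h; [right|left].
Qed.

Section joint.
Context d (Omega : measurableType d) (P : probability Omega R).
Variables X Y : {RV P >-> borel S}.
Hypothesis lawX : has_law P X (sk_prob k).
Hypothesis lawY : has_law P Y (sk_prob k).
Hypothesis indXY : independent_rv X Y.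

Let mX (B : set (borel S)) : measurable B -> measurable (X @^-1` B).
Proof. by move=> mB; rewrite -[X in measurable X]setTI; apply: lawX.1. Qed.

Let mY (B : set (borel S)) : measurable B -> measurable (Y @^-1` B).
Proof. by move=> mB; rewrite -[X in measurable X]setTI; apply: lawY.1. Qed.

(** Both orders of the pair are kept, whence the factor 2 in [prob_rect] and in [sk_law]. *)
Definition rect (B C : set S) : set Omega :=
  (X @^-1` B `&` Y @^-1` C) `|` (X @^-1` C `&` Y @^-1` B).

Lemma rect_measurable (B C : set (borel S)) :
  measurable B -> measurable C -> measurable (rect B C).
Proof.
move=> mB mC; apply: measurableU; apply: measurableI;
  by [exact: mX|exact: mY].
Qed.

Lemma prob_rect (B C : set (borel S)) : measurable B -> measurable C ->
  B `&` C = set0 ->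
  P (rect B C) = (2%:E * (@sk_measure R Theta L k B * @sk_measure R Theta L k C))%E.
Proof.
move=> mB mC BC; rewrite measureU; last first.
- rewrite -subset0 => o [[XB YC] [XC YB]].
  by have : (B `&` C) (X o) by []; rewrite BC.
- by apply: measurableI; [exact: mX|exact: mY].
- by apply: measurableI; [exact: mX|exact: mY].
rewrite (_ : (2 : R)%:E = 1 + 1)%E; last by rewrite -EFinD.
rewrite ge0_muleDl// mul1e; congr (_ + _)%E.
  by rewrite -(lawX.2 _ mB) -(lawY.2 _ mC); exact: indXY.
rewrite muleC -(lawX.2 _ mC) -(lawY.2 _ mB); exact: indXY.
Qed.

Definition gen_event (A : set R) i n : set Omega :=
  \big[setU/set0]_(w <- words n) rect (cylk i (false :: w)) (gate_set i w A).

Definition tooth_event (A : set R) i : set Omega :=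
  rect (root_set i A) (lower_set i) `|` \bigcup_n gen_event A i n.

Definition dist_event (A : set R) : set Omega := \bigcup_i tooth_event A i.

Lemma rect_top (A : set R) i w o : rect (cylk i (false :: w)) (gate_set i w A) o ->
  exists x y, [/\ X o = toot i x, Y o = toot i y, meet_at x y (size w) &
    stem x (size w) = w].
Proof.
move=> [[[x -> /= [xn xw]] [y -> [/= [yn yw] _]]]|
  [[x -> [/= [xn xw] _]] [y -> /= [yn yw]]]].
  by exists x, y; split => //; split; [rewrite xw yw|rewrite xn yn].
by exists x, y; split => //; split; [rewrite xw yw|rewrite xn yn].
Qed.

Lemma tooth_event_top (A : set R) i o : tooth_event A i o ->
  top_tooth i (X o) (Y o) \/ top_tooth i (Y o) (X o).
Proof.
move=> [[[[x Xo _] Yo]|[Xo [y Yo _]]]|[n _]].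
- by left; exists x; split => //; left.
- by right; exists y; split => //; left.
- rewrite /gen_event -bigcup_seq => -[w _ /rect_top[x [y [Xo Yo _ _]]]].
  by left; exists x; split => //; right; exists y.
Qed.

Lemma gen_event_measurable (A : set (measurableTypeR R)) i n :
  measurable A -> measurable (gen_event A i n).
Proof.
move=> mA; apply: bigsetU_measurable => w _; apply: rect_measurable.
  exact: cyl_measurable.
exact: gate_set_measurable.
Qed.

Lemma tooth_event_measurable (A : set (measurableTypeR R)) i :
  measurable A -> measurable (tooth_event A i).
Proof.
move=> mA; apply: measurableU.
  by apply: rect_measurable; [exact: root_set_measurable|exact: lower_set_measurable].
by apply: bigcupT_measurable => n; exact: gen_event_measurable.
Qed.

Lemma prob_gen_event (A : set (measurableTypeR R)) i n : measurable A ->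
  P (gen_event A i n) = ((sk_s k i ^+ 2 *
    split_mass Theta (sk_a k i) (sk_b k i) (sk_wa k i) (sk_wb k i) n /
    (cumul Theta (sk_wb k i n) - cumul Theta (sk_wa k i n)))%:E *
    Theta (A `&` `](sk_wa k i n), (sk_wb k i n)]%classic))%E.
Proof.
move=> mA; rewrite measure_bigsetU_seq.
- have mAI : measurable (A `&` `](sk_wa k i n), (sk_wb k i n)]%classic : set (measurableTypeR R)).
    by apply: measurableI => //; exact: measurable_itv.
  rewrite -(fineK (fin_num_measure Theta _ mAI)) -EFinM.
  rewrite /split_mass mulr_sumr !mulr_suml -sumEFin !big_seq.
  apply: eq_bigr => w; rewrite mem_words => /eqP wn.
  apply: etrans (prob_rect (@cyl_measurable _ _ _ k i (false :: w)) (@gate_set_measurable _ _ _ k i w A mA) _) _.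
  + rewrite -subset0 => p [[x -> /= [xn xw]] [y [<-] [/= [yn _] _]]].
    by rewrite xn in yn.
  rewrite sk_measure_cyl sk_measure_gate// wn.
  rewrite -[in LHS](fineK (fin_num_measure Theta _ mAI)) -!EFinM; congr (_%:E).
  rewrite {1}/whi {1}/wlo /= -/(wlo _ _ _ _ _ w) -/(whi _ _ _ _ _ w).
  rewrite -/(wpot _ _ _ _ _ w) -/(wcut _ _ _ _ _ w); ring.
- exact: words_uniq.
- move=> w; apply: rect_measurable; first exact: cyl_measurable.
  exact: gate_set_measurable.
- move=> w v wv; rewrite -subset0 => o [/rect_top[x [y [Xo Yo m xw]]]].
  move=> /rect_top[x' [y' [Xo' Yo' m' xw']]].
  move: Xo' Yo'; rewrite Xo Yo => -[xx] [yy]; subst x' y'.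
  by move/eqP : wv; apply; rewrite -xw -xw' (meet_uniq m m').
Qed.

Lemma prob_tooth_event (A : set (measurableTypeR R)) i : measurable A ->
  P (tooth_event A i) =
  ((2 * sk_P k i * sk_s k i / (cumul Theta (sk_b k i) - cumul Theta (sk_a k i)))%:E *
        Theta (A `&` `](sk_a k i), (sk_b k i)]%classic) +
      \sum_(n <oo) (sk_s k i ^+ 2 *
          split_mass Theta (sk_a k i) (sk_b k i) (sk_wa k i) (sk_wb k i) n /
          (cumul Theta (sk_wb k i n) - cumul Theta (sk_wa k i n)))%:E *
        Theta (A `&` `](sk_wa k i n), (sk_wb k i n)]%classic))%E.
Proof.
move=> mA; rewrite measureU.
- congr (_ + _)%E.
    apply: etrans (prob_rect (@root_set_measurable _ _ _ k i A mA) (@lower_set_measurable _ _ _ k i) _) _.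
    + exact: root_lower_disj.
    + rewrite sk_measure_root// sk_measure_lower.
      have mAI : measurable (A `&` `](sk_a k i), (sk_b k i)]%classic : set (measurableTypeR R)).
        by apply: measurableI => //; exact: measurable_itv.
      by rewrite -(fineK (fin_num_measure Theta _ mAI)) -!EFinM; congr (_%:E); ring.
  transitivity (\sum_(n <oo) P (gen_event A i n))%E; last first.
    by apply: eq_eseriesr => n _; exact: prob_gen_event.
  apply: measure_semi_bigcup.
  + by move=> n; exact: gen_event_measurable.
  + apply/trivIsetP => n m _ _ nm; rewrite -subset0 => o [].
    rewrite /gen_event -!bigcup_seq => -[w /= wn /rect_top[x [y [Xo Yo mw _]]]].
    move=> [v /= vm /rect_top[x' [y' [Xo' Yo' mv _]]]].
    move: Xo' Yo'; rewrite Xo Yo => -[xx] [yy]; subst x' y'.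
    move: wn vm; rewrite !mem_words => /eqP wn /eqP vm.
    by move/eqP : nm; apply; rewrite -wn -vm (meet_uniq mw mv).
  + by apply: bigcupT_measurable => n; exact: gen_event_measurable.
- by apply: rect_measurable; [exact: root_set_measurable|exact: lower_set_measurable].
- by apply: bigcupT_measurable => n; exact: gen_event_measurable.
- rewrite -subset0 => o [H [n _]].
  rewrite /gen_event -bigcup_seq => -[w _ /rect_top[x [y [Xo Yo _ _]]]].
  have low z : ~ lower_set i (toot i z).
    move=> [//|[j ji [u [ij _]]]].
    by move: ji; rewrite -ij leNgt sk_a_lt_b.
  by case: H => -[]; rewrite /preimage /= Xo Yo => h1 h2; [apply: low h2|apply: low h1].
Qed.

Lemma dist_event_measurable (A : set (measurableTypeR R)) :
  measurable A -> measurable (dist_event A).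
Proof.
by move=> mA; apply: bigcupT_measurable => i; exact: tooth_event_measurable.
Qed.

Lemma prob_dist_event (A : set (measurableTypeR R)) : measurable A ->
  P (dist_event A) = Theta A.
Proof.
move=> mA; rewrite (sk_law k mA).
transitivity (\sum_(i <oo) P (tooth_event A i))%E; last first.
  by apply: eq_eseriesr => i _; exact: prob_tooth_event.
apply: measure_semi_bigcup.
- by move=> i; exact: tooth_event_measurable.
- apply/trivIsetP => i j _ _ ij; rewrite -subset0 => o [/tooth_event_top hi].
  move=> /tooth_event_top hj; move/eqP : ij; apply; exact: top_tooth_uniq hi hj.
- exact: dist_event_measurable.
Qed.

Let D o : measurableTypeR R := comb_dist (X o : S) (Y o : S).

Lemma dist_event_sub (A : set R) : dist_event A `<=` D @^-1` A.
Proof.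
have sym (p q : S) : A (comb_dist p q) -> A (comb_dist q p).
  by rewrite comb_dist_sym.
move=> o [i _ [[[h1 h2]|[h1 h2]]|[n _]]].
- exact: dist_root h1 h2.
- by apply: sym; exact: dist_root h2 h1.
- rewrite /gen_event -bigcup_seq => -[w _ [[h1 h2]|[h1 h2]]].
    exact: dist_gate h1 h2.
  by apply: sym; exact: dist_gate h2 h1.
Qed.

Lemma dist_event_sup (A : set R) : D @^-1` A `&` [set o | X o <> Y o] `<=` dist_event A.
Proof.
move=> o [/= Ao XY]; have [i H] := dist_cases XY Ao; exists i => //.
case: H => [[h1 h2]|[[h1 h2]|[w H]]]; first by left; left.
  by left; right.
right; exists (size w) => //; rewrite /gen_event -bigcup_seq; exists w.
  by rewrite /= mem_words.
by case: H => -[h1 h2]; [left|right].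
Qed.

Lemma dist_event_neq (A : set R) : dist_event A `<=` [set o | X o <> Y o].
Proof.
move=> o [i _ [H|[n _ H]]] /= XY.
  have : (@root_set R Theta L k i A `&` @lower_set R Theta L k i) (X o).
    by case: H => -[]; rewrite /preimage /= -XY.
  by rewrite root_lower_disj.
move: H; rewrite /gen_event -bigcup_seq => -[w _ /rect_top[x [y [Xo Yo m _]]]].
by move: XY m; rewrite Xo Yo => -[->] /not_meet.
Qed.

(** Off the diagonal the preimage of [A] is [dist_event A], a countable union of rectangles, which
    also gives the measurability of the distance. The diagonal is the complement of
    [dist_event setT], of probability [Theta setT = 1], hence null. *)
Lemma dist_law : has_law P D Theta.
Proof.
have DE (A : set (measurableTypeR R)) : D @^-1` A =
    dist_event A `|` (if `[< A 0 >] then ~` dist_event setT else set0).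
  apply/seteqP; split => o.
    move=> Ao; have [XY|XY] := pselect (X o = Y o); last first.
      by left; apply: dist_event_sup.
    right; rewrite asboolT; last by move: Ao; rewrite /preimage /D /= XY comb_dist_refl.
    by move/dist_event_neq; rewrite /= XY.
  move=> [/dist_event_sub//|]; case: asboolP => // A0 nXY.
  have XY : X o = Y o.
    by apply: contrapT => XY; apply: nXY; apply: dist_event_sup.
  by rewrite /preimage /D /= XY comb_dist_refl.
have mT := dist_event_measurable measurableT.
have mE (A : set (measurableTypeR R)) :
    measurable (if `[< A 0 >] then ~` dist_event setT else set0).
  by case: ifP => _ //; exact: measurableC.
split.
  move=> _ A mA; rewrite setTI DE; apply: measurableU => //.
  exact: dist_event_measurable.
move=> A mA; rewrite DE measureU0//; first exact: prob_dist_event.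
  exact: dist_event_measurable.
case: ifP => _; last exact: measure0.
apply: etrans (probability_setC P mT) _.
by rewrite prob_dist_event// probability_setT subee.
Qed.

End joint.

Lemma sk_realisation : realisation Theta (sk_prob k).
Proof.
split; first exact: comb_separable.
move=> d Omega P X Y lX lY iXY; exact: (dist_law lX lY iXY).
Qed.

(** Every nonempty open set contains a cylinder, around the base point because small teeth
    accumulate there, and cylinders have positive mass. *)
Lemma sk_msupp : msupp (sk_prob k : set S -> \bar R) = setT.
Proof.
rewrite -subTset => p _ U oU Up.
suff [i [w wU]] : exists i w, cylk i w `<=` U.
  apply: (@lt_le_trans _ _ (@sk_measure R Theta L k (cylk i w))).
    rewrite sk_measure_cyl lte_fin mulr_gt0 ?sk_s_gt0// subr_gt0.
    exact: (wlo_lt nonneg (adm_root (adm i)) (adm_win (adm i)) w).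
  apply: le_measure; rewrite ?inE //; first exact: cyl_measurable.
  exact: sub_sigma_algebra.
have /nbhs_ballP[e /= e0 eU] : nbhs p U by exact: open_nbhs_nbhs.
case: p Up eU => [[i x]|] Up eU.
  have L0 : 0 < L by exact: lt_le_trans (sk_L1 k).
  have [n Hn] := tooth_cont (sk_tooth k i) (divr_gt0 e0 L0).
  exists i, (stem x n) => _ [y -> xy]; apply: eU.
  rewrite ballEmdist /= comb_mdistE /= eqxx.
  apply: le_lt_trans (tooth_d_le (sk_tooth k i) _ _) _.
  rewrite mulrC -ltr_pdivlMr//; apply: Hn.
  by rewrite -[in LHS]xy size_stem.
have [i bi] := sk_accum k e0; exists i, [::] => _ [y -> _]; apply: eU.
rewrite ballEmdist /= comb_mdistE /= max_r//.
exact: le_lt_trans (g_le _ _) bi.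
Qed.

Lemma sk_full (L' : R) : L <= L' ->
  full_ultrametric_realisation L' Theta (sk_prob k).
Proof.
move=> LL; split; [exact: sk_realisation|exact: sk_msupp|].
have L0 : 0 < L' by apply: lt_le_trans LL; exact: lt_le_trans (sk_L1 k).
exists (@comb_ultra R (sk_comb k)).
have dL (x y : S) : mdist x y <= L' * comb_ultra x y.
  apply: le_trans (comb_dist_le x y) _; rewrite ler_wpM2r//.
  exact: comb_ultra_ge0.
split.
- split; last exact: comb_ultra_tri.
  split; [exact: comb_ultra_ge0|exact: comb_ultra_eq0|exact: comb_ultra_sym|].
  move=> x y z; apply: le_trans (comb_ultra_tri x y z) _.
  by rewrite ge_max lerDl lerDr !comb_ultra_ge0.
- move=> x y; rewrite dL andbT; apply: le_trans (comb_ultra_le x y).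
  rewrite ler_piMl ?comb_ultra_ge0// invf_le1//.
  exact: le_trans (sk_L1 k) LL.
- by move=> x y; rewrite dL comb_ultra_le.
Qed.

End skeleton_law.

(** * Distances and the support of [Theta] *)

Section realisation_support.
Context (R : realType) (Theta : probability (measurableTypeR R) R)
  (S : completeMetricType R) (mu : probability (borel S) R).
Hypotheses (real : realisation Theta mu) (full : msupp (mu : set S -> \bar R) = setT).

Let O : measurableType _ := (borel S * borel S)%type.
Let P : probability O R := (mu \x mu)%E.
Let X : O -> borel S := fst.
Let Y : O -> borel S := snd.

HB.instance Definition _ := isMeasurableFun.Build _ _ _ _ X measurable_fst.
HB.instance Definition _ := isMeasurableFun.Build _ _ _ _ Y measurable_snd.

Let lawX (A : set (borel S)) : measurable A -> P (X @^-1` A) = mu A.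
Proof.
move=> mA; rewrite (_ : X @^-1` A = A `*` setT); last first.
  by apply/seteqP; split => -[u v] //= [].
rewrite /P /= product_measure1E// -[RHS]mule1; congr (_ * _)%E.
exact: probability_setT.
Qed.

Let lawY (A : set (borel S)) : measurable A -> P (Y @^-1` A) = mu A.
Proof.
move=> mA; rewrite (_ : Y @^-1` A = setT `*` A); last first.
  by apply/seteqP; split => -[u v] //= [].
rewrite /P /= product_measure1E// -[RHS]mul1e; congr (_ * _)%E.
exact: probability_setT.
Qed.

(** A realisation speaks of all independent pairs; the two coordinates of the product space form
    one. *)
Let dist_has_law :
  has_law P (fun o => mdist (X o : S) (Y o : S) : measurableTypeR R) Theta.
Proof.
apply: (real.2 _ O P (X : {RV P >-> borel S}) (Y : {RV P >-> borel S})).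
- by split => //; exact: measurable_fst.
- by split => //; exact: measurable_snd.
move=> A B mA mB; rewrite lawX// lawY// (_ : _ `&` _ = A `*` B); last first.
  by apply/seteqP; split => -[u v].
by rewrite /P /= product_measure1E.
Qed.

(** Small balls around [x] and [y] have positive mass, and pairs in their product have distances
    close to that of [x] and [y]. *)
Lemma dist_set_sub : dist_set S `<=` msupp (Theta : set R -> \bar R).
Proof.
move=> _ [x _ [y _ <-]] U oU Uxy.
have /nbhs_ballP[e /= e0 eU] : nbhs (mdist x y) U by exact: open_nbhs_nbhs.
have e20 : 0 < e / 2 by rewrite divr_gt0.
have mU : measurable (U : set (measurableTypeR R)) by exact: measurable_realfun.open_measurable.
have ob z : open (ball z (e / 2) : set S)^°.
  exact: open_interior.
have mb z : measurable ((ball z (e / 2))^° : set (borel S)).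
  by apply: sub_sigma_algebra; exact: open_interior.
have pb z : (0 < mu (ball z (e / 2))^°)%E.
  have : msupp (mu : set S -> \bar R) z by rewrite full.
  by apply; [exact: open_interior|exact: nbhsx_ballx].
rewrite -dist_has_law.2//.
apply: (@lt_le_trans _ _ (P ((ball x (e / 2))^° `*` (ball y (e / 2))^°))).
  by rewrite /P /= product_measure1E//; apply: mule_gt0; exact: pb.
apply: le_measure; rewrite ?inE //.
- exact: measurableX.
- by rewrite -[X in measurable X]setTI; exact: dist_has_law.1.
- move=> [u v] /= [/interior_subset + /interior_subset]; rewrite !ballEmdist /= => xu yv.
  apply: eU; rewrite /ball /= ltr_norml.
  have := metric_triangle x u y; have := metric_triangle u v y.
  have := metric_triangle u x v; have := metric_triangle x y v.
  rewrite (metric_sym v y) (metric_sym u x); lra.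
Qed.

Lemma mdist_continuous : continuous (fun p : S * S => mdist p.1 p.2).
Proof.
move=> [x y] /=; apply/cvgrPdist_lt => e e0.
have e20 : 0 < e / 2 by rewrite divr_gt0.
exists (ball x (e / 2), ball y (e / 2)) => /=.
  by split; exact: nbhsx_ballx.
move=> [u v] /= []; rewrite !ballEmdist /= => xu yv; rewrite ltr_norml.
have := metric_triangle x u y; have := metric_triangle u v y.
have := metric_triangle u x v; have := metric_triangle x y v.
rewrite (metric_sym v y) (metric_sym u x); lra.
Qed.

Hypothesis compactS : compact [set: S].

Lemma dist_set_compact : compact (dist_set S).
Proof.
rewrite (_ : dist_set S = (fun p : S * S => mdist p.1 p.2) @` (setT `*` setT)).
  apply: continuous_compact; last exact: compact_setX.
  by apply: continuous_subspaceT; exact: mdist_continuous.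
apply/seteqP; split => [_ [x _ [y _ <-]]|_ [[x y] _ <-]].
  by exists (x, y).
by exists x => //; exists y.
Qed.

(** By compactness the set of distances is closed; its complement is open and has measure zero for
    [Theta], hence misses the support. *)
Lemma dist_set_msupp : dist_set S = msupp (Theta : set R -> \bar R).
Proof.
apply/seteqP; split; first exact: dist_set_sub.
move=> t tT; apply: contrapT => nt.
have oC : open (~` dist_set S).
  by apply: closed_openC; apply: compact_closed; [exact: Rhausdorff|exact: dist_set_compact].
have mC : measurable (~` dist_set S : set (measurableTypeR R)) by exact: measurable_realfun.open_measurable.
have := tT _ oC nt; rewrite -dist_has_law.2//.
rewrite (_ : _ @^-1` _ = set0) ?measure0 ?ltxx//.
by rewrite -subset0 => o; apply; exists (X o) => //; exists (Y o).
Qed.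

Lemma diam_max : exists2 m : R, is_maximum (msupp (Theta : set R -> \bar R)) m &
  diam S = m%:E.
Proof.
have [] := @compact_EVT_max R R id (dist_set S) _ dist_set_compact.
- by exists (mdist (point : S) point); exists point => //; exists point.
- by apply: continuous_subspaceT => x.
move=> m; rewrite inE => md mmax; exists m.
  rewrite -dist_set_msupp; split => // x xd.
  by apply: mmax; rewrite inE.
rewrite /diam; apply/eqP; rewrite eq_le; apply/andP; split.
  by apply: ge_ereal_sup => _ [x xd <-]; rewrite lee_fin mmax// inE.
by apply: ereal_sup_ubound; exists m.
Qed.

End realisation_support.

Section skeleton_bounded.
Context (R : realType) (Theta : probability (measurableTypeR R) R) (L : R).
Variable k : skeleton Theta L.
Local Notation S := (comb_space (sk_comb k)).

Local Notation toot := (tooth_in (sk_comb k)).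
Local Notation rootf i :=
  (tree_g Theta (sk_a k i) (sk_b k i) (sk_wa k i) (sk_wb k i)).

(** The height of a point is its distance to the base point, hence belongs to the support of
    [Theta]; a bound on the support therefore bounds all the teeth. *)
Lemma sk_compact : bounded_set (msupp (Theta : set R -> \bar R)) ->
  compact [set: S].
Proof.
move=> [M [_ HM]]; apply: (@comb_compact R (sk_comb k) (M + 1)) => i.
pose x : cantor_space := fun=> false.
have : msupp (Theta : set R -> \bar R) (rootf i x).
  apply: (dist_set_sub (sk_realisation k) (sk_msupp k)).
  exists None => //; exists (toot i x) => //.
  rewrite comb_mdistE /= max_r//.
  exact: le_trans (ltW (sk_a_gt0 k i)) (tooth_g_ge (sk_tooth k i) x).
have M1 : M < M + 1 by rewrite ltrDl.
move=> /(HM (M + 1) M1) H.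
apply: le_trans (tooth_g_ge (sk_tooth k i) x) _.
by apply: le_trans (ler_norm _) H.
Qed.

End skeleton_bounded.

(** * Windows *)

Section cumul_atomless.
Context (R : realType) (Theta : probability (measurableTypeR R) R).
Hypothesis Theta_nonneg : Theta [set x : R | 0 <= x] = 1%E.
Hypothesis Theta_atomless : atomless Theta.
Hypothesis Theta_supp0 : msupp (Theta : set R -> \bar R) 0.

Local Notation F := (cumul Theta).

(** Left continuity of the distribution function; this is where atoms are excluded. *)
Lemma cumul_left x u : (forall y, y < x -> F y <= u) -> F x <= u.
Proof.
move=> H; pose E n : set R := `]-oo, (x - n.+1%:R^-1)]%classic.
have mE n : measurable (E n : set (measurableTypeR R)) by exact: measurable_itv.
have cvE : Theta (E n) @[n --> \oo] --> Theta (\bigcup_n E n).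
  apply: nondecreasing_cvg_mu => //.
  - exact: bigcupT_measurable.
  - apply/nondecreasing_seqP => n; apply/subsetPset => z /=.
    rewrite /E /= !in_itv /= => /le_trans; apply.
    by rewrite lerD2l lerN2 lef_pV2 ?posrE// ler_nat.
have EU : \bigcup_n E n = `]-oo, x[%classic.
  apply/seteqP; split => z /=.
    move=> [n _]; rewrite /E /= !in_itv /= => /le_lt_trans; apply.
    by rewrite ltrBlDr ltrDl invr_gt0.
  rewrite in_itv /= => zx; have e0 : 0 < x - z by rewrite subr_gt0.
  exists (Num.truncn (x - z)^-1) => //; rewrite /E /= in_itv /= lerBrDr -lerBrDl.
  rewrite -[leRHS]invrK lef_pV2 ?posrE ?invr_gt0//.
  by rewrite ltW// truncnS_gt.
have -> : F x = fine (Theta (\bigcup_n E n)).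
  rewrite EU /cumul; congr fine.
  have -> : `]-oo, x]%classic = `]-oo, x[%classic `|` [set x] :> set R.
    apply/seteqP; split => z /=; rewrite !in_itv /= le_eqVlt.
      by move=> /predU1P[->|->]; [right|left].
    by move=> [->|->]; rewrite ?eqxx ?orbT.
  by rewrite measureU0//; exact: Theta_atomless.
rewrite -lee_fin fineK ?fin_num_measure//; last exact: bigcupT_measurable.
apply: (cvge_le _ cvE).
by apply: nearW => n; rewrite /E -cumulE lee_fin H// ltrBlDr ltrDl invr_gt0.
Qed.

Lemma cumul0 : F 0 = 0.
Proof.
apply/eqP; rewrite eq_le cumul_ge0 andbT; apply: cumul_left => y y0.
by rewrite (cumul_lt0 Theta_nonneg).
Qed.

Lemma cumul_gt0 (y : R) : 0 < y -> 0 < F y.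
Proof.
move=> y0; rewrite -lte_fin cumulE.
have Ty := Theta_supp0 (itv_open (- y) y).
pose I : set R := `](- y), y[%classic.
have {}Ty : (0 < Theta I)%E.
  by apply: Ty; rewrite /= in_itv /= oppr_lt0 y0.
apply: lt_le_trans Ty _; apply: le_measure; rewrite ?inE.
- exact: measurable_itv.
- exact: measurable_itv.
- by move=> z; rewrite /I /= !in_itv /= => /andP[_ /ltW].
Qed.

(** Take the last point at which the distribution function is at most half of its value at [y]: any
    move to the right of it increases the function. *)
Lemma right_support_point (y : R) : 0 < y ->
  exists s, 0 < s < y /\ forall e, 0 < e -> F s < F (s + e).
Proof.
move=> y0; have Fy := cumul_gt0 y0; pose E := [set t | F t <= F y / 2].
have Ey t : E t -> t < y.
  move=> Et; rewrite ltNge; apply/negP => /(cumul_homo Theta).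
  by move: Et; rewrite /E /=; lra.
have [t t0 Et] : exists2 t, 0 < t & E t.
  apply: contrapT => H; have : F y / 2 <= F 0.
    apply: cumul_right => t t0; rewrite leNgt; apply/negP => /ltW Et.
    by apply: H; exists t.
  by rewrite cumul0; lra.
have hsE : has_sup E by split; [exists t|exists y => s /Ey/ltW].
have FsE : F (sup E) <= F y / 2.
  apply: cumul_left => z zs; have [e Ee ze] := sup_gt hsE.1 zs.
  by apply: le_trans Ee; apply: cumul_homo; exact: ltW.
exists (sup E); split.
  apply/andP; split; last exact: Ey.
  by apply: lt_le_trans t0 _; apply: ub_le_sup => //; case: hsE.
move=> e e0; apply: le_lt_trans FsE _; rewrite ltNge; apply/negP => Ese.
have : sup E + e <= sup E by apply: ub_le_sup => //; case: hsE.
by lra.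
Qed.

Lemma cumul_quantile (u : R) : 0 < u < 1 -> F (quantile Theta u) = u.
Proof.
move=> /andP[u0 u1].
have ex : exists y, u <= F y.
  apply: contrapT => /forallNP H.
  pose E (n : nat) : set R := `]-oo, n%:R]%classic.
  have mE n : measurable (E n : set (measurableTypeR R)) by exact: measurable_itv.
  have cvE : Theta (E n) @[n --> \oo] --> Theta (\bigcup_n E n).
    apply: nondecreasing_cvg_mu => //.
    - exact: bigcupT_measurable.
    - apply/nondecreasing_seqP => n; apply/subsetPset => z /=.
      by rewrite /E /= !in_itv /= => /le_trans; apply; rewrite ler_nat.
  have ET : \bigcup_n E n = setT.
    rewrite -subTset => z _; exists (Num.truncn `|z|).+1 => //.
    rewrite /E /= in_itv /= (le_trans (ler_norm _))// ltW//.
    exact: truncnS_gt.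
  have : (Theta (\bigcup_n E n) <= u%:E)%E.
    apply: (cvge_le _ cvE); apply: nearW => n.
    rewrite /E -cumulE lee_fin leNgt; apply/negP => /ltW; exact: H.
  by rewrite ET probability_setT lee_fin leNgt u1.
apply/eqP; rewrite eq_le; apply/andP; split; last first.
  by rewrite -(quantile_le Theta_nonneg _ u0 ex).
apply: cumul_left => y; rewrite (quantile_gt Theta_nonneg _ u0 ex); exact: ltW.
Qed.

(** Uniform continuity, from finitely many quantiles at equally spaced levels: an increase by more
    than three levels over a short interval would enclose two consecutive quantiles, closer to each
    other than the least gap [d]. *)
Lemma cumul_uniform (e : R) : 0 < e -> exists2 d, 0 < d & forall x, F (x + d) - F x <= e.
Proof.
move=> e0; pose N := (Num.truncn (3 / e)).+1.
have N0 : 0 < (N%:R : R) by rewrite ltr0n.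
have N3 : 3 / N%:R <= e.
  by rewrite ler_pdivrMr// -ler_pdivrMl// mulrC ltW// truncnS_gt.
pose q i := quantile Theta (i%:R / N%:R).
have Fq i : (0 < i < N)%N -> F (q i) = i%:R / N%:R.
  move=> /andP[i0 iN]; apply: cumul_quantile.
  by rewrite divr_gt0 ?ltr0n//= ltr_pdivrMr// mul1r ltr_nat.
have [d d0 Hd] : exists2 d, 0 < d & forall i, (0 < i)%N -> (i.+1 < N)%N -> d <= q i.+1 - q i.
  have pos i : (0 < i)%N -> (i.+1 < N)%N -> 0 < q i.+1 - q i.
    move=> i0 iN; rewrite subr_gt0 ltNge; apply/negP => /(cumul_homo Theta).
    rewrite !Fq ?iN ?i0 ?(ltnW iN)// ler_pM2r ?invr_gt0// ler_nat ltnn//.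
  have : exists2 d, 0 < d & forall i, (i < N)%N -> (0 < i)%N -> (i.+1 < N)%N -> d <= q i.+1 - q i.
    elim: {1}N => [|m [d d0 Hd]]; first by exists 1.
    have [[m0 mN]|nm] := pselect ((0 < m)%N /\ (m.+1 < N)%N); last first.
      exists d => // i; rewrite ltnS leq_eqVlt => /predU1P[->|im] i0 iN; last exact: Hd.
      by exfalso; apply: nm.
    exists (Num.min d (q m.+1 - q m)); first by rewrite lt_min d0 pos.
    move=> i; rewrite ltnS leq_eqVlt => /predU1P[->|im] i0 iN.
      by rewrite ge_min lexx orbT.
    by rewrite ge_min Hd.
  by move=> [d d0 Hd]; exists d => // i i0 iN; apply: Hd => //; exact: ltnW.
exists (d / 2); first by rewrite divr_gt0.
move=> x; apply: le_trans N3; rewrite leNgt; apply/negP => H.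
have Fx0 : 0 <= N%:R * F x by rewrite mulr_ge0 ?cumul_ge0// ltW.
pose i := (Num.truncn (N%:R * F x)).+1.
have xi : F x < i%:R / N%:R.
  by rewrite ltr_pdivlMr// mulrC truncnS_gt.
have ix : i.+1%:R / N%:R < F (x + d / 2).
  have : i.+1%:R <= N%:R * F x + 2 :> R.
    by rewrite /i -addn2 natrD lerD2r truncn_le.
  have : 3 < (F (x + d / 2) - F x) * N%:R by rewrite -ltr_pdivrMr.
  rewrite ltr_pdivrMr//; lra.
have iN : (i.+1 < N)%N.
  have := lt_le_trans ix (cumul_le1 Theta _).
  by rewrite ltr_pdivrMr// mul1r ltr_nat.
have xq : x < q i.
  rewrite ltNge; apply/negP => /(cumul_homo Theta).
  by rewrite Fq ?(ltnW iN)// leNgt xi.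
have qx : q i.+1 < x + d / 2.
  rewrite ltNge; apply/negP => /(cumul_homo Theta).
  by rewrite Fq ?iN// leNgt ix.
have := Hd i isT iN; lra.
Qed.

End cumul_atomless.

(* The windows ]sig j, sig j + del j] supply the distances inside the teeth. *)
Record ladder (R : realType) (Theta : probability (measurableTypeR R) R)
    (L r0 : R) (sig del : nat -> R) : Prop := Ladder {
  lad_gt0 : forall j, 0 < sig j ;
  lad_half : forall j, sig j.+1 <= sig j / 2 ;
  lad_del_gt0 : forall j, 0 < del j ;
  lad_del : forall j, del j <= sig j.+1 / 16 ;
  lad_del_L : forall j, del j <= (L - 1) * sig j ;
  lad_top : sig 0 <= r0 / 2 ;
  lad_win : forall j, cumul Theta (sig j) < cumul Theta (sig j + del j) }.

Section ladder.
Context (R : realType) (Theta : probability (measurableTypeR R) R).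
Hypothesis Theta_nonneg : Theta [set x : R | 0 <= x] = 1%E.
Hypothesis Theta_atomless : atomless Theta.
Hypothesis Theta_supp0 : msupp (Theta : set R -> \bar R) 0.
Variables (L r0 : R).
Hypotheses (L1 : 1 < L) (r0_gt0 : 0 < r0).

Local Notation F := (cumul Theta).

(** Each [sig j] is a point of right increase, so that a window starting there has positive mass
    however short; [del j] may then be as small as the other conditions require. *)
Lemma ladder_exists : exists sig del, ladder Theta L r0 sig del.
Proof.
have rsp (y : R) := right_support_point Theta_nonneg Theta_atomless Theta_supp0 (y := y).
have half (y : R) : 0 < y -> 0 < y / 2 by move=> y0; rewrite divr_gt0.
pose next (y : R) : R := if pselect (0 < y) is left h then projT1 (cid (rsp y h)) else 0.
have nextP (y : R) : 0 < y ->
    0 < next y < y /\ forall e, 0 < e -> F (next y) < F (next y + e).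
  by move=> y0; rewrite /next; case: pselect => // h; case: cid.
pose sig j : R := iter j (fun s => next (s / 2)) (next (r0 / 2)).
have sig0 j : 0 < sig j.
  elim: j => [|j IH] /=; first by have [/andP[]] := nextP _ (half _ r0_gt0).
  by have [/andP[]] := nextP _ (half _ IH).
pose del j : R := Num.min ((L - 1) * sig j) (sig j.+1 / 16).
have del0 j : 0 < del j.
  by rewrite lt_min divr_gt0 ?sig0// mulr_gt0 ?sig0// subr_gt0.
exists sig, del; split => //.
- by move=> j; have [/andP[_ /ltW]] := nextP _ (half _ (sig0 j)).
- by move=> j; rewrite /del ge_min lexx orbT.
- by move=> j; rewrite /del ge_min lexx.
- by have [/andP[_ /ltW]] := nextP _ (half _ r0_gt0).
- case=> [|j]; last by have [_] := nextP _ (half _ (sig0 j)); apply.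
  by have [_] := nextP _ (half _ r0_gt0); apply.
Qed.

Variables (sig del : nat -> R).
Hypothesis lad : ladder Theta L r0 sig del.

Definition win_mass j : R := F (sig j + del j) - F (sig j).

Lemma win_mass_gt0 j : 0 < win_mass j.
Proof. by rewrite subr_gt0 (lad_win lad). Qed.

Lemma win_mass_le1 j : win_mass j <= 1.
Proof.
have := cumul_le1 Theta (sig j + del j); have := cumul_ge0 Theta (sig j).
by rewrite /win_mass; lra.
Qed.

Lemma lad_homo i j : (i <= j)%N -> sig j <= sig i.
Proof.
move: i j; apply/nonincreasing_seqP => j.
by have := lad_half lad j; have := lad_gt0 lad j; lra.
Qed.

Lemma lad_step j : sig j.+1 + del j.+1 <= sig j.
Proof.
have := lad_half lad j; have := lad_half lad j.+1; have := lad_del lad j.+1.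
have := lad_gt0 lad j; have := lad_gt0 lad j.+1; lra.
Qed.

Lemma lad_lim e : 0 < e -> exists j, sig j < e.
Proof.
move=> e0; have bnd j : sig j <= sig 0 * (2^-1) ^+ j.
  elim: j => [|j IH]; first by rewrite expr0 mulr1.
  by rewrite exprS; have := lad_half lad j; lra.
have : sig 0 * (2^-1) ^+ j @[j --> \oo] --> sig 0 * 0.
  by apply: cvgMr; apply: cvg_expr; rewrite ger0_norm; lra.
rewrite mulr0 => /cvgrPdist_lt/(_ _ e0)[N _ /(_ N (leqnn _))] /=.
rewrite sub0r normrN ger0_norm; last by rewrite mulr_ge0 ?exprn_ge0// ltW ?(lad_gt0 lad).
by move=> /(le_lt_trans (bnd N)) ?; exists N.
Qed.

(* Two generations share a window; we pass to the next window as soon as the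
   oscillations are small enough and the pieces are light enough. *)
Fixpoint schedule (j0 n : nat) : nat * R :=
  if n is m.+1 then
    let (j, w) := schedule j0 m in
    let w' := w / 2 + 2 * del j in
    if (w' <= sig j.+1) && ((2 / 3) ^+ m.+1 * win_mass j0 <= win_mass j.+1)
    then (j.+1, w') else (j, w')
  else (j0, sig j0).

Definition sched_idx j0 n := (schedule j0 n).1.
Definition sched_osc j0 n := (schedule j0 n).2.

Lemma sched_oscS j0 n :
  sched_osc j0 n.+1 = sched_osc j0 n / 2 + 2 * del (sched_idx j0 n).
Proof.
rewrite /sched_osc /sched_idx /=; case: (schedule j0 n) => j w /=.
by case: ifP.
Qed.

Lemma sched_idxS j0 n : sched_idx j0 n.+1 =
  if (sched_osc j0 n.+1 <= sig (sched_idx j0 n).+1) &&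
     ((2 / 3) ^+ n.+1 * win_mass j0 <= win_mass (sched_idx j0 n).+1)
  then (sched_idx j0 n).+1 else sched_idx j0 n.
Proof.
rewrite sched_oscS /sched_osc /sched_idx /=; case: (schedule j0 n) => j w /=.
by case: ifP.
Qed.

Lemma sched_idx_ge j0 n : (j0 <= sched_idx j0 n)%N.
Proof.
elim: n => [//|n IH]; rewrite sched_idxS; case: ifP => // _; exact: leqW.
Qed.

Lemma sched_idx_homo j0 m n : (m <= n)%N -> (sched_idx j0 m <= sched_idx j0 n)%N.
Proof.
move: m n; apply: homo_leq leqnn leq_trans _ => n.
by rewrite sched_idxS; case: ifP.
Qed.

Lemma lad_del_sig j : del j <= sig j / 32.
Proof. by have := lad_del lad j; have := lad_half lad j; lra. Qed.

Lemma sched_osc_le j0 n : sched_osc j0 n <= sig (sched_idx j0 n).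
Proof.
elim: n => [//|n IH]; rewrite sched_idxS; case: ifPn => [/andP[]//|_].
rewrite sched_oscS; have := lad_del_sig (sched_idx j0 n).
by have := lad_gt0 lad (sched_idx j0 n); move: IH; lra.
Qed.

(** The rate 2/3 lies strictly between 1/2, the decay of the separation probabilities over two
    generations, and 1: the ratio of the former to the window masses is then summable, like (3/4)^n,
    and the threshold still tends to 0. *)
Lemma sched_mass j0 n : (2 / 3) ^+ n * win_mass j0 <= win_mass (sched_idx j0 n).
Proof.
elim: n => [|n IH]; first by rewrite expr0 mul1r.
rewrite sched_idxS; case: ifPn => [/andP[]//|_]; apply: le_trans IH.
rewrite ler_pM2r ?win_mass_gt0// exprS ler_piMl//; last by lra.
Qed.

(** If the schedule stayed at [m], the oscillation would tend to [4 * del m], well below [sig m.+1]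
    by [lad_del], and the mass threshold to 0, so both tests would succeed eventually. *)
Lemma sched_unbounded j0 m : exists n, (m <= sched_idx j0 n)%N.
Proof.
elim: m => [|m [n mn]]; first by exists 0%N.
apply: contrapT => /forallNP H.
have stay i : (n <= i)%N -> sched_idx j0 i = m.
  move=> ni; apply/eqP; rewrite eqn_leq (leq_trans mn) ?sched_idx_homo// andbT.
  by rewrite -ltnS ltnNge; apply/negP; exact: H.
(* [4 * del m] is the fixed point of [w / 2 + 2 * del m]. *)
have osc i : sched_osc j0 (n + i) - 4 * del m =
    (2^-1) ^+ i * (sched_osc j0 n - 4 * del m).
  elim: i => [|i IH]; first by rewrite addn0 expr0 mul1r.
  by rewrite addnS sched_oscS stay ?leq_addr// exprS -mulrA -IH; lra.
have s0 := lad_gt0 lad m.+1.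
have c1 : (2^-1) ^+ i * (sched_osc j0 n - 4 * del m) @[i --> \oo] --> 0.
  rewrite -[X in _ --> X](mul0r (sched_osc j0 n - 4 * del m)).
  by apply: cvgMl; apply: cvg_expr; rewrite ger0_norm; lra.
have c2 : (2 / 3) ^+ i * win_mass j0 @[i --> \oo] --> (0 : R).
  rewrite -[X in _ --> X](mul0r (win_mass j0)).
  by apply: cvgMl; apply: cvg_expr; rewrite ger0_norm; lra.
have s02 : 0 < sig m.+1 / 2 by rewrite divr_gt0.
have /cvgrPdist_lt/(_ _ s02)[N1 _ HN1] := c1.
have /cvgrPdist_lt/(_ _ (win_mass_gt0 m.+1))[N2 _ HN2] := c2.
pose i := maxn N1 N2.
have h1 := HN1 i (leq_maxl _ _).
have h2 := HN2 (n + i).+1 (leq_trans (leq_maxr N1 N2) (leqW (leq_addl n i))).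
apply: (H (n + i).+1); rewrite sched_idxS (stay _ (leq_addr _ _)).
have -> : sched_osc j0 (n + i).+1 <= sig m.+1.
  rewrite sched_oscS (stay _ (leq_addr _ _)).
  move: h1; rewrite /= sub0r normrN -osc => /(le_lt_trans (ler_norm _)).
  by have := lad_del lad m; have := lad_del_gt0 lad m; lra.
have -> // : (2 / 3) ^+ (n + i).+1 * win_mass j0 <= win_mass m.+1.
by move: h2; rewrite /= sub0r normrN => /(le_lt_trans (ler_norm _))/ltW.
Qed.

Definition sched_wa j0 n := sig (sched_idx j0 n./2).
Definition sched_wb j0 n := sig (sched_idx j0 n./2) + del (sched_idx j0 n./2).

Lemma sched_admissible j0 a0 b0 : F a0 < F b0 -> b0 - a0 <= sig j0 ->
  sig j0 + del j0 <= a0 -> b0 <= L * a0 ->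
  admissible Theta L a0 b0 (sched_wa j0) (sched_wb j0).
Proof.
move=> ab wab wa0 bL; rewrite /sched_wa /sched_wb.
have s0 := lad_gt0 lad; have half_homo m n : (m <= n)%N -> (m./2 <= n./2)%N.
  exact: half_leq.
split => //.
- by move=> n; exact: (lad_win lad).
- move=> m n mn; apply: lad_homo; exact/sched_idx_homo/half_leq.
- move=> e /lad_lim[j je]; have [n jn] := sched_unbounded j0 j.
  by exists n.*2; rewrite doubleK; apply: le_lt_trans je; exact: lad_homo.
- by move=> n; have := lad_del_L lad (sched_idx j0 n./2); lra.
- move=> n; apply: le_trans wa0; have := sched_idx_ge j0 n./2.
  rewrite leq_eqVlt => /predU1P[<-//|].
  case: (sched_idx j0 n./2) => // j; rewrite ltnS => jj.
  apply: le_trans (lad_step j) _; apply: le_trans (lad_homo jj) _.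
  by rewrite lerDl ltW ?(lad_del_gt0 lad).
(* After an even cut the bound is halved and one window width is added; the odd cut adds a second
   width, which gives the recursion of [sched_osc]. *)
- exists (fun n => if odd n then sched_osc j0 n./2 / 2 + del (sched_idx j0 n./2)
    else sched_osc j0 n./2); split.
  + by rewrite /= /sched_osc.
  + move=> n /=; rewrite uphalf_half; case: (boolP (odd n)) => on /=.
      by rewrite add1n sched_oscS; lra.
    by rewrite add0n; lra.
  + move=> n; have := sched_osc_le j0 n./2.
    have := lad_del_sig (sched_idx j0 n./2); have := s0 (sched_idx j0 n./2).
    by case: ifP => _; lra.
Qed.

(** Twice the sum of the geometric series of ratio 3/4, each power occurring twice. *)
Lemma half_pow_sum n :
  \sum_(0 <= i < n) ((3 / 4) ^+ i./2) <= (8 : R).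
Proof.
have E : \sum_(0 <= i < n) ((3 / 4) ^+ i./2) =
    8 - (if odd n then 7 else 8) * (3 / 4) ^+ n./2 :> R.
  elim: n => [|n IH]; first by rewrite big_geq// expr0; lra.
  rewrite big_nat_recr//= IH uphalf_half; case: (odd n) => /=.
    by rewrite add1n exprS; lra.
  by rewrite add0n; lra.
rewrite E; have : 0 <= ((3 / 4) ^+ n./2 : R) by rewrite exprn_ge0//; lra.
by case: (odd n); lra.
Qed.

End ladder.

Lemma nneseries_recS (R : realType) (f : nat -> \bar R) l :
  (forall i, (0 <= f i)%E) ->
  (\sum_(l <= i <oo) f i = f l + \sum_(l.+1 <= i <oo) f i)%E.
Proof.
by move=> f0; rewrite (nneseries_split l 1)// addn1 big_nat1.
Qed.

(** * The density used by the inside of a tooth *)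

Section density.
Context (R : realType) (Theta : probability (measurableTypeR R) R).
Hypothesis Theta_nonneg : Theta [set x : R | 0 <= x] = 1%E.
Variables (L r0 : R) (sig del : nat -> R).
Hypothesis lad : ladder Theta L r0 sig del.

Local Notation wm := (win_mass Theta sig del).
Local Notation idx := (sched_idx Theta sig del).
Local Notation wa := (sched_wa Theta sig del).
Local Notation wb := (sched_wb Theta sig del).

(** [B l] is the density on the piece [l] of the distance law inside a tooth of mass 1, obtained by
    regrouping the generations that use the window containing this piece; [psi l] stands for the
    measure of a set inside the piece. The bound compares the separation probabilities with the
    window masses, and [B] vanishes on the windows above the starting one. *)
Lemma tooth_density (a0 b0 : R) (j0 : nat) (win : nat -> option nat) :
  cumul Theta a0 < cumul Theta b0 ->
  exists B : nat -> R, [/\ forall l, 0 <= B l <= 8 / wm j0,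
    forall l, (forall m, win l = Some m -> (m < j0)%N) -> B l = 0 &
    forall psi : nat -> R, (forall l, 0 <= psi l) ->
      (\sum_(n <oo) (split_mass Theta a0 b0 (wa j0) (wb j0) n /
          (cumul Theta (wb j0 n) - cumul Theta (wa j0 n)))%:E *
          \sum_(l <oo) (if win l == Some (idx j0 n./2) then psi l else 0)%:E =
        \sum_(l <oo) (B l * psi l)%:E)%E].
Proof.
move=> ab; have winF n : cumul Theta (wa j0 n) < cumul Theta (wb j0 n).
  exact: (lad_win lad).
pose c n := split_mass Theta a0 b0 (wa j0) (wb j0) n /
  (cumul Theta (wb j0 n) - cumul Theta (wa j0 n)).
have c0 n : 0 <= c n.
  by rewrite divr_ge0 ?split_mass_ge0// subr_ge0 ltW.
have w0 := win_mass_gt0 lad j0.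
have c1 n : c n <= (3 / 4) ^+ n./2 / wm j0.
  have := split_mass_le Theta_nonneg ab winF n.
  rewrite /c -[_ - _]/(wm (idx j0 n./2)) => h.
  have h' := sched_mass lad j0 n./2; have w1 := win_mass_gt0 lad (idx j0 n./2).
  rewrite ler_pdivrMr// mulrAC ler_pdivlMr//.
  apply: (@le_trans _ _ ((2^-1) ^+ n./2 * wm j0)); first by rewrite ler_pM2r.
  (* The factor (2/3)^n is absorbed by [sched_mass], the factor (3/4)^n is left for the
     summation. *)
  have -> : 2^-1 = (3 / 4) * (2 / 3) :> R by lra.
  by rewrite exprMn -mulrA ler_wpM2l// exprn_ge0//; lra.
pose B l := (\sum_(n <oo) (if win l == Some (idx j0 n./2) then c n else 0)%:E)%E.
have if0 (b : bool) (r : R) : 0 <= r -> 0 <= (if b then r else 0).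
  by case: b.
have B8 l : (B l <= (8 / wm j0)%:E)%E.
  apply: lime_le; first by apply: is_cvg_nneseries => n _ _; rewrite lee_fin if0.
  apply: nearW => n; rewrite sumEFin lee_fin.
  rewrite ler_pdivlMr//; apply: le_trans (half_pow_sum R n).
  rewrite mulr_suml; apply: ler_sum => i _; case: ifP => _.
    by rewrite -ler_pdivlMr.
  by rewrite mul0r exprn_ge0//; lra.
have B0 l : (0 <= B l)%E by apply: nneseries_ge0 => n _ _; rewrite lee_fin if0.
have Bfin l : B l \is a fin_num.
  by rewrite ge0_fin_numE//; apply: le_lt_trans (B8 l) _; rewrite ltry.
exists (fun l => fine (B l)); split.
- by move=> l; rewrite -!lee_fin fineK// B0 B8.
- move=> l Hl; rewrite /B eseries0// => n _ _; case: eqP => // /Hl.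
  by rewrite ltnNge (sched_idx_ge Theta sig del j0).
move=> psi psi0.
transitivity (\sum_(n <oo) \sum_(l <oo)
    ((c n)%:E * (if win l == Some (idx j0 n./2) then psi l else 0)%:E))%E.
  apply: eq_eseriesr => n _; rewrite nneseriesZl//.
  by move=> l _; rewrite lee_fin if0.
rewrite nneseries_interchange; last first.
  by move=> n l; apply: mule_ge0; rewrite lee_fin ?if0.
apply: eq_eseriesr => l _; rewrite EFinM fineK// muleC -nneseriesZl; last first.
  by move=> n _; rewrite lee_fin if0.
apply: eq_eseriesr => n _; rewrite -!EFinM; congr (_%:E).
by case: ifP => _; rewrite ?mulr0// mulrC.
Qed.

End density.

(** * Masses *)

Section inner_masses.
Context (R : realType).
Variables (theta T K : nat -> R) (B : nat -> nat -> R) (M0 : R) (acc0 : nat -> R).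
Hypothesis theta_gt0 : forall l, 0 < theta l.
Hypothesis thetaE : forall l, theta l = T l - T l.+1.
Hypothesis T_ge0 : forall l, 0 <= T l.
Hypothesis T_lim : forall e : R, 0 < e -> exists l, T l < e.
Hypothesis K_ge0 : forall l, 0 <= K l.
Hypothesis theta_T : forall l, theta l <= T l / 4.
Hypothesis theta_K : forall l, 8 * (K l * theta l) ^+ 2 <= T l.
Hypothesis B_ge0 : forall k l, 0 <= B k l.
Hypothesis B_le : forall k l, B k l <= K k.
Hypothesis B_low : forall k l, (l <= k)%N -> B k l = 0.
Hypothesis B_sum : forall k, (\sum_(l <oo) (B k l * theta l)%:E = 1)%E.
Hypothesis M0_gt0 : 0 < M0.
Hypothesis acc0_ge0 : forall l, 0 <= acc0 l.
Hypothesis acc0_le : forall l, acc0 l <= (1 - M0) / 2.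
Hypothesis M0_sum : ((M0 ^+ 2)%:E + \sum_(l <oo) (acc0 l * theta l)%:E = (T 0)%:E)%E.

(* State: total mass of the union of the teeth of index at least [l] (and of
   the base point), and density with respect to [Theta] of the part of the
   distance law consumed by the inside of the teeth already chosen. *)
Fixpoint inner_state (l : nat) : R * (nat -> R) :=
  if l is m.+1 then
    let (M, acc) := inner_state m in
    let M' := (M + Num.sqrt (M ^+ 2 - 2 * (1 - acc m) * theta m)) / 2 in
    (M', fun i => acc i + (M - M') ^+ 2 * B m i)
  else (M0, acc0).

Definition inner_M l := (inner_state l).1.
Definition inner_acc l := (inner_state l).2.

Lemma inner_MS l : inner_M l.+1 = (inner_M l +
  Num.sqrt (inner_M l ^+ 2 - 2 * (1 - inner_acc l l) * theta l)) / 2.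
Proof. by rewrite /inner_M /inner_acc /=; case: (inner_state l). Qed.

Lemma inner_accS l i : inner_acc l.+1 i =
  inner_acc l i + (inner_M l - inner_M l.+1) ^+ 2 * B l i.
Proof. by rewrite /inner_M /inner_acc /=; case: (inner_state l). Qed.

Let T_tail l : (\sum_(l <= i <oo) (theta i)%:E <= (T l)%:E)%E.
Proof.
apply: lime_le.
  by apply: is_cvg_nneseries => n _ _; rewrite lee_fin ltW.
apply: nearW => n; rewrite sumEFin lee_fin.
have [nl|ln] := leqP n l; first by rewrite big_geq.
rewrite (_ : \sum_(l <= i < n) theta i = T l - T n).
  by rewrite lerBlDr lerDl T_ge0.
rewrite -[RHS]opprB -(telescope_sumr T (ltnW ln)) -sumrN.
by apply: eq_bigr => i _; rewrite thetaE opprB.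
Qed.

(** The last clause is the conservation law: pairs inside the remaining teeth, plus what the teeth
    already chosen use below the top of the piece [l], account for all of [Theta] there. The middle
    clause keeps the used density below 1/2. *)
Definition inner_inv l : Prop := [/\ 0 < inner_M l,
  forall i, 0 <= inner_acc l i <= (1 - inner_M l) / 2 &
  ((inner_M l ^+ 2)%:E + \sum_(l <= i <oo) (inner_acc l i * theta i)%:E =
    (T l)%:E)%E].

(** At most half of [T l] is used by the teeth already chosen, and the conservation law leaves the
    rest to [inner_M l ^+ 2]. *)
Lemma inner_M_ge l : inner_inv l -> T l / 2 <= inner_M l ^+ 2.
Proof.
move=> [M0' accb sumE].
have accth i : 0 <= inner_acc l i * theta i.
  by rewrite mulr_ge0 ?(ltW (theta_gt0 i))//; case/andP: (accb i).
have h : (\sum_(l <= i <oo) (inner_acc l i * theta i)%:E <= (2^-1 * T l)%:E)%E.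
  apply: (@le_trans _ _ (2^-1%:E * \sum_(l <= i <oo) (theta i)%:E)%E).
    rewrite -nneseriesZl; last by move=> i _; rewrite lee_fin ltW.
    apply: lee_nneseries => i; first by rewrite lee_fin.
    move=> _; rewrite -EFinM lee_fin ler_wpM2r ?(ltW (theta_gt0 i))//.
    by have /andP[? ?] := accb i; move: M0'; lra.
  by rewrite EFinM lee_wpmul2l.
have : ((T l)%:E <= (inner_M l ^+ 2)%:E + (2^-1 * T l)%:E)%E.
  by rewrite -sumE leeD2l.
by rewrite -EFinD lee_fin; lra.
Qed.

(** The new mass is the larger root of the quadratic equation, whose discriminant is nonnegative by
    [theta_T]. Being at least half of the old mass, it gives [s * inner_M l <= theta l] for the mass
    [s] of the tooth; [theta_K] turns this into the third conclusion. *)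
Lemma inner_step l : inner_inv l -> [/\ inner_M l.+1 < inner_M l,
  2 * (inner_M l - inner_M l.+1) * inner_M l.+1 = (1 - inner_acc l l) * theta l,
  (inner_M l - inner_M l.+1) * K l <= 2^-1 & 0 < inner_M l.+1].
Proof.
move=> inv; have MT := inner_M_ge inv; case: inv => Mp accb _.
have /andP[a0 a1] := accb l; have t0 := theta_gt0 l.
have M1 : inner_M l <= 1 by have := le_trans a0 a1; lra.
pose x := 1 - inner_acc l l.
have x0 : 0 < x by rewrite /x; lra.
have x1 : x <= 1 by rewrite /x; lra.
pose D := inner_M l ^+ 2 - 2 * x * theta l.
have xt : x * theta l <= theta l by rewrite ler_piMl// ltW.
have D0 : 0 <= D by rewrite /D; have := theta_T l; move: MT; lra.
have sD := sqr_sqrtr D0; set q := Num.sqrt D in sD.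
have q0 : 0 <= q by exact: sqrtr_ge0.
have ME : inner_M l.+1 = (inner_M l + q) / 2 by rewrite inner_MS.
have prod : 2 * (inner_M l - inner_M l.+1) * inner_M l.+1 = x * theta l.
  rewrite ME; have -> : 2 * (inner_M l - (inner_M l + q) / 2) *
      ((inner_M l + q) / 2) = (inner_M l ^+ 2 - q ^+ 2) / 2 by field.
  by rewrite sD /D; field.
have M'0 : 0 < inner_M l.+1 by rewrite ME; lra.
have s0 : 0 < inner_M l - inner_M l.+1.
  have : 0 < 2 * (inner_M l - inner_M l.+1) * inner_M l.+1.
    by rewrite prod mulr_gt0.
  by rewrite pmulr_lgt0// pmulr_rgt0.
split => //; first by rewrite -subr_gt0.
set s := inner_M l - inner_M l.+1.
have sM : s * inner_M l <= theta l.
  apply: le_trans xt; rewrite -prod -/s -mulrA mulrCA ler_wpM2l ?(ltW s0)//.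
  by rewrite ME; lra.
have K0 := K_ge0 l.
have h : (s * K l * inner_M l) ^+ 2 <= (2^-1 * inner_M l) ^+ 2.
  apply: (@le_trans _ _ ((K l * theta l) ^+ 2)).
    rewrite ler_sqr ?nnegrE ?mulr_ge0 ?(ltW s0) ?(ltW Mp) ?(ltW t0)//.
    by rewrite mulrAC [leRHS]mulrC ler_wpM2r.
  by rewrite exprMn; have := theta_K l; move: MT; lra.
rewrite ler_sqr ?nnegrE ?mulr_ge0 ?(ltW s0) ?(ltW Mp)// in h.
by rewrite ler_pM2r in h.
Qed.

(** The tooth adds a density at most [s ^+ 2 * K l <= s / 2], which is exactly the growth of the
    allowed bound. In the conservation law, the square of M' + s splits into M'^2, the cross term
    taken from the piece [l], and s^2, the mass used below by the inside of the tooth. *)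
Lemma inner_invP l : inner_inv l.
Proof.
elim: l => [|l IH]; first by split => // i; rewrite acc0_ge0 acc0_le.
have [Mlt prod sK M'0] := inner_step IH; case: IH => Mp accb sumE.
set s := inner_M l - inner_M l.+1 in prod sK *.
have s0 : 0 < s by rewrite subr_gt0.
split => // [i|].
  rewrite inner_accS -/s; have /andP[a0 a1] := accb i.
  rewrite addr_ge0 ?mulr_ge0 ?B_ge0 ?sqr_ge0 ?(ltW s0)//=.
  have : s ^+ 2 * B l i <= s / 2.
    rewrite expr2 -mulrA ler_pM2l//; apply: le_trans sK.
    by rewrite ler_pM2l.
  by rewrite /s in a1 *; lra.
have accth i : (0 <= (inner_acc l i * theta i)%:E)%E.
  by rewrite lee_fin mulr_ge0 ?(ltW (theta_gt0 i))//; case/andP: (accb i).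
have Bth k i : (0 <= (B k i * theta i)%:E)%E.
  by rewrite lee_fin mulr_ge0 ?(ltW (theta_gt0 i)).
have Bsum : (\sum_(l.+1 <= i <oo) (B l i * theta i)%:E = 1)%E.
  rewrite -(B_sum l) [RHS](nneseries_split 0 l.+1)// add0n.
  rewrite big_nat big1 ?add0e// => i /andP[_ il].
  by rewrite B_low// mul0r.
have -> : (\sum_(l.+1 <= i <oo) (inner_acc l.+1 i * theta i)%:E =
    \sum_(l.+1 <= i <oo) (inner_acc l i * theta i)%:E + (s ^+ 2)%:E)%E.
  rewrite -[X in (_ + X)%E]mule1 -Bsum -nneseriesZl//.
  rewrite -nneseriesD//; last by move=> i _ _; apply: mule_ge0; rewrite // lee_fin sqr_ge0.
  by apply: eq_eseriesr => i _; rewrite inner_accS -/s -EFinM -EFinD; congr (_%:E); ring.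
move: sumE; rewrite nneseries_recS//.
set V := (\sum_(l.+1 <= i <oo) _)%E.
have V0 : (0 <= V)%E by apply: nneseries_ge0.
case: V V0 => [v||] //=.
  move=> v0; rewrite -!EFinD => -[sumE]; congr (_%:E).
  have sE : s ^+ 2 = (inner_M l - inner_M l.+1) ^+ 2 by [].
  by have := thetaE l; move: prod sumE; rewrite sE /s; lra.
Qed.

Lemma inner_M_gt0 l : 0 < inner_M l.
Proof. by case: (inner_invP l). Qed.

Lemma inner_M_lt l : inner_M l.+1 < inner_M l.
Proof. by case: (inner_step (inner_invP l)). Qed.

Lemma inner_M_lim (e : R) : 0 < e -> exists l, inner_M l < e.
Proof.
move=> e0; have [l Tl] := T_lim (exprn_gt0 2 e0); exists l.
have [M0' accb sumE] := inner_invP l.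
rewrite -(ltr_sqr (x := inner_M l)) ?nnegrE ?(ltW M0') ?(ltW e0)//.
apply: le_lt_trans Tl; rewrite -lee_fin -sumE leeDl// nneseries_ge0// => i _ _.
by rewrite lee_fin mulr_ge0 ?(ltW (theta_gt0 i))//; case/andP: (accb i).
Qed.

Lemma inner_accE l : inner_acc l l =
  acc0 l + \sum_(0 <= k < l) (inner_M k - inner_M k.+1) ^+ 2 * B k l.
Proof.
have H m : inner_acc m l =
    acc0 l + \sum_(0 <= k < m) (inner_M k - inner_M k.+1) ^+ 2 * B k l.
  elim: m => [|m IH]; first by rewrite big_geq// addr0.
  by rewrite inner_accS IH big_nat_recr//= addrA.
exact: H.
Qed.

(* The equation expressing that the law of the distance between the tooth [l]
   and the smaller ones is the part of [Theta] left over by the insides of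
   the teeth. *)
Lemma inner_balance l :
  (\sum_(k <oo) ((inner_M k - inner_M k.+1) ^+ 2 * B k l)%:E =
   (1 - acc0 l - 2 * inner_M l.+1 * (inner_M l - inner_M l.+1) / theta l)%:E)%E.
Proof.
have [_ prod _ _] := inner_step (inner_invP l).
rewrite (nneseries_split 0 l)//; last first.
  by move=> k _; rewrite lee_fin mulr_ge0 ?sqr_ge0.
rewrite add0n [X in (_ + X)%E]eseries0 ?adde0; last first.
  by move=> k lk _; rewrite B_low// mulr0.
rewrite sumEFin; congr (_%:E); have := inner_accE l.
have -> : 2 * inner_M l.+1 * (inner_M l - inner_M l.+1) = (1 - inner_acc l l) * theta l.
  by rewrite -prod; ring.
rewrite mulfK ?gt_eqF//; lra.
Qed.

End inner_masses.

(** * Outer masses, solved upwards *)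

Section outer_masses.
Context (R : realType).
Variables (theta tau : nat -> R).
Hypothesis theta_gt0 : forall n, 0 < theta n.
Hypothesis thetaE : forall n, theta n = tau n - tau n.+1.
Hypothesis tau_ge0 : forall n, 0 <= tau n.
Hypothesis tau0_le : tau 0 <= 4^-1.
Hypothesis tau_lim : tau n @[n --> \oo] --> (0 : R).

(** Solves [2 * (G n.+1 - G n) * G n = theta n]: going up, the mass below the tooth is known and the
    equation is linear. *)
Fixpoint orbit (g : R) (n : nat) : R :=
  if n is m.+1 then orbit g m + theta m / (2 * orbit g m) else g.

Let tau_le n : tau n <= 4^-1.
Proof.
elim: n => [//|n IH]; apply: le_trans IH.
by have := theta_gt0 n; rewrite thetaE subr_gt0 => /ltW.
Qed.

Let theta_le n : theta n <= 4^-1.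
Proof. by have := tau_ge0 n.+1; have := tau_le n; rewrite thetaE; lra. Qed.

Lemma orbit_ge (g : R) n : 2^-1 <= g -> 2^-1 <= orbit g n.
Proof.
move=> g0; elim: n => [//|n IH] /=; apply: (le_trans IH); rewrite lerDl.
have {}IH : 0 < orbit g n by lra.
by rewrite divr_ge0 ?mulr_ge0 ?(ltW IH) ?(ltW (theta_gt0 n)).
Qed.

Lemma orbit_lt (g : R) n : 2^-1 <= g -> orbit g n < orbit g n.+1.
Proof.
move=> g0 /=; rewrite ltrDl divr_gt0// mulr_gt0//.
by have := orbit_ge n g0; lra.
Qed.

(* The step of the recursion is nondecreasing and 1-Lipschitz in the starting
   point, so that the supremum of the starting points with orbit below 1 has
   an orbit converging to 1. *)
Lemma orbit_lip (g h : R) n : 2^-1 <= g -> g <= h ->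
  orbit g n <= orbit h n <= orbit g n + (h - g).
Proof.
move=> g0 gh; have h0 := le_trans g0 gh.
elim: n => [|n] /=; first by apply/andP; split; lra.
have := orbit_ge n g0; have := orbit_ge n h0.
set x := orbit h n; set y := orbit g n => x0 y0 /andP[yx xy].
have xp : 0 < x by lra.
have yp : 0 < y by lra.
have E : x + theta n / (2 * x) - (y + theta n / (2 * y)) =
    (x - y) * (1 - theta n / (2 * x * y)).
  by field; rewrite !gt_eqF.
have c0 : 0 <= theta n / (2 * x * y).
  by rewrite divr_ge0 ?mulr_ge0 ?(ltW xp) ?(ltW yp) ?(ltW (theta_gt0 n)).
have c1 : theta n / (2 * x * y) <= 1.
  rewrite ler_pdivrMr ?mulr_gt0// mul1r; have := theta_le n.
  have : 2^-1 * 2^-1 <= x * y by rewrite ler_pM.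
  by rewrite -mulrA; lra.
set c := theta n / (2 * x * y) in E c0 c1.
have d0 : 0 <= x - y by lra.
have : 0 <= (x - y) * (1 - c) by rewrite mulr_ge0//; lra.
have : (x - y) * (1 - c) <= x - y by rewrite ler_piMr//; lra.
by rewrite -E => e1 e2; apply/andP; split; lra.
Qed.

(** Each step adds to the square [theta m] and the square of the tooth mass, itself at most a
    quarter of [theta m]. The squares thus stay below 1/4 + (5/4)(1/4) = 9/16. *)
Lemma orbit_half_le1 n : orbit 2^-1 n <= 1.
Proof.
have H m : orbit 2^-1 m ^+ 2 <= 4^-1 + 5 / 4 * (tau 0 - tau m).
  elim: m => [|m IH]; first by rewrite /= expr2; lra.
  have y0 := orbit_ge m (lexx (2^-1 : R)); rewrite /=.
  set y := orbit _ m in IH y0 *.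
  have yp : 0 < y by lra.
  have -> : (y + theta m / (2 * y)) ^+ 2 =
      y ^+ 2 + theta m + theta m * (theta m / (2 * y) ^+ 2).
    by field; rewrite gt_eqF.
  have : theta m * (theta m / (2 * y) ^+ 2) <= theta m * 4^-1.
    rewrite ler_pM2l ?theta_gt0// ler_pdivrMr ?exprn_gt0 ?mulr_gt0//.
    have : 1 * 1 <= (2 * y) ^+ 2 by rewrite expr2 ler_pM//; lra.
    by have := theta_le m; lra.
  by have := thetaE m; move: IH; lra.
have := H n; have := tau_ge0 n; have := tau0_le => h1 h2 h3.
rewrite leNgt; apply/negP => h.
have : 1 * 1 < orbit 2^-1 n ^+ 2 by rewrite expr2 ltr_pM//; lra.
by lra.
Qed.

(** The last identity is the conservation law at [r0]: the mass used by the insides of the outer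
    teeth, plus [G 0 ^+ 2], is what [Theta] has below [r0]. It lets the inner recursion start from
    [G 0]. *)
Lemma outer_masses_exist : exists G : nat -> R, [/\
  forall n, 2^-1 <= G n < G n.+1,
  forall n, G n < 1,
  forall n, 2 * (G n.+1 - G n) * G n = theta n,
  G n @[n --> \oo] --> (1 : R) &
  (\sum_(n <oo) ((G n.+1 - G n) ^+ 2)%:E = (1 - tau 0 - G 0%N ^+ 2)%:E)%E].
Proof.
pose A := [set g : R | 2^-1 <= g /\ forall n, orbit g n <= 1].
have Ah : A 2^-1 by split => // n; exact: orbit_half_le1.
have hA : has_sup A.
  by split; [exists 2^-1 | exists 1 => g [_ /(_ 0%N)]].
pose g := sup A.
have g0 : 2^-1 <= g by apply: ub_le_sup => //; case: hA.
have Ag : A g.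
  split => // n; rewrite leNgt; apply/negP => h.
  have e0 : 0 < orbit g n - 1 by lra.
  have [x [x0 Ax] xg] := sup_adherent e0 hA.
  have xg' : x <= g by apply: ub_le_sup => //; case: hA.
  by have /andP[_] := orbit_lip n x0 xg'; have := Ax n; move: xg; rewrite -/g; lra.
have Glt n := orbit_lt n g0.
have G1 n : orbit g n < 1 by apply: lt_le_trans (Glt n) _; case: Ag.
have Ghomo m n : (m <= n)%N -> orbit g m <= orbit g n.
  by move: m n; apply/nondecreasing_seqP => n; exact: ltW.
have Glim : orbit g n @[n --> \oo] --> (1 : R).
  apply/cvgrPdist_lt => e e0.
  have [N HN] : exists N, 1 - e < orbit g N.
    apply: contrapT => /forallNP H.
    have : A (g + e).
      split; first by lra.
      move=> n; have ge : g <= g + e by lra.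
      have /andP[_] := orbit_lip n g0 ge.
      by have /negP := H n; rewrite -leNgt; lra.
    by move=> /(ub_le_sup (proj2 hA)); rewrite -/g; lra.
  exists N => // n /= Nn; rewrite ger0_norm ?subr_ge0 ?(ltW (G1 n))//.
  by have := Ghomo _ _ Nn; lra.
have step n : 2 * (orbit g n.+1 - orbit g n) * orbit g n = theta n.
  by rewrite /=; field; have := orbit_ge n g0; lra.
exists (orbit g); split => //.
  by move=> n; rewrite orbit_ge//= Glt.
have sumE n : \sum_(0 <= i < n) (orbit g i.+1 - orbit g i) ^+ 2 =
    orbit g n ^+ 2 - g ^+ 2 - (tau 0 - tau n).
  elim: n => [|n IH]; first by rewrite big_geq//=; lra.
  by rewrite big_nat_recr// IH /=; have := step n; have := thetaE n; rewrite /=; lra.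
apply: cvg_lim => //.
have -> : (fun n => \sum_(0 <= i < n) ((orbit g i.+1 - orbit g i) ^+ 2)%:E)%E =
    (fun n => (orbit g n ^+ 2 - g ^+ 2 - (tau 0 - tau n))%:E).
  by apply/funext => n; rewrite sumEFin sumE.
apply: cvg_EFin; first exact: nearW.
have -> : fine \o (fun n => (orbit g n ^+ 2 - g ^+ 2 - (tau 0 - tau n))%:E) =
    (fun n => orbit g n ^+ 2 - g ^+ 2 - (tau 0 - tau n)) by [].
have -> : 1 - tau 0 - orbit g 0 ^+ 2 = 1 ^+ 2 - g ^+ 2 - (tau 0 - 0).
  by rewrite /=; ring.
apply: cvgB; last by apply: cvgB => //; exact: cvg_cst.
by apply: cvgB; [under eq_fun do rewrite expr2; rewrite expr2; exact: cvgM | exact: cvg_cst].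
Qed.

End outer_masses.

(** * Partition of the half-line *)

(** Serves to drop the pieces of measure zero, by which the equations for the masses could not be
    divided; the last two properties say that nothing else is skipped. *)
Lemma enum_pred (p : pred nat) : (forall n, exists2 m, (n <= m)%N & p m) ->
  exists e : nat -> nat, [/\ forall l, p (e l), forall l, (e l < e l.+1)%N,
    forall n, (n < e 0)%N -> ~~ p n &
    forall l n, (e l < n < e l.+1)%N -> ~~ p n].
Proof.
move=> inf; have inf' n : exists m, (n <= m)%N && p m.
  by have [m h1 h2] := inf n; exists m; rewrite h1.
pose nx n := ex_minn (inf' n).
have nxP n : [/\ (n <= nx n)%N, p (nx n) & forall m, (n <= m < nx n)%N -> ~~ p m].
  rewrite /nx; case: ex_minnP => m /andP[nm pm] H; split => // i /andP[ni im].
  by apply/negP => pi; have := H i; rewrite ni pi leqNgt im => /(_ isT).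
exists (fun l => iter l (fun i => nx i.+1) (nx 0)); split.
- by case=> [|l] /=; [have [] := nxP 0 | have [] := nxP (iter l (fun i => nx i.+1) (nx 0)).+1].
- by move=> l /=; have [] := nxP (iter l (fun i => nx i.+1) (nx 0)).+1.
- by move=> n n0; have [_ _] := nxP 0; apply; rewrite leq0n.
- by move=> l n; have [_ _] := nxP (iter l (fun i => nx i.+1) (nx 0)).+1; apply.
Qed.

Section enumeration.
Variables (p : pred nat) (e : nat -> nat).
Hypothesis p_e : forall l, p (e l).
Hypothesis e_lt : forall l, (e l < e l.+1)%N.
Hypothesis p_low : forall n, (n < e 0)%N -> ~~ p n.
Hypothesis p_gap : forall l n, (e l < n < e l.+1)%N -> ~~ p n.

Lemma enum_homo l m : (l < m)%N -> (e l < e m)%N.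
Proof.
by move: l m; exact: homo_ltn ltn_trans e_lt.
Qed.

Lemma enum_homo_le l m : (l <= m)%N -> (e l <= e m)%N.
Proof. by rewrite leq_eqVlt => /predU1P[->//|/enum_homo/ltnW]. Qed.

Lemma enum_ge l : (l <= e l)%N.
Proof. by elim: l => // l IH; exact: leq_ltn_trans IH (e_lt l). Qed.

Lemma enum_onto n : p n -> exists l, e l = n.
Proof.
move=> pn; have ex : exists l, (n <= e l)%N by exists n; exact: enum_ge.
case: (ex_minnP ex) => -[|l] nl H; first exists 0%N; last exists l.+1.
  apply/eqP; rewrite eqn_leq nl andbT leqNgt; apply/negP => /p_low.
  by rewrite pn.
apply/eqP; rewrite eqn_leq nl andbT leqNgt; apply/negP => h.
have ln : (e l < n)%N.
  by rewrite ltnNge; apply/negP => /H; rewrite ltnn.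
by have := @p_gap l n; rewrite ln h pn => /(_ isT).
Qed.

Lemma enum_series (R : realType) (f : nat -> \bar R) : (forall n, (0 <= f n)%E) ->
  (forall n, ~~ p n -> f n = 0%E) ->
  (\sum_(n <oo) f n = \sum_(l <oo) f (e l))%E.
Proof.
move=> f0 fp; rewrite (nneseries_esumT (a := fun l => f (e l)))//.
transitivity (\sum_(n <oo | p n) f n)%E.
  rewrite [RHS]eseries_mkcond; apply: eq_eseriesr => n _.
  by case: ifPn => // /fp.
rewrite nneseries_esum//; apply: reindex_esum; split.
- by move=> l _ /=.
- move=> l m _ _ lm; apply/eqP; have [/enum_homo|/enum_homo|//] := ltngtP l m.
    by rewrite lm ltnn.
  by rewrite lm ltnn.
- by move=> n /= /enum_onto[l <-]; exists l.
Qed.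

(** Applied to the distribution function at the cut points: it does not change across the skipped
    pieces, so consecutive kept pieces still match. *)
Lemma enum_const (R : numDomainType) (f : nat -> R) :
  (forall n, ~~ p n -> f n.+1 = f n) ->
  (forall l, f (e l.+1) = f (e l).+1) /\ f (e 0) = f 0.
Proof.
move=> fp; have H i j : (forall n, (i <= n < j)%N -> ~~ p n) -> (i <= j)%N -> f j = f i.
  elim: j => [|j IH] Hp; first by rewrite leqn0 => /eqP ->.
  rewrite leq_eqVlt => /predU1P[->//|]; rewrite ltnS => ij.
  rewrite fp; last by apply: Hp; rewrite ij /=.
  by apply: IH => // n /andP[h1 h2]; apply: Hp; rewrite h1 ltnW.
split=> [l|]; apply: H => //; by [move=> n; exact: p_gap|move=> n /andP[_]; exact: p_low].
Qed.

End enumeration.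

Section chains.
Context (R : realType) (Theta : probability (measurableTypeR R) R).

Local Notation F := (cumul Theta).

Lemma itv_null (A : set (measurableTypeR R)) (a b : R) : measurable A -> a <= b ->
  ~~ (F a < F b) -> Theta (A `&` `]a, b]%classic) = 0%E.
Proof.
move=> mA ab; rewrite -leNgt => Fba; apply/eqP; rewrite eq_le measure_ge0 andbT.
have mI : measurable (`]a, b]%classic : set (measurableTypeR R)) by exact: measurable_itv.
apply: (@le_trans _ _ (Theta `]a, b]%classic)).
  by apply: le_measure; rewrite ?inE//; exact: measurableI.
apply: (@le_trans _ _ ((F b - F a)%:E)); last by rewrite lee_fin; lra.
by rewrite -measure_itvoc.
Qed.

Lemma itv_series (A : set (measurableTypeR R)) (lo hi : nat -> R) (I : set R) :
  measurable A -> (forall m n, (m < n)%N -> hi n <= lo m \/ hi m <= lo n) ->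
  (forall t, I t <-> exists n, lo n < t <= hi n) ->
  Theta (A `&` I) = (\sum_(n <oo) Theta (A `&` `](lo n), (hi n)]%classic))%E.
Proof.
move=> mA dis IE.
have -> : A `&` I = \bigcup_n (A `&` `](lo n), (hi n)]%classic).
  rewrite -setI_bigcupr; congr (_ `&` _); apply/seteqP; split => t.
    by move=> /IE[n tn]; exists n => //=; rewrite in_itv.
  by move=> [n _] /=; rewrite in_itv /= => tn; apply/IE; exists n.
have mI n : measurable (A `&` `](lo n), (hi n)]%classic : set (measurableTypeR R)).
  by apply: measurableI => //; exact: measurable_itv.
apply: measure_semi_bigcup => //; last exact: bigcupT_measurable.
apply/trivIsetP => m n _ _ mn; rewrite -subset0 => t /= [[_ tm] [_ tn]].
move: tm tn; rewrite !in_itv /= => /andP[m1 m2] /andP[n1 n2].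
have : hi n <= lo m \/ hi m <= lo n.
  move: mn; rewrite neq_ltn => /orP[/dis//|/dis[|]]; by [right|left].
by case => h; lra.
Qed.

End chains.

Section refinement.
Context (R : realType).
Variables bd step : nat -> R.
Hypothesis bd_lt : forall m, bd m.+1 < bd m.
Hypothesis step_gt0 : forall m, 0 < step m.

(* Descending cut points: from [bd m] to [bd m.+1] by steps of length [step m],
   the last one possibly shorter. *)
Fixpoint descent (n : nat) : nat * R :=
  if n is i.+1 then
    let (m, x) := descent i in
    if x - step m <= bd m.+1 then (m.+1, bd m.+1) else (m, x - step m)
  else (0%N, bd 0%N).

Definition phase n := (descent n).1.
Definition level n := (descent n).2.

Lemma descentS n :
  (phase n.+1 = (phase n).+1 /\ level n.+1 = bd (phase n).+1 /\
     level n - step (phase n) <= bd (phase n).+1) \/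
  (phase n.+1 = phase n /\ level n.+1 = level n - step (phase n) /\
     bd (phase n).+1 < level n - step (phase n)).
Proof.
rewrite /phase /level /=; case: (descent n) => m x /=.
by case: (leP (x - step m) (bd m.+1)) => h; [left|right].
Qed.

Lemma level_range n : bd (phase n).+1 < level n <= bd (phase n).
Proof.
elim: n => [|n /andP[IH1 IH2]]; first by rewrite /phase /level /= bd_lt lexx.
case: (descentS n) => [[-> [-> _]]|[-> [-> h]]]; first by rewrite bd_lt lexx.
by rewrite h /=; have := step_gt0 (phase n); lra.
Qed.

Lemma level_step n : [/\ level n.+1 < level n,
  level n - level n.+1 <= step (phase n) & bd (phase n).+1 <= level n.+1].
Proof.
have /andP[h1 h2] := level_range n; have h3 := step_gt0 (phase n).
case: (descentS n) => [[_ [-> h]]|[_ [-> h]]]; split => //; lra.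
Qed.

Lemma level_homo m n : (m <= n)%N -> level n <= level m.
Proof.
by move: m n; apply/nonincreasing_seqP => n; have [/ltW] := level_step n.
Qed.

Lemma phase_homo m n : (m <= n)%N -> (phase m <= phase n)%N.
Proof.
move: m n; apply: homo_leq leqnn leq_trans _ => n.
by case: (descentS n) => [[-> _]|[-> _]].
Qed.

Lemma bd_homo m n : (m <= n)%N -> bd n <= bd m.
Proof.
by move: m n; apply/nonincreasing_seqP => n; exact: ltW.
Qed.

Lemma phase_unbounded m : exists n, (m <= phase n)%N.
Proof.
elim: m => [|m [n mn]]; first by exists 0%N.
apply: contrapT => /forallNP H.
have stay i : phase (n + i) = m.
  apply/eqP; rewrite eqn_leq (leq_trans mn) ?phase_homo ?leq_addr// andbT.
  by rewrite -ltnS ltnNge; apply/negP; exact: H.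
have lvl i : level (n + i) = level n - i%:R * step m.
  elim: i => [|i IH]; first by rewrite addn0 mul0r subr0.
  case: (descentS (n + i)); rewrite -!addnS !stay IH => -[h [-> _]].
    by case: (n_Sn _ h).
  by rewrite -addn1 natrD; ring.
pose i := (Num.truncn ((level n - bd m.+1) / step m)).+1.
have : (level n - bd m.+1) / step m < i%:R by exact: truncnS_gt.
rewrite ltr_pdivrMr//; have /andP[] := level_range (n + i).
by rewrite stay lvl; lra.
Qed.

Lemma level_cover (t : R) : t <= bd 0 -> (exists n, level n < t) ->
  exists n, level n.+1 < t <= level n.
Proof.
move=> t0 ex; case: (ex_minnP ex) => -[|n] nt H.
  by move: nt; rewrite /level /= ltNge t0.
exists n; rewrite nt leNgt; apply/negP => /H; rewrite ltnn//.
Qed.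

Hypothesis bd_lim : forall e : R, 0 < e -> exists m, bd m < e.

Lemma level_lim (e : R) : 0 < e -> exists n, level n < e.
Proof.
move=> /bd_lim[m me]; have [n mn] := phase_unbounded m; exists n.
have /andP[_ h] := level_range n.
exact: le_lt_trans (le_trans h (bd_homo mn)) me.
Qed.

Lemma level_gt0 (bd_gt0 : forall m, 0 < bd m) n : 0 < level n.
Proof. by have /andP[h _] := level_range n; exact: lt_trans h. Qed.

Lemma level_window m n (t : R) : level n.+1 < t <= level n ->
  (bd m.+1 < t <= bd m) = (phase n == m).
Proof.
move=> /andP[h1 h2]; have /andP[h3 h4] := level_range n.
have [_ _ h5] := level_step n; case: eqVneq => [<-|].
  by apply/andP; split; lra.
rewrite neq_ltn => /orP[] nm; apply/negbTE; rewrite negb_and -!leNgt -!ltNge.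
  by apply/orP; right; have := bd_homo nm; lra.
by apply/orP; left; have := bd_homo nm; lra.
Qed.

End refinement.

(* Partition of ]0, r0] into pieces ]a l, b l] of positive mass, up to a null
   set; [win l = Some m] when the piece lies in the [m]-th window, and the tree
   over the piece starts with the window of index [jz l]. *)
Record inner_pieces (R : realType) (Theta : probability (measurableTypeR R) R)
    (L r0 : R) (sig del : nat -> R) (a b : nat -> R) (jz : nat -> nat)
    (win : nat -> option nat) : Prop := InnerPieces {
  ip_mass : forall l, cumul Theta (a l) < cumul Theta (b l) ;
  ip_adm : forall l, admissible Theta L (a l) (b l)
    (sched_wa Theta sig del (jz l)) (sched_wb Theta sig del (jz l)) ;
  ip_desc : forall l, b l.+1 <= a l ;
  ip_cumul : forall l, cumul Theta (b l.+1) = cumul Theta (a l) ;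
  ip_top : b 0 <= r0 ;
  ip_cumul0 : cumul Theta (b 0) = cumul Theta r0 ;
  ip_lim : forall e : R, 0 < e -> exists l, b l < e ;
  ip_small : forall l,
    cumul Theta (b l) - cumul Theta (a l) <= cumul Theta (b l) / 4 ;
  ip_smallK : forall l, 8 * (8 / win_mass Theta sig del (jz l) *
    (cumul Theta (b l) - cumul Theta (a l))) ^+ 2 <= cumul Theta (b l) ;
  ip_win_lt : forall k l m, (l <= k)%N -> win l = Some m -> (m < jz k)%N ;
  ip_series : forall A : set (measurableTypeR R), measurable A ->
    Theta (A `&` `]0, r0]%classic) =
      (\sum_(l <oo) Theta (A `&` `](a l), (b l)]%classic))%E ;
  ip_win : forall m (A : set (measurableTypeR R)), measurable A ->
    Theta (A `&` `](sig m), (sig m + del m)]%classic) =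
      (\sum_(l <oo) if win l == Some m then Theta (A `&` `](a l), (b l)]%classic)
        else 0)%E }.

(** * Pieces below [r0] *)

Section inner_pieces_exist.
Context (R : realType) (Theta : probability (measurableTypeR R) R).
Hypothesis Theta_nonneg : Theta [set x : R | 0 <= x] = 1%E.
Hypothesis Theta_atomless : atomless Theta.
Hypothesis Theta_supp0 : msupp (Theta : set R -> \bar R) 0.
Variables (L r0 : R) (sig del : nat -> R).
Hypothesis L1 : 1 < L.
Hypothesis lad : ladder Theta L r0 sig del.

Local Notation F := (cumul Theta).
Local Notation wm := (win_mass Theta sig del).

(** The bounds alternate between tops and bottoms of windows, so that no piece straddles the end of
    a window; the odd phases are the windows. *)
Let bd m : R :=
  if m is i.+1 then (if odd i then sig i./2 else sig i./2 + del i./2) else r0.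

Let bd_lt m : bd m.+1 < bd m.
Proof.
case: m => [|i] /=.
  have := lad_del lad 0; have := lad_half lad 0; have := lad_top lad.
  by have := lad_gt0 lad 0; have := lad_gt0 lad 1; lra.
rewrite uphalf_half; case: (odd i); rewrite /= ?add1n ?add0n; last first.
  by rewrite ltrDl (lad_del_gt0 lad).
have := lad_half lad i./2; have := lad_half lad i./2.+1.
have := lad_del lad i./2.+1; have := lad_gt0 lad i./2; lra.
Qed.

(** [uphalf m] is the first window entirely below the phase [m]; the trees over the pieces of this
    phase start there. *)
Let bd_ge m : sig (uphalf m) + del (uphalf m) <= bd m.+1.
Proof.
rewrite /bd uphalf_half; case: (odd m) => /=; rewrite ?add1n ?add0n//.
exact: (lad_step lad).
Qed.

Let bd_gt0 m : 0 < bd m.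
Proof.
apply: lt_trans (bd_lt m); apply: lt_le_trans (bd_ge m).
by rewrite addr_gt0 ?(lad_gt0 lad) ?(lad_del_gt0 lad).
Qed.

Let bd_lim (e : R) : 0 < e -> exists m, bd m < e.
Proof.
move=> /(lad_lim lad)[j je]; exists j.*2.+2.
by rewrite /bd /= odd_double /= uphalf_double.
Qed.

(** With a piece of mass at most this, [8 / wm * theta] is at most a quarter of the mass below the
    piece, which yields both [ip_small] and [ip_smallK]. *)
Let eps m := F (bd m.+1) * wm (uphalf m) / 32.

Lemma inner_pieces_exist : exists a b jz win,
  inner_pieces Theta L r0 sig del a b jz win.
Proof.
have F0 (x : R) : 0 < x -> 0 < F x.
  exact: (cumul_gt0 Theta_supp0).
have eps0 m : 0 < eps m.
  by rewrite /eps divr_gt0// mulr_gt0 ?F0 ?(win_mass_gt0 lad).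
have exd m : exists d : R, 0 < d /\ forall x, F (x + d) - F x <= eps m.
  have [d d0 Hd] := cumul_uniform Theta_nonneg Theta_atomless (eps0 m).
  by exists d.
have [d Hd] := choice exd.
(* The three bounds make the mass of a piece small, its length at most the first oscillation bound
   of its tree, and the ratio of its ends at most [L]. *)
pose step m : R := Num.min (d m) (Num.min (sig (uphalf m)) ((L - 1) * sig (uphalf m))).
have step_gt0 m : 0 < step m.
  have s0 := lad_gt0 lad (uphalf m).
  by rewrite !lt_min s0 (proj1 (Hd m)) mulr_gt0// subr_gt0.
pose x := level bd step; pose ph := phase bd step.
have xr n := level_range bd_lt step_gt0 n.
have xs n := level_step bd_lt step_gt0 n.
have x0 n : 0 < x n by exact: (level_gt0 bd_lt step_gt0 bd_gt0).
have xlim (e : R) : 0 < e -> exists n, x n < e.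
  exact: (level_lim bd_lt step_gt0 bd_lim).
have xhomo m n : (m <= n)%N -> x n <= x m by exact: (level_homo bd_lt step_gt0).
have phomo m n : (m <= n)%N -> (ph m <= ph n)%N by exact: phase_homo.
have xmass n : F (x n) - F (x n.+1) <= eps (ph n).
  have [h1 h2 h3] := xs n; apply: le_trans (proj2 (Hd (ph n)) (x n.+1)).
  rewrite lerD2r; apply: cumul_homo; rewrite -lerBlDl; apply: le_trans h2 _.
  by rewrite /step ge_min lexx.
pose p n := F (x n.+1) < F (x n).
have pinf n : exists2 m, (n <= m)%N & p m.
  apply: contrapT => H; have pn m : (n <= m)%N -> F (x m.+1) = F (x m).
    move=> nm; apply/eqP; rewrite eq_le cumul_homo ?xhomo//=.
    by rewrite leNgt; apply/negP => pm; apply: H; exists m.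
  have pn' i : F (x (n + i)%N) = F (x n).
    by elim: i => [|i IH]; rewrite ?addn0// addnS pn ?leq_addr.
  have : F (x n) <= F 0.
    apply: cumul_right => y /xlim[m my].
    rewrite -(pn' m); apply: cumul_homo; apply: ltW; apply: le_lt_trans my.
    by apply: xhomo; rewrite leq_addl.
  by rewrite (cumul0 Theta_nonneg Theta_atomless) leNgt F0.
have [e [pe elt elow egap]] := enum_pred pinf.
have [eS e0] : (forall l, F (x (e l.+1)) = F (x (e l).+1)) /\ F (x (e 0%N)) = F (x 0%N).
  apply: (enum_const elt elow egap (f := fun n => F (x n))) => n pn.
  by apply/eqP; rewrite eq_le cumul_homo ?xhomo//= leNgt.
pose win n := if odd (ph n) then Some (ph n)./2 else None.
have winP m n : (win n == Some m) = (ph n == m.*2.+1).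
  rewrite /win; case: (boolP (odd (ph n))) => h; last first.
    by apply/esym/negbTE; apply: contraNneq h => ->; rewrite /= odd_double.
  have {1}-> : m = m.*2.+1./2 by rewrite /= uphalf_double.
  apply/eqP/eqP => [[hh]|-> //].
  by rewrite -(odd_double_half (ph n)) h hh /= uphalf_double.
have ser (A : set (measurableTypeR R)) : measurable A ->
    Theta (A `&` `]0, r0]%classic) =
      (\sum_(l <oo) Theta (A `&` `](x (e l).+1), (x (e l))]%classic))%E.
  move=> mA; rewrite (@itv_series _ _ A (fun n => x n.+1) x)//.
  - apply: (enum_series pe elt elow egap
      (f := fun n => Theta (A `&` `](x n.+1), (x n)]%classic))) => // n pn.
    by apply: itv_null => //; apply: xhomo.
  - by move=> m n mn; left; exact: xhomo.
  - move=> t; rewrite /= in_itv /=; split => [/andP[t0 tr]|[n /andP[h1 h2]]].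
      exact: (level_cover (bd := bd) (step := step) tr (xlim _ t0)).
    rewrite (lt_trans (x0 _) h1) (le_trans h2)//.
    exact: (le_trans (xhomo _ _ (leq0n n))).
exists (fun l => x (e l).+1), (x \o e), (fun l => uphalf (ph (e l))), (win \o e).
have xbd l : bd (ph (e l)).+1 <= x (e l).+1 by have [] := xs (e l).
split => //=.
- move=> l; have [h1 h2 h3] := xs (e l).
  have h4 := bd_ge (ph (e l)); have s0 := lad_gt0 lad (uphalf (ph (e l))).
  have d0 := lad_del_gt0 lad (uphalf (ph (e l))).
  have st1 : step (ph (e l)) <= sig (uphalf (ph (e l))).
    by rewrite /step !ge_min lexx orbT.
  have st2 : step (ph (e l)) <= (L - 1) * sig (uphalf (ph (e l))).
    by rewrite /step !ge_min lexx !orbT.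
  apply: (sched_admissible lad) => //.
  + exact: pe.
  + exact: le_trans h2 st1.
  + exact: le_trans h4 h3.
  + rewrite -/x -/ph in h1 h2 h3 *.
    have h5 := le_trans h4 (xbd l).
    have : (L - 1) * sig (uphalf (ph (e l))) <= (L - 1) * x (e l).+1.
      by rewrite ler_pM2l ?subr_gt0//; move: h5 d0; lra.
    by move: (le_trans h2 st2); lra.
- by move=> l; apply: xhomo; exact: elt.
- exact: (xhomo 0%N).
- move=> u /xlim[n nu]; exists n; apply: le_lt_trans nu; apply: xhomo.
  exact: enum_ge.
- move=> l; apply: le_trans (xmass _) _; rewrite /eps.
  have : F (bd (ph (e l)).+1) <= F (x (e l)).
    by apply: cumul_homo; apply: le_trans (xbd l) _; exact: xhomo.
  set T := F (bd _); have T0 : 0 < T by exact: F0.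
  have : T * wm (uphalf (ph (e l))) <= T.
    by rewrite ler_piMr ?(ltW T0)// win_mass_le1.
  by lra.
- move=> l; have := xmass (e l); rewrite /eps.
  have : F (bd (ph (e l)).+1) <= F (x (e l)).
    by apply: cumul_homo; apply: le_trans (xbd l) _; exact: xhomo.
  set T := F (bd _); have T0 : 0 < T by exact: F0.
  have T1 : T <= 1 by exact: cumul_le1.
  have v0 := win_mass_gt0 lad (uphalf (ph (e l))).
  set v := wm _ in v0 * => TF h.
  set M := F (x (e l)) - _ in h *.
  have M0 : 0 <= M by rewrite subr_ge0; exact: ltW (pe l).
  have : (8 / v * M) ^+ 2 <= (T / 4) ^+ 2.
    rewrite ler_sqr ?nnegrE ?mulr_ge0 ?invr_ge0 ?(ltW v0) ?(ltW T0)//.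
    by rewrite mulrAC ler_pdivrMr//; lra.
  have : T * T <= T by rewrite ler_piMl// ltW.
  by rewrite (exprMn _ T) [T ^+ 2]expr2; lra.
- move=> k l m lk /eqP; rewrite winP => /eqP pl.
  have := phomo _ _ (enum_homo_le elt lk); rewrite pl => h.
  by rewrite gtn_uphalf_double.
- move=> m A mA; have bdE : `](sig m), (sig m + del m)]%classic =
      `](bd m.*2.+2), (bd m.*2.+1)]%classic :> set R.
    by rewrite /bd /= odd_double /= doubleK uphalf_double.
  rewrite bdE; set W : set R := `]_, _]%classic.
  have mW : measurable (W : set (measurableTypeR R)) by exact: measurable_itv.
  have -> : A `&` W = (A `&` W) `&` `]0, r0]%classic.
    apply/esym/setIidPl => t [_]; rewrite /W /= !in_itv /= => /andP[h1 h2].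
    rewrite (lt_trans (bd_gt0 m.*2.+2) h1)/=; apply: (le_trans h2).
    exact: (bd_homo bd_lt (leq0n m.*2.+1)).
  rewrite ser; last exact: measurableI.
  apply: eq_eseriesr => l _; rewrite winP; case: ifPn => h.
    congr (Theta _); rewrite -setIA; congr (_ `&` _).
    apply/setIidPr => t /=; rewrite !in_itv /= => tl.
    by apply: etrans (level_window bd_lt step_gt0 m.*2.+1 tl) _.
  rewrite (_ : _ `&` _ = set0) ?measure0// -subset0 => t /= [[_ tW] tl].
  move: tW tl; rewrite /W /= !in_itv /= => tW tl.
  by move: h; rewrite -(level_window bd_lt step_gt0 m.*2.+1 tl) => /negP; apply.
Qed.

End inner_pieces_exist.

(** * Boundedness of the support in terms of the distribution function *)

Section support_bounds.
Context (R : realType) (Theta : probability (measurableTypeR R) R).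
Hypothesis Theta_nonneg : Theta [set x : R | 0 <= x] = 1%E.
Hypothesis Theta_atomless : atomless Theta.

Local Notation F := (cumul Theta).

Lemma cumul_lim (u : R) : u < 1 -> exists y, u < F y.
Proof.
move=> u1; pose v := Num.max u 0; have v1 : v < 1 by rewrite gt_max u1 ltr01.
have v0 : 0 <= v by rewrite le_max lexx orbT.
exists (quantile Theta ((v + 1) / 2)).
rewrite (cumul_quantile Theta_nonneg Theta_atomless); last by apply/andP; split; lra.
by apply: (@le_lt_trans _ _ v); [rewrite le_max lexx | lra].
Qed.

Lemma quantile_msupp (u : R) : 0 < u < 1 ->
  msupp (Theta : set R -> \bar R) (quantile Theta u).
Proof.
move=> /andP[u0 u1] U oU Uq; set q := quantile Theta u in Uq *.
have /nbhs_ballP[e /= e0 eU] : nbhs q U by exact: open_nbhs_nbhs.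
have ex : exists y, u <= F y by have [y /ltW] := cumul_lim u1; exists y.
have qe : q - e / 2 <= q by rewrite gerBl divr_ge0 ?(ltW e0).
have lt : F (q - e / 2) < u.
  by rewrite -(quantile_gt Theta_nonneg _ u0 ex) gtrBl divr_gt0.
apply: (@lt_le_trans _ _ (Theta `](q - e / 2), q]%classic)).
  rewrite measure_itvoc// lte_fin subr_gt0.
  by rewrite (cumul_quantile Theta_nonneg Theta_atomless) ?u0.
apply: le_measure; rewrite ?inE; first exact: measurable_itv.
  exact: measurable_realfun.open_measurable.
move=> z /=; rewrite in_itv /= => /andP[z1 z2]; apply: eU.
by rewrite /ball /= ger0_norm; lra.
Qed.

Lemma bounded_msupp_cumul : bounded_set (msupp (Theta : set R -> \bar R)) ->
  exists2 r, 0 < r & F r = 1.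
Proof.
move=> [M [_ HM]]; exists (Num.max (M + 1) 1); first by rewrite lt_max ltr01 orbT.
set r := Num.max _ _; apply/eqP; rewrite eq_le cumul_le1 leNgt; apply/negP => Fr.
have u01 : 0 < (F r + 1) / 2 < 1.
  by have := cumul_ge0 Theta r; move=> h; apply/andP; split; lra.
have M1 : M < M + 1 by rewrite ltrDl.
have := HM _ M1 _ (quantile_msupp u01) => /(le_trans (ler_norm _)) qM.
have : F (quantile Theta ((F r + 1) / 2)) <= F r.
  by apply: cumul_homo; apply: le_trans qM _; rewrite le_max lexx.
by rewrite (cumul_quantile Theta_nonneg Theta_atomless)//; lra.
Qed.

Lemma unbounded_msupp_cumul : ~ bounded_set (msupp (Theta : set R -> \bar R)) ->
  forall M : R, F M < 1.
Proof.
move=> unb M; rewrite lt_neqAle cumul_le1 andbT; apply/eqP => FM; apply: unb.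
exists M; split; first exact: num_real.
move=> M' MM' x xs; apply: le_trans (ltW MM').
have Mx : x <= M.
  rewrite leNgt; apply/negP => Mx; have := xs `]M, +oo[%classic (rray_open M).
  rewrite /= in_itv /= andbT Mx => /(_ isT); rewrite -setCitvl.
  rewrite probability_setC ?measurable_itv//.
  by rewrite -cumulE FM subee// ltxx.
have x0 : 0 <= x.
  rewrite leNgt; apply/negP => x0; have := xs `]-oo, 0[%classic (lray_open (0 : R)).
  rewrite /= in_itv /= => /(_ x0).
  have -> : `]-oo, 0[%classic = ~` [set x : R | 0 <= x].
    by apply/seteqP; split => y /=; rewrite in_itv /= ltNge => /negP.
  rewrite probability_setC; last first.
    have -> : [set x : R | 0 <= x] = `[0, +oo[%classic.
      by apply/seteqP; split => y /=; rewrite in_itv /= andbT.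
    exact: measurable_itv.
  by rewrite Theta_nonneg subee// ltxx.
by rewrite ger0_norm.
Qed.

End support_bounds.

(** Partition of ]r0, +oo[ into ascending pieces, up to a null set, all of whose trees start at the
    window 0. The constant 16 in [op_small] makes the mass of a tooth times its density bound
    [8 / win_mass] at most 1/2. *)
Record outer_pieces (R : realType) (Theta : probability (measurableTypeR R) R)
    (L r0 : R) (sig del : nat -> R) (a b : nat -> R) : Prop := OuterPieces {
  op_mass : forall n, cumul Theta (a n) < cumul Theta (b n) ;
  op_adm : forall n, admissible Theta L (a n) (b n)
    (sched_wa Theta sig del 0) (sched_wb Theta sig del 0) ;
  op_asc : forall n, b n <= a n.+1 ;
  op_cumul : forall n, cumul Theta (a n.+1) = cumul Theta (b n) ;
  op_bot : r0 <= a 0 ;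
  op_cumul0 : cumul Theta (a 0) = cumul Theta r0 ;
  op_lim : forall M : R, exists n, M < a n ;
  op_small : forall n, cumul Theta (b n) - cumul Theta (a n) <=
    win_mass Theta sig del 0 / 16 ;
  op_series : forall A : set (measurableTypeR R), measurable A ->
    Theta (A `&` `]r0, +oo[%classic) =
      (\sum_(n <oo) Theta (A `&` `](a n), (b n)]%classic))%E }.

(** * Pieces above [r0] *)

Section outer_pieces_exist.
Context (R : realType) (Theta : probability (measurableTypeR R) R).
Hypothesis Theta_nonneg : Theta [set x : R | 0 <= x] = 1%E.
Hypothesis Theta_atomless : atomless Theta.
Variables (L r0 : R) (sig del : nat -> R).
Hypothesis L1 : 1 < L.
Hypothesis lad : ladder Theta L r0 sig del.
Hypothesis Theta_unbounded : forall M : R, cumul Theta M < 1.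

Local Notation F := (cumul Theta).
Local Notation wm := (win_mass Theta sig del).

Lemma outer_pieces_exist : exists a b, outer_pieces Theta L r0 sig del a b.
Proof.
have s0 := lad_gt0 lad 0; have w0 := win_mass_gt0 lad 0.
have w16 : 0 < wm 0 / 16 by rewrite divr_gt0.
have [d d0 Hd] := cumul_uniform Theta_nonneg Theta_atomless w16.
(* A constant step is enough here: heights are bounded below by [r0 >= 2 * sig 0] and there is only
   one starting window. *)
pose h : R := Num.min d (Num.min (sig 0) ((L - 1) * sig 0)).
have h0 : 0 < h by rewrite !lt_min d0 s0 mulr_gt0// subr_gt0.
have hd : h <= d by rewrite /h ge_min lexx.
have hs : h <= sig 0 by rewrite /h !ge_min lexx orbT.
have hL : h <= (L - 1) * sig 0 by rewrite /h !ge_min lexx !orbT.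
pose y n : R := r0 + n%:R * h.
have yS n : y n.+1 = y n + h by rewrite /y -addn1 natrD; ring.
have y0 : y 0 = r0 by rewrite /y mul0r addr0.
have yhomo m n : (m <= n)%N -> y m <= y n.
  by move=> mn; rewrite lerD2l ler_wpM2r ?(ltW h0)// ler_nat.
have ylim M : exists n, M < y n.
  exists (Num.truncn (`|M - r0| / h)).+1; rewrite /y -ltrBlDl.
  apply: le_lt_trans (ler_norm _) _; rewrite -ltr_pdivrMr//; exact: truncnS_gt.
pose p n := F (y n) < F (y n.+1).
have pinf n : exists2 m, (n <= m)%N & p m.
  apply: contrapT => H; have pn m : (n <= m)%N -> F (y m.+1) = F (y m).
    move=> nm; apply/eqP; rewrite eq_le andbC cumul_homo ?yhomo//=.
    by rewrite leNgt; apply/negP => pm; apply: H; exists m.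
  have pn' i : F (y (n + i)%N) = F (y n).
    by elim: i => [|i IH]; rewrite ?addn0// addnS pn ?leq_addr.
  have [z] := cumul_lim Theta_nonneg Theta_atomless (Theta_unbounded (y n)).
  have [m zm] := ylim z; rewrite ltNge -(pn' m) => /negP; apply.
  apply: cumul_homo; apply: ltW (lt_le_trans zm _).
  by apply: yhomo; rewrite leq_addl.
have [e [pe elt elow egap]] := enum_pred pinf.
have [eS e0] : (forall l, F (y (e l.+1)) = F (y (e l).+1)) /\ F (y (e 0%N)) = F (y 0%N).
  apply: (enum_const elt elow egap (f := fun n => F (y n))) => n pn.
  by apply/eqP; rewrite eq_le andbC cumul_homo ?yhomo//= leNgt.
have yr n : r0 <= y n by rewrite -y0; exact: yhomo.
have top := lad_top lad; have hal := lad_half lad 0; have s1 := lad_gt0 lad 1.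
have del0 := lad_del lad 0.
exists (y \o e), (fun n => y (e n).+1); split => //=.
- move=> n; have := yr (e n) => yn; apply: (sched_admissible lad) => //.
  + exact: pe.
  + by rewrite yS; lra.
  + by lra.
  + have : (L - 1) * sig 0 <= (L - 1) * y (e n) by rewrite ler_pM2l ?subr_gt0//; lra.
    by rewrite yS; lra.
- by move=> n; apply: yhomo; exact: elt.
- by rewrite e0 y0.
- move=> M; have [n Mn] := ylim M; exists n; apply: lt_le_trans Mn _.
  by apply: yhomo; exact: enum_ge.
- move=> n; apply: le_trans (Hd (y (e n))); rewrite lerD2r yS.
  by apply: cumul_homo; rewrite lerD2l.
- move=> A mA; rewrite (@itv_series _ _ A y (fun n => y n.+1))//.
  - apply: (enum_series pe elt elow egap
      (f := fun n => Theta (A `&` `](y n), (y n.+1)]%classic))) => // n pn.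
    by apply: itv_null => //; apply: yhomo.
  - by move=> m n mn; right; exact: yhomo.
  - move=> t; rewrite /= in_itv /= andbT; split => [rt|[n /andP[h1 _]]].
      have ex : exists n, t <= y n by have [n /ltW] := ylim t; exists n.
      case: (ex_minnP ex) => -[|n] nt H; first by move: nt; rewrite y0 leNgt rt.
      exists n; rewrite nt andbT ltNge; apply/negP => /H; rewrite ltnn//.
    exact: le_lt_trans (yr n) h1.
Qed.

End outer_pieces_exist.

(** * Assembly *)

Section assembly.
Context (R : realType) (Theta : probability (measurableTypeR R) R).
Hypothesis Theta_nonneg : Theta [set x : R | 0 <= x] = 1%E.
Hypothesis Theta_atomless : atomless Theta.
Variables (L r0 : R) (sig del : nat -> R).
Hypothesis lad : ladder Theta L r0 sig del.
Variables (a b : nat -> R) (jz : nat -> nat) (win : nat -> option nat).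
Hypothesis ip : inner_pieces Theta L r0 sig del a b jz win.

Local Notation F := (cumul Theta).
Local Notation wm := (win_mass Theta sig del).
Local Notation wa := (sched_wa Theta sig del).
Local Notation wb := (sched_wb Theta sig del).
Local Notation theta l := (F (b l) - F (a l)).

Lemma ip_ab l : a l <= b l.
Proof.
by rewrite leNgt; apply/negP => /ltW/(cumul_homo Theta); rewrite leNgt (ip_mass ip).
Qed.

Lemma ip_homo m n : (m <= n)%N -> b n <= b m.
Proof.
move: m n; apply/nonincreasing_seqP => n.
exact: le_trans (ip_desc ip n) (ip_ab n).
Qed.

Lemma ip_theta l : (theta l)%:E = Theta `](a l), (b l)]%classic.
Proof. by rewrite measure_itvoc// ip_ab. Qed.

(** [tooth_density] with [psi l] the measure of [A] in the piece [l]. Taking for [A] the whole line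
    gives total mass 1, because two points of a tooth separate almost surely. *)
Lemma tooth_law (a0 b0 : R) j0 : F a0 < F b0 ->
  exists B : nat -> R, [/\ forall l, 0 <= B l <= 8 / wm j0,
    forall l, (forall m, win l = Some m -> (m < j0)%N) -> B l = 0,
    (\sum_(l <oo) (B l * theta l)%:E = 1)%E &
    forall (s : R) (A : set (measurableTypeR R)), measurable A ->
      (\sum_(n <oo) (s ^+ 2 * split_mass Theta a0 b0 (wa j0) (wb j0) n /
          (F (wb j0 n) - F (wa j0 n)))%:E *
          Theta (A `&` `](wa j0 n), (wb j0 n)]%classic) =
        \sum_(l <oo) (s ^+ 2 * B l)%:E *
          Theta (A `&` `](a l), (b l)]%classic))%E].
Proof.
move=> ab0; have [B [B8 B0 BE]] := tooth_density Theta_nonneg lad j0 win ab0.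
have winF n : F (wa j0 n) < F (wb j0 n) by exact: (lad_win lad).
have law (A : set (measurableTypeR R)) : measurable A ->
      (\sum_(n <oo) (split_mass Theta a0 b0 (wa j0) (wb j0) n /
          (F (wb j0 n) - F (wa j0 n)))%:E *
          Theta (A `&` `](wa j0 n), (wb j0 n)]%classic) =
        \sum_(l <oo) (B l)%:E * Theta (A `&` `](a l), (b l)]%classic))%E.
  move=> mA; have mI l : measurable (A `&` `](a l), (b l)]%classic : set (measurableTypeR R)).
    by apply: measurableI => //; exact: measurable_itv.
  pose psi l := fine (Theta (A `&` `](a l), (b l)]%classic)).
  have psiE l : (psi l)%:E = Theta (A `&` `](a l), (b l)]%classic).
    by rewrite /psi fineK// fin_num_measure.
  have psi0 l : 0 <= psi l by rewrite -lee_fin psiE measure_ge0.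
  transitivity (\sum_(l <oo) (B l * psi l)%:E)%E; last first.
    by apply: eq_eseriesr => l _; rewrite EFinM psiE.
  rewrite -BE//; apply: eq_eseriesr => n _; congr (_ * _)%E.
  rewrite [LHS](ip_win ip)//; apply: eq_eseriesr => l _.
  by case: ifP => _; rewrite ?psiE.
exists B; split => //; last first.
  move=> s A mA.
  transitivity ((s ^+ 2)%:E *
      \sum_(l <oo) (B l)%:E * Theta (A `&` `](a l), (b l)]%classic))%E.
    rewrite -law// -nneseriesZl; last first.
      move=> n _; rewrite mule_ge0// lee_fin divr_ge0 ?split_mass_ge0//.
      by rewrite subr_ge0 ltW.
    by apply: eq_eseriesr => n _; rewrite muleA -EFinM mulrA.
  rewrite -nneseriesZl; last first.
    by move=> l _; rewrite mule_ge0// lee_fin; have /andP[] := B8 l.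
  by apply: eq_eseriesr => l _; rewrite muleA -EFinM.
transitivity (\sum_(l <oo) (B l)%:E * Theta (setT `&` `](a l), (b l)]%classic))%E.
  by apply: eq_eseriesr => l _; rewrite setTI EFinM ip_theta.
rewrite -law//; have <- := sum_split_mass Theta_nonneg ab0 winF.
apply: eq_eseriesr => n _; rewrite setTI measure_itvoc; last first.
  by rewrite /sched_wa /sched_wb lerDl ltW// (lad_del_gt0 lad).
by rewrite -EFinM divfK// subr_eq0 gt_eqF.
Qed.

Lemma ip_T_lim (e : R) : 0 < e -> exists l, F (b l) < e.
Proof.
move=> e0; have e20 : 0 < e / 2 by rewrite divr_gt0.
have [d d0 Hd] := cumul_uniform Theta_nonneg Theta_atomless e20.
have [l bl] := ip_lim ip d0; exists l.
have := Hd 0; rewrite add0r (cumul0 Theta_nonneg Theta_atomless) subr0.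
by have := cumul_homo Theta (ltW bl); lra.
Qed.

(** Exchanging the sums collects, on each piece [l], the density coming from the pairs with their
    top in the tooth [l] and from the insides of all inner teeth; [inner_balance] says that the
    total is [1 - acc0 l]. *)
Lemma inner_part (M0 : R) (acc0 : nat -> R) :
  0 < M0 -> (forall l, 0 <= acc0 l) -> (forall l, acc0 l <= (1 - M0) / 2) ->
  ((M0 ^+ 2)%:E + \sum_(l <oo) (acc0 l * theta l)%:E = (F r0)%:E)%E ->
  exists M : nat -> R, [/\ M 0 = M0, forall l, 0 < M l.+1 < M l,
    forall e, 0 < e -> exists l, M l < e &
    forall A : set (measurableTypeR R), measurable A ->
      (\sum_(i <oo)
       ((2 * M i.+1 * (M i - M i.+1) / theta i)%:E *
          Theta (A `&` `](a i), (b i)]%classic) +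
        \sum_(n <oo) ((M i - M i.+1) ^+ 2 *
            split_mass Theta (a i) (b i) (wa (jz i)) (wb (jz i)) n /
            (F (wb (jz i) n) - F (wa (jz i) n)))%:E *
          Theta (A `&` `](wa (jz i) n), (wb (jz i) n)]%classic)) =
       \sum_(l <oo) (1 - acc0 l)%:E * Theta (A `&` `](a l), (b l)]%classic))%E].
Proof.
move=> M00 acc00 acc0M M0sum.
have [B HB] := choice (fun i => tooth_law (jz i) (ip_mass ip i)).
have B0 k l : 0 <= B k l by have [/(_ l)/andP[]] := HB k.
have K0 l : 0 <= 8 / wm (jz l) by rewrite divr_ge0// ltW// (win_mass_gt0 lad).
have th0 l : 0 < theta l by rewrite subr_gt0 (ip_mass ip).
have thE l : theta l = F (b l) - F (b l.+1) by rewrite (ip_cumul ip).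
have BK k l : B k l <= 8 / wm (jz k) by have [/(_ l)/andP[]] := HB k.
have Blow k l : (l <= k)%N -> B k l = 0.
  by have [_ H _ _] := HB k => lk; apply: H => m; exact: (ip_win_lt ip lk).
have Bsum k : (\sum_(l <oo) (B k l * theta l)%:E = 1)%E by have [] := HB k.
rewrite -(ip_cumul0 ip) in M0sum.
have T0 l : 0 <= F (b l) by exact: cumul_ge0.
pose M := inner_M (fun l => theta l) B M0 acc0.
have bal := inner_balance th0 thE T0 K0 (ip_small ip) (ip_smallK ip) B0 BK
  Blow Bsum M00 acc00 acc0M M0sum.
have Mpos := inner_M_gt0 th0 thE T0 K0 (ip_small ip) (ip_smallK ip) B0 BK
  Blow Bsum M00 acc00 acc0M M0sum.
have Mlt := inner_M_lt th0 thE T0 K0 (ip_small ip) (ip_smallK ip) B0 BK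
  Blow Bsum M00 acc00 acc0M M0sum.
have Mlim := inner_M_lim th0 thE T0 ip_T_lim K0 (ip_small ip) (ip_smallK ip) B0 BK
  Blow Bsum M00 acc00 acc0M M0sum.
rewrite -/M in bal Mpos Mlt Mlim; exists M; split => //.
  by move=> l; rewrite Mpos Mlt.
move=> A mA; pose m l := Theta (A `&` `](a l), (b l)]%classic).
have m0 l : (0 <= m l)%E by exact: measure_ge0.
pose c i := 2 * M i.+1 * (M i - M i.+1) / theta i.
have c0 i : 0 <= c i.
  by rewrite divr_ge0 ?(ltW (th0 i))// mulr_ge0 ?subr_ge0 ?(ltW (Mlt i))// mulr_ge0 ?(ltW (Mpos _)).
transitivity (\sum_(i <oo) ((c i)%:E * m i +
    \sum_(l <oo) (((M i - M i.+1) ^+ 2 * B i l)%:E * m l)))%E.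
  apply: eq_eseriesr => i _; congr (_ + _)%E.
  by have [_ _ _ ->] := HB i.
have sB i l : (0 <= ((M i - M i.+1) ^+ 2 * B i l)%:E * m l)%E.
  by rewrite mule_ge0// lee_fin mulr_ge0// sqr_ge0.
rewrite nneseriesD; last 2 first.
- by move=> i _ _; rewrite mule_ge0// lee_fin.
- by move=> i _ _; apply: nneseries_ge0 => l _ _.
rewrite nneseries_interchange// -nneseriesD; last 2 first.
- by move=> i _ _; rewrite mule_ge0// lee_fin.
- by move=> i _ _; apply: nneseries_ge0 => l _ _.
apply: eq_eseriesr => l _.
transitivity ((c l)%:E * m l + m l * \sum_(i <oo) ((M i - M i.+1) ^+ 2 * B i l)%:E)%E.
  congr (_ + _)%E; have ml : m l \is a fin_num.
    by rewrite fin_num_measure//; apply: measurableI => //; exact: measurable_itv.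
  rewrite -(fineK ml) -nneseriesZl; last first.
    by move=> i _; rewrite lee_fin mulr_ge0// sqr_ge0.
  by apply: eq_eseriesr => i _; rewrite muleC.
rewrite bal muleC -muleDr//; last first.
  by rewrite fin_num_measure//; apply: measurableI => //; exact: measurable_itv.
by rewrite muleC; congr (_ * _)%E; rewrite -EFinD; congr (_%:E); rewrite /c; ring.
Qed.

End assembly.

Lemma nneseries_parity (R : realType) (f : nat -> \bar R) :
  (forall n, (0 <= f n)%E) ->
  (\sum_(n <oo) f n = \sum_(n <oo) f n.*2 + \sum_(n <oo) f n.*2.+1)%E.
Proof.
move=> f0.
have -> : (\sum_(n <oo) f n.*2 = \sum_(n <oo) if odd n then 0 else f n)%E.
  rewrite [RHS](@enum_series (fun n => ~~ odd n) double)//.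
  - by apply: eq_eseriesr => n _; rewrite odd_double.
  - by move=> n; rewrite odd_double.
  - move=> l n /andP[h1 h2]; rewrite negbK.
    have -> : n = l.*2.+1 by rewrite doubleS in h2; lia.
    by rewrite /= odd_double.
  - by move=> n; case: ifP.
  - by move=> n; rewrite negbK => ->.
have -> : (\sum_(n <oo) f n.*2.+1 = \sum_(n <oo) if odd n then f n else 0)%E.
  rewrite [RHS](@enum_series odd (fun n => n.*2.+1))//.
  - by apply: eq_eseriesr => n _; rewrite /= odd_double.
  - by move=> n; rewrite /= odd_double.
  - by move=> n /=; rewrite ltnS leqn0 => /eqP ->.
  - move=> l n /andP[h1 h2].
    have -> : n = l.+1.*2 by rewrite doubleS in h2 *; lia.
    by rewrite odd_double.
  - by move=> n; case: ifP.
  - by move=> n; case: ifP.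
rewrite -nneseriesD; last 2 first.
- by move=> n _ _; case: ifP.
- by move=> n _ _; case: ifP.
by apply: eq_eseriesr => n _; case: ifP => _; rewrite ?adde0 ?add0e.
Qed.

(** * Teeth above [r0] *)

Section outer_part.
Context (R : realType) (Theta : probability (measurableTypeR R) R).
Hypothesis Theta_nonneg : Theta [set x : R | 0 <= x] = 1%E.
Hypothesis Theta_atomless : atomless Theta.
Variables (L r0 : R) (sig del : nat -> R).
Hypothesis lad : ladder Theta L r0 sig del.
Variables (a b : nat -> R) (jz : nat -> nat) (win : nat -> option nat).
Hypothesis ip : inner_pieces Theta L r0 sig del a b jz win.
Variables a' b' : nat -> R.
Hypothesis op : outer_pieces Theta L r0 sig del a' b'.
Hypothesis r0_large : 3 / 4 <= cumul Theta r0.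

Local Notation F := (cumul Theta).
Local Notation wm := (win_mass Theta sig del).
Local Notation wa := (sched_wa Theta sig del).
Local Notation wb := (sched_wb Theta sig del).

Lemma op_ab n : a' n <= b' n.
Proof.
by rewrite leNgt; apply/negP => /ltW/(cumul_homo Theta); rewrite leNgt (op_mass op).
Qed.

Lemma op_homo m n : (m <= n)%N -> a' m <= a' n.
Proof.
move: m n; apply/nondecreasing_seqP => n.
exact: le_trans (op_ab n) (op_asc op n).
Qed.

Lemma op_tail_lim : 1 - F (a' n) @[n --> \oo] --> (0 : R).
Proof.
apply/cvgrPdist_lt => e e0; have e1 : 1 - e < 1 by rewrite gtrBl.
have [y ey] := cumul_lim Theta_nonneg Theta_atomless e1.
have [N yN] := op_lim op y; exists N => // n /= Nn.
have h1 := cumul_le1 Theta (a' n).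
have h2 : F y <= F (a' n).
  by apply: cumul_homo; apply: le_trans (ltW yN) _; exact: op_homo.
by rewrite sub0r normrN ger0_norm; lra.
Qed.

(** [acc l] is the density that the insides of all the outer teeth use on the inner piece [l]. A
    tooth of mass s contributes at most s / 2, and the outer masses add up to [1 - G 0], which is
    the bound the inner recursion asks of its initial density. *)
Lemma outer_part : exists G acc : nat -> R, [/\
  forall n, 0 < G n < G n.+1,
  forall t, t < 1 -> exists n, t <= G n,
  forall n, G n < 1,
  (forall l, 0 <= acc l <= (1 - G 0) / 2) /\
  ((G 0 ^+ 2)%:E + \sum_(l <oo) (acc l * (F (b l) - F (a l)))%:E =
    (F r0)%:E)%E &
  forall A : set (measurableTypeR R), measurable A ->
    (\sum_(i <oo)
      ((2 * G i * (G i.+1 - G i) / (F (b' i) - F (a' i)))%:E *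
          Theta (A `&` `](a' i), (b' i)]%classic) +
        \sum_(n <oo) ((G i.+1 - G i) ^+ 2 *
            split_mass Theta (a' i) (b' i) (wa 0) (wb 0) n /
            (F (wb 0 n) - F (wa 0 n)))%:E *
          Theta (A `&` `](wa 0 n), (wb 0 n)]%classic)) =
      \sum_(n <oo) Theta (A `&` `](a' n), (b' n)]%classic) +
      \sum_(l <oo) (acc l)%:E * Theta (A `&` `](a l), (b l)]%classic))%E].
Proof.
have th0 n : 0 < F (b' n) - F (a' n) by rewrite subr_gt0 (op_mass op).
have thE n : F (b' n) - F (a' n) = (1 - F (a' n)) - (1 - F (a' n.+1)).
  by rewrite (op_cumul op); ring.
have tau0 n : 0 <= 1 - F (a' n) by rewrite subr_ge0 cumul_le1.
have tau1 : 1 - F (a' 0) <= 4^-1 by rewrite (op_cumul0 op); move: r0_large; lra.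
have [G [Glt G1 Gprod Glim Gsum]] := outer_masses_exist th0 thE tau0 tau1 op_tail_lim.
have G0 n : 0 < G n by have /andP[h _] := Glt n; lra.
have s0 n : 0 < G n.+1 - G n by rewrite subr_gt0; have /andP[] := Glt n.
have [B HB] := choice (fun n => tooth_law Theta_nonneg lad ip 0 (op_mass op n)).
have B0 n l : 0 <= B n l by have [/(_ l)/andP[]] := HB n.
have w0 := win_mass_gt0 lad 0.
(* Since [G n] is at least 1/2, the mass of the tooth is at most that of its piece, to which
   [op_small] applies. *)
have sB n l : (G n.+1 - G n) ^+ 2 * B n l <= (G n.+1 - G n) / 2.
  rewrite expr2 -mulrA ler_pM2l//; apply: (@le_trans _ _ ((wm 0 / 16) * (8 / wm 0))).
    apply: ler_pM => //; [exact: ltW | | by have [/(_ l)/andP[]] := HB n].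
    apply: le_trans (op_small op n); rewrite -Gprod.
    have : 0 <= (G n.+1 - G n) * (2 * G n - 1).
      by rewrite mulr_ge0 ?(ltW (s0 n))//; have /andP[h _] := Glt n; lra.
    by lra.
  by rewrite le_eqVlt; apply/orP; left; apply/eqP; field; rewrite gt_eqF.
have sB0 n l : 0 <= (G n.+1 - G n) ^+ 2 * B n l by rewrite mulr_ge0 ?sqr_ge0.
pose acce l := (\sum_(n <oo) ((G n.+1 - G n) ^+ 2 * B n l)%:E)%E.
have acce0 l : (0 <= acce l)%E.
  by apply: nneseries_ge0 => n _ _; rewrite lee_fin.
have acce1 l : (acce l <= ((1 - G 0) / 2)%:E)%E.
  apply: lime_le; first by apply: is_cvg_nneseries => n _ _; rewrite lee_fin.
  apply: nearW => n; rewrite sumEFin lee_fin.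
  apply: (@le_trans _ _ (\sum_(0 <= i < n) (G i.+1 - G i) / 2)).
    by apply: ler_sum => i _.
  by rewrite -mulr_suml telescope_sumr// ler_pM2r// lerD2r ltW.
have accfin l : acce l \is a fin_num.
  by rewrite ge0_fin_numE//; apply: le_lt_trans (acce1 l) _; rewrite ltry.
exists G, (fine \o acce); split => //.
- by move=> n; rewrite G0; have /andP[] := Glt n.
- move=> t t1; have e0 : 0 < 1 - t by rewrite subr_gt0.
  have /cvgrPdist_lt/(_ _ e0)[N _ /(_ N (leqnn N)) /=] := Glim.
  by move=> /(le_lt_trans (ler_norm _)) h; exists N; move: h; lra.
- split; first by move=> l; rewrite -!lee_fin /= fineK// acce0 acce1.
  have -> : (\sum_(l <oo) ((fine \o acce) l * (F (b l) - F (a l)))%:E =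
      \sum_(n <oo) ((G n.+1 - G n) ^+ 2)%:E)%E.
    transitivity (\sum_(l <oo) \sum_(n <oo)
        ((G n.+1 - G n) ^+ 2 * (B n l * (F (b l) - F (a l))))%:E)%E.
      apply: eq_eseriesr => l _; rewrite EFinM /= fineK// muleC -nneseriesZl; last first.
        by move=> n _; rewrite lee_fin.
      by apply: eq_eseriesr => n _; rewrite -EFinM; congr (_%:E); ring.
    rewrite nneseries_interchange; last first.
      move=> l n; rewrite lee_fin mulr_ge0 ?sqr_ge0// mulr_ge0// subr_ge0.
      by rewrite ltW// (ip_mass ip).
    apply: eq_eseriesr => n _; have [_ _ Bs _] := HB n.
    rewrite -[RHS]mule1 -Bs -nneseriesZl//.
    by move=> l _; rewrite lee_fin mulr_ge0// subr_ge0 ltW// (ip_mass ip).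
  by rewrite Gsum -EFinD (op_cumul0 op); congr (_%:E); ring.
move=> A mA; pose m l := Theta (A `&` `](a l), (b l)]%classic).
have m0 l : (0 <= m l)%E by exact: measure_ge0.
transitivity (\sum_(i <oo) (Theta (A `&` `](a' i), (b' i)]%classic) +
    \sum_(l <oo) (((G i.+1 - G i) ^+ 2 * B i l)%:E * m l)))%E.
  apply: eq_eseriesr => i _; congr (_ + _)%E.
    rewrite [2 * G i * _]mulrAC Gprod divff ?mul1e// gt_eqF//.
  by have [_ _ _ ->] := HB i.
have sBm i l : (0 <= ((G i.+1 - G i) ^+ 2 * B i l)%:E * m l)%E.
  by rewrite mule_ge0// lee_fin.
rewrite nneseriesD; last 2 first.
- by move=> i _ _.
- by move=> i _ _; apply: nneseries_ge0 => l _ _.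
rewrite nneseries_interchange//; congr (_ + _)%E; apply: eq_eseriesr => l _.
have ml : m l \is a fin_num.
  by rewrite fin_num_measure//; apply: measurableI => //; exact: measurable_itv.
rewrite /= fineK// -/(m l) [RHS]muleC -(fineK ml) -nneseriesZl; last first.
  by move=> i _; rewrite lee_fin.
by apply: eq_eseriesr => i _; rewrite muleC.
Qed.

End outer_part.

Lemma measure_split (R : realType) (Theta : probability (measurableTypeR R) R)
    (r : R) (A : set (measurableTypeR R)) :
  Theta [set x : R | 0 <= x] = 1%E -> atomless Theta -> 0 <= r -> measurable A ->
  (Theta A = Theta (A `&` `]0%R, r]%classic) + Theta (A `&` `]r, +oo[%classic))%E.
Proof.
move=> nn al r0 mA; pose K : set (measurableTypeR R) := `]-oo, 0]%classic.
pose I : set (measurableTypeR R) := `]0, r]%classic.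
pose J : set (measurableTypeR R) := `]r, +oo[%classic.
have mK : measurable K by exact: measurable_itv.
have mI : measurable I by exact: measurable_itv.
have mJ : measurable J by exact: measurable_itv.
have K0 : Theta K = 0%E by rewrite -cumulE (cumul0 nn al).
rewrite -/I -/J; have AE : A = (A `&` K) `|` ((A `&` I) `|` (A `&` J)).
  rewrite -!setIUr; apply/esym/setIidPl => x _; rewrite /I /J /K /= !in_itv /= andbT.
  by case: (leP x 0) => x0; [left|right; case: (leP x r) => xr; [left|right]].
transitivity (Theta (A `&` K) + Theta ((A `&` I) `|` (A `&` J)))%E.
  rewrite {1}AE; apply: measureU; first exact: measurableI.
    by apply: measurableU; exact: measurableI.
  rewrite -setIUr setIACA setIid -subset0 => x [_]; rewrite /K /I /J /=.
  rewrite !in_itv /= andbT => -[x0 [/andP[x1 _]|x1]].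
    by move: x1; rewrite ltNge x0.
  by move: (le_lt_trans r0 x1); rewrite ltNge x0.
have -> : Theta (A `&` K) = 0%E.
  apply/eqP; rewrite eq_le measure_ge0 andbT -K0.
  by apply: le_measure; rewrite ?inE//; apply: measurableI.
rewrite add0e; apply: measureU; [exact: measurableI|exact: measurableI|].
rewrite setIACA setIid -subset0 => x [_]; rewrite /I /J /=.
by rewrite !in_itv /= andbT => -[/andP[_ x0]]; rewrite ltNge x0.
Qed.

(** * Construction of the skeletons *)

Section skeletons.
Context (R : realType) (Theta : probability (measurableTypeR R) R).
Hypothesis Theta_nonneg : Theta [set x : R | 0 <= x] = 1%E.
Hypothesis Theta_atomless : atomless Theta.
Hypothesis Theta_supp0 : msupp (Theta : set R -> \bar R) 0.
Variable L : R.
Hypotheses (L1 : 1 < L) (L2 : L <= 2).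
Local Notation F := (cumul Theta).

(** All the mass of [Theta] lies below [r0], so the inner recursion starts with total mass 1 and
    nothing used. The tooth [l] sits above the mass [M l.+1] of the smaller ones. *)
Lemma bounded_skeleton (r0 : R) : 0 < r0 -> F r0 = 1 ->
  exists k : skeleton Theta L,
    forall r : R, 0 < r -> exists N, forall i, (N <= i)%N -> sk_b k i < r.
Proof.
move=> r00 Fr0.
have [sig [del lad]] := ladder_exists Theta_nonneg Theta_atomless Theta_supp0 L1 r00.
have [a [b [jz [win ip]]]] :=
  inner_pieces_exist Theta_nonneg Theta_atomless Theta_supp0 L1 lad.
have [||||M [M0 Mlt Mlim law]] := inner_part Theta_nonneg Theta_atomless lad ip
  (M0 := 1) (acc0 := fun=> 0) => //.
  by rewrite eseries0 ?adde0 ?expr1n ?Fr0// => l _ _; rewrite mul0r.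
have Mp l : 0 < M l.
  by have /andP[h1 h2] := Mlt l; exact: lt_trans h2.
have Mhomo m n : (m <= n)%N -> M n <= M m.
  by move: m n; apply/nonincreasing_seqP => n; have /andP[_ /ltW] := Mlt n.
have small r : 0 < r -> exists N, forall i, (N <= i)%N -> b i < r.
  move=> /(ip_lim ip)[N Nr]; exists N => i Ni; apply: le_lt_trans Nr.
  exact: ip_homo ip _ _ Ni.
have Ps l : M l.+1 + (M l - M l.+1) = M l by ring.
have ord i j : (i < j)%N -> b j <= a i /\ M j.+1 + (M j - M j.+1) <= M i.+1.
  move=> ij; rewrite Ps; split; last exact: Mhomo.
  by apply: le_trans (ip_homo ip ij) _; exact: ip_desc ip _.
unshelve eexists.
  apply: (@Skeleton _ Theta L a b
    (fun i => sched_wa Theta sig del (jz i)) (fun i => sched_wb Theta sig del (jz i))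
    (fun l => M l.+1) (fun l => M l - M l.+1)) => //.
  - exact: ltW.
  - exact: ip_adm ip.
  - by move=> r K r1; have [N HN] := small _ r1; exists N => i /HN; left.
  - by move=> r /(ip_lim ip).
  - move=> i j; rewrite neq_ltn => /orP[/ord|/ord]; [right|left] => //.
  - by move=> l; exact: ltW.
  - by move=> l; rewrite subr_gt0; have /andP[] := Mlt l.
  - by move=> l; rewrite Ps -M0 Mhomo.
  - move=> t /andP[t0 t1].
    have ex : exists n, M n < t by exact: Mlim.
    case: (ex_minnP ex) => -[|n] nt H; first by move: nt; rewrite M0 ltNge (ltW t1).
    exists n; rewrite Ps nt leNgt; apply/negP => /H; rewrite ltnn//.
  - move=> A mA; rewrite [RHS]law//.
    rewrite [LHS](measure_split Theta_nonneg Theta_atomless (ltW r00) mA).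
    pose J : set (measurableTypeR R) := `]r0, +oo[%classic.
    have mJ : measurable J by exact: measurable_itv.
    have J0 : Theta J = 0%E.
      by rewrite /J -setCitvl probability_setC ?measurable_itv// -cumulE Fr0 subee.
    have -> : Theta (A `&` J) = 0%E.
      apply/eqP; rewrite eq_le measure_ge0 andbT -J0.
      by apply: le_measure; rewrite ?inE//; exact: measurableI.
    rewrite adde0 [LHS](ip_series ip)//; apply: eq_eseriesr => l _.
    by rewrite subr0 mul1e.
exact: small.
Qed.

(** Inner teeth get the even indices and outer teeth the odd ones. The inner recursion starts from
    the mass [G 0] left below [r0], with the density [acc] already used by the outer teeth. *)
Lemma unbounded_skeleton : (forall M, F M < 1) ->
  exists k : skeleton Theta L,
  (forall r : R, 0 < r -> exists N, forall i, (N <= i)%N -> sk_b k i.*2 < r) /\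
  (exists2 r, 0 < r & forall i, r <= sk_a k i.*2.+1).
Proof.
move=> Theta_unbounded.
(* The level 3/4 leaves a tail of at most 1/4, as the outer recursion requires. *)
have [y Fy] := cumul_lim Theta_nonneg Theta_atomless (ltac:(lra) : (3 / 4 : R) < 1).
pose r0 := Num.max y 1; have r00 : 0 < r0 by rewrite lt_max ltr01 orbT.
have Fr0 : 3 / 4 <= F r0.
  by apply: le_trans (ltW Fy) _; apply: cumul_homo; rewrite le_max lexx.
have [sig [del lad]] := ladder_exists Theta_nonneg Theta_atomless Theta_supp0 L1 r00.
have [a [b [jz [win ip]]]] :=
  inner_pieces_exist Theta_nonneg Theta_atomless Theta_supp0 L1 lad.
have [a' [b' op]] := outer_pieces_exist Theta_nonneg Theta_atomless L1 lad Theta_unbounded.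
have [G [acc [Glt Gcov G1 [accb accsum] lawG]]] :=
  outer_part Theta_nonneg Theta_atomless lad ip op Fr0.
have G0 : 0 < G 0%N by have /andP[] := Glt 0%N.
have [||||M [M0 Mlt Mlim law]] := inner_part Theta_nonneg Theta_atomless lad ip
  (M0 := G 0%N) (acc0 := acc) => //.
- by move=> l; have /andP[] := accb l.
- by move=> l; have /andP[] := accb l.
have Mp l : 0 < M l.
  by have /andP[h1 h2] := Mlt l; exact: lt_trans h2.
have Mhomo m n : (m <= n)%N -> M n <= M m.
  by move: m n; apply/nonincreasing_seqP => n; have /andP[_ /ltW] := Mlt n.
have Ghomo m n : (m <= n)%N -> G m <= G n.
  by move: m n; apply/nondecreasing_seqP => n; have /andP[_ /ltW] := Glt n.
have small r : 0 < r -> exists N, forall i, (N <= i)%N -> b i < r.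
  move=> /(ip_lim ip)[N Nr]; exists N => i Ni; apply: le_lt_trans Nr.
  exact: ip_homo ip _ _ Ni.
have large K : exists N, forall i, (N <= i)%N -> K < a' i.
  have [N KN] := op_lim op K; exists N => i Ni; apply: lt_le_trans KN _.
  exact: op_homo op _ _ Ni.
pose ta i := if odd i then a' i./2 else a i./2.
pose tb i := if odd i then b' i./2 else b i./2.
pose tj i := if odd i then 0%N else jz i./2.
pose P i : R := if odd i then G i./2 else M i./2.+1.
pose s i : R := if odd i then G i./2.+1 - G i./2 else M i./2 - M i./2.+1.
have Ps i : P i + s i = if odd i then G i./2.+1 else M i./2.
  by rewrite /P /s; case: ifP => _; ring.
have half2 i : i.*2.+1./2 = i by rewrite /= uphalf_double.
(* The hypothesis selects one order for each pair of distinct indices; the other order follows by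
   symmetry of the conclusion. *)
have ord i j : (i./2 < j./2)%N \/ [/\ i./2 = j./2, odd i & ~~ odd j] \/
    [/\ (j./2 <= i./2)%N, ~~ odd i & odd j] ->
    (tb i <= ta j /\ P i + s i <= P j) \/ (tb j <= ta i /\ P j + s j <= P i).
  have mix m n : b m <= a' n /\ M m <= G n.
    split; last by apply: le_trans (Mhomo _ _ (leq0n m)) _; rewrite M0 Ghomo.
    apply: le_trans (ip_homo ip (leq0n m)) _; apply: le_trans (ip_top ip) _.
    by apply: le_trans (op_bot op) _; exact: (op_homo op).
  have inn m n : (m < n)%N -> b n <= a m /\ M n <= M m.+1.
    move=> mn; split; last exact: Mhomo.
    by apply: le_trans (ip_homo ip mn) _; exact: ip_desc ip _.
  have out m n : (m < n)%N -> b' m <= a' n /\ G m.+1 <= G n.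
    move=> mn; split; last exact: Ghomo.
    by apply: le_trans (op_asc op m) _; exact: (op_homo op).
  rewrite !Ps /ta /tb /P; case: (boolP (odd i)) => io; case: (boolP (odd j)) => jo.
  - by move=> [/out|[[]|[]]] //; left.
  - by move=> _; right; exact: mix.
  - by move=> _; left; exact: mix.
  - by move=> [/inn|[[]|[]]] //; right.
unshelve eexists.
  apply: (@Skeleton _ Theta L ta tb
    (fun i => sched_wa Theta sig del (tj i)) (fun i => sched_wb Theta sig del (tj i))
    P s) => //.
  - exact: ltW.
  - by move=> i; rewrite /ta /tb /tj; case: ifP => _; [exact: op_adm op _|exact: ip_adm ip _].
  - move=> r K r1; have [N1 HN1] := small _ r1; have [N2 HN2] := large K.
    exists (maxn N1 N2).*2 => i; rewrite -geq_half_double geq_max => /andP[h1 h2].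
    by rewrite /ta /tb; case: ifP => _; [right; exact: HN2|left; exact: HN1].
  - by move=> r /(ip_lim ip)[l bl]; exists l.*2; rewrite /tb odd_double doubleK.
  - move=> i j ij.
    have H : i./2 = j./2 -> odd i = odd j -> False.
      move=> h1 h2; move/eqP: ij; apply.
      by rewrite -(odd_double_half i) -(odd_double_half j) h1 h2.
    have [h|h|h] := ltngtP i./2 j./2.
    + by apply: ord; left.
    + by apply/or_comm/ord; left.
    + case: (boolP (odd i)) => io; case: (boolP (odd j)) => jo.
      * by case: (H h); rewrite io jo.
      * by apply: ord; right; left.
      * by apply: ord; right; right; rewrite h leqnn.
      * by case: (H h); rewrite (negbTE io) (negbTE jo).
  - by move=> i; rewrite /P; case: ifP => _; [apply: le_trans (ltW G0) (Ghomo _ _ _)|exact: ltW].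
  - move=> i; rewrite /s; case: ifP => _; rewrite subr_gt0.
      by have /andP[] := Glt i./2.
    by have /andP[] := Mlt i./2.
  - move=> i; rewrite Ps; case: ifP => _; first exact: ltW.
    by apply: le_trans (Mhomo _ _ (leq0n _)) _; rewrite M0 ltW.
  - move=> t /andP[t0 t1]; have [tM|tM] := leP t (M 0%N).
      have ex : exists n, M n < t by exact: Mlim.
      case: (ex_minnP ex) => -[|n] nt H; first by move: nt; rewrite ltNge tM.
      exists n.*2; rewrite Ps /P odd_double doubleK nt leNgt.
      by apply/negP => /H; rewrite ltnn.
    have ex := Gcov _ t1.
    case: (ex_minnP ex) => -[|n] nt H; first by move: tM; rewrite M0 ltNge nt.
    exists n.*2.+1; rewrite Ps /P half2 /= odd_double /= nt andbT ltNge.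
    by apply/negP => /H; rewrite ltnn.
  - move=> A mA; rewrite [RHS]nneseries_parity; last first.
      move=> i; rewrite adde_ge0//.
        rewrite mule_ge0// lee_fin divr_ge0//.
          rewrite mulr_ge0//; last first.
            rewrite /s; case: ifP => _; rewrite subr_ge0 ltW//.
              by have /andP[] := Glt i./2.
            by have /andP[] := Mlt i./2.
          rewrite mulr_ge0//.
          by rewrite /P; case: ifP => _; [apply: le_trans (ltW G0) (Ghomo _ _ _)|exact: ltW].
        rewrite subr_ge0 ltW// /ta /tb.
        by case: ifP => _; [exact: op_mass op _|exact: ip_mass ip _].
      apply: nneseries_ge0 => n _ _; rewrite mule_ge0// lee_fin divr_ge0//.
        rewrite mulr_ge0 ?sqr_ge0//; apply: split_mass_ge0 => //.
          by rewrite /ta /tb; case: ifP => _; [exact: op_mass op _|exact: ip_mass ip _].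
        by move=> q; exact: (lad_win lad).
      by rewrite subr_ge0 ltW//; exact: (lad_win lad).
    pose I : set (measurableTypeR R) := `]0, r0]%classic.
    pose J : set (measurableTypeR R) := `]r0, +oo[%classic.
    have mI : measurable I by exact: measurable_itv.
    have mJ : measurable J by exact: measurable_itv.
    transitivity (Theta (A `&` I) + Theta (A `&` J))%E.
      exact: (measure_split Theta_nonneg Theta_atomless (ltW r00) mA).
    have evE := law A mA; have odE := lawG A mA.
    transitivity (\sum_(l <oo) (1 - acc l)%:E * Theta (A `&` `](a l), (b l)]%classic) +
      (\sum_(n <oo) Theta (A `&` `](a' n), (b' n)]%classic) +
      \sum_(l <oo) (acc l)%:E * Theta (A `&` `](a l), (b l)]%classic)))%E; last first.
      have sumE := f_equal2 (@adde R) (esym evE) (esym odE).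
      refine (etrans sumE _); apply: f_equal2; apply: eq_eseriesr => i _.
        by rewrite /P /s /ta /tb /tj odd_double doubleK.
      by rewrite /P /s /ta /tb /tj half2 /= odd_double.
    have -> : Theta (A `&` I) = _ := ip_series ip mA.
    have -> : Theta (A `&` J) = _ := op_series op mA.
    (* On an inner piece the densities [1 - acc l] and [acc l] add up to 1. *)
    rewrite [RHS]addeCA addeC; congr (_ + _)%E; rewrite -nneseriesD; last 2 first.
    - move=> l _ _; rewrite mule_ge0// lee_fin.
      by have /andP[_] := accb l; have := G1 0%N; move=> h1 h2; lra.
    - by move=> l _ _; rewrite mule_ge0// lee_fin; have /andP[] := accb l.
    apply: eq_eseriesr => l _; rewrite -muleDl//; last first.
      by rewrite fin_num_measure//; apply: measurableI => //; exact: measurable_itv.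
    by rewrite -EFinD subrK mul1e.
split.
  move=> r /small[N HN]; exists N => i Ni /=.
  by rewrite /tb odd_double doubleK; exact: HN.
exists r0 => // i /=; rewrite /ta /= odd_double /= uphalf_double.
by apply: le_trans (op_bot op) _; exact: (op_homo op).
Qed.

End skeletons.

Theorem corollary6p1 (R : realType)
    (Theta : probability (measurableTypeR R) R)
    (Theta_nonneg : Theta [set x : R | 0 <= x] = 1%E)
    (Theta_atomless : atomless Theta)
    (Theta_supp0 : msupp (Theta : set R -> \bar R) 0)
    (L : R) (L_gt1 : 1 < L) :
  [/\ exists (S : completeMetricType R) (mu : probability (borel S) R),
        full_ultrametric_realisation L Theta mu,
      bounded_set (msupp (Theta : set R -> \bar R)) ->
      exists (S : completeMetricType R) (mu : probability (borel S) R),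
        [/\ full_ultrametric_realisation L Theta mu,
            compact [set: S],
            homeomorphic S cantor_space,
            dist_set S = msupp (Theta : set R -> \bar R) &
            exists2 m : R, is_maximum (msupp (Theta : set R -> \bar R)) m &
              diam S = m%:E] &
      ~ bounded_set (msupp (Theta : set R -> \bar R)) ->
      exists (S : completeMetricType R) (mu : probability (borel S) R),
        [/\ full_ultrametric_realisation L Theta mu,
            proper_space S &
            homeomorphic S {n : nat & cantor_space}]].
Proof.
(* The triangle inequality in the trees uses a factor at most 2, and the conclusion for a smaller
   factor implies that for [L]. *)
pose L' := Num.min L 2.
have L'1 : 1 < L' by rewrite lt_min L_gt1/=; lra.
have L'2 : L' <= 2 by rewrite ge_min lexx orbT.
have L'L : L' <= L by rewrite ge_min lexx.
have bdd : bounded_set (msupp (Theta : set R -> \bar R)) ->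
    exists (S : completeMetricType R) (mu : probability (borel S) R),
      [/\ full_ultrametric_realisation L Theta mu,
          compact [set: S],
          homeomorphic S cantor_space,
          dist_set S = msupp (Theta : set R -> \bar R) &
          exists2 m : R, is_maximum (msupp (Theta : set R -> \bar R)) m &
            diam S = m%:E].
  move=> bd; have [r0 r00 Fr0] := bounded_msupp_cumul Theta_nonneg Theta_atomless bd.
  have [k ksmall] := bounded_skeleton Theta_nonneg Theta_atomless Theta_supp0 L'1 L'2 r00 Fr0.
  have cpt := sk_compact (k := k) bd.
  exists (comb_space (sk_comb k)), (sk_prob k); split => //.
  - exact: sk_full.
  - exact: comb_homeo_cantor.
  - exact: (dist_set_msupp (sk_realisation k) (sk_msupp k) cpt).
  - exact: (diam_max (sk_realisation k) (sk_msupp k) cpt).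
have unbdd : ~ bounded_set (msupp (Theta : set R -> \bar R)) ->
    exists (S : completeMetricType R) (mu : probability (borel S) R),
      [/\ full_ultrametric_realisation L Theta mu,
          proper_space S &
          homeomorphic S {n : nat & cantor_space}].
  move=> unb; have F1 := unbounded_msupp_cumul Theta_nonneg unb.
  have [k [ksmall kfar]] := unbounded_skeleton Theta_nonneg Theta_atomless Theta_supp0 L'1 L'2 F1.
  exists (comb_space (sk_comb k)), (sk_prob k); split.
  - exact: sk_full.
  - exact: comb_proper.
  - exact: comb_homeo_sum.
split => //; have [/bdd|/unbdd] := pselect (bounded_set (msupp (Theta : set R -> \bar R))).
- by move=> [S [mu [H _ _ _ _]]]; exists S, mu.
- by move=> [S [mu [H _ _]]]; exists S, mu.
Qed.
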